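(* Let $\mathfrak g$ be an untwisted affine Lie superalgebra such that the Dynkin diagram of $\mathfrak g_{\bar 0}$ is connected, and let $k$ be a non-negative integer. Then every non-zero positive energy $V_k(\mathfrak g)$-module contains a singular vector (a non-zero vector $v$ such that $\mathfrak n v=0$). In particular, the irreducible positive energy $V_k(\mathfrak g)$-modules are $\mathfrak g$-integrable highest weight modules of level $k$.
   Context: $\mathfrak g=\dot{\mathfrak g}^{(1)}=\dot{\mathfrak g}\otimes\mathbb C[t^{\pm1}]\oplus\mathbb CK\oplus\mathbb Cd$ is the affinization of a finite-dimensional Kac–Moody Lie superalgebra $\dot{\mathfrak g}$ with $\mathfrak g_{\bar1}\ne0$, with $[d,at^s]=s\,at^s$ and Cartan subalgebra $\mathfrak h=\dot{\mathfrak h}\oplus\mathbb CK\oplus\mathbb Cd$. The Dynkin diagram of $\mathfrak g_{\bar0}$ is connected exactly when $\mathfrak g$ is $\mathfrak{sl}(1|n)^{(1)}$ or $\mathfrak{osp}(n|m)^{(1)}$ with $n=1,2$. In this case let $\dot{\mathfrak g}^{\#}$ be the simple Lie algebra $[\dot{\mathfrak g}_{\bar0},\dot{\mathfrak g}_{\bar0}]$; the invariant form is normalized by $(\alpha,\alpha)=2$ for the longest root $\alpha$ of $\dot{\mathfrak g}^{\#}$. Given a triangular decomposition $\dot{\mathfrak g}=\dot{\mathfrak n}^-\oplus\dot{\mathfrak h}\oplus\dot{\mathfrak n}$, put $\mathfrak n=\dot{\mathfrak n}+\sum_{s\ge1}\dot{\mathfrak g}t^s$. A $\mathfrak g$-module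 is integrable if it is integrable over the affine Lie algebra $[\dot{\mathfrak g}_{\bar0},\dot{\mathfrak g}_{\bar0}]^{(1)}$ and $\mathfrak h$ acts locally finitely with finite-dimensional generalized weight spaces. $V^k(\mathfrak g)$ is the affine vertex superalgebra of level $k$, $V_k(\mathfrak g)$ its simple quotient; $V^k(\mathfrak g)$-modules are the restricted $[\mathfrak g,\mathfrak g]$-modules of level $k$ (for all $a\in\dot{\mathfrak g}$ and $v$, $(at^m)v=0$ for $m\gg0$), and a $V_k(\mathfrak g)$-module is a $V^k(\mathfrak g)$-module on which the action factors through $V_k(\mathfrak g)$. A $V^k(\mathfrak g)$-module is positive energy if it is a $\mathbb Z$-graded $[\mathfrak g,\mathfrak g]$-module $M=\bigoplus_{m\in\mathbb Z}M_m$ of level $k$ with $(at^j)M_m\subset M_{m-j}$ and grading bounded from below; it becomes a $\mathfrak g$-module by $dv=-mv$ for $v\in M_m$. *)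

(* Defs.v *)
From HB Require Import structures.
From mathcomp Require Import all_boot all_order all_algebra.

Set Implicit Arguments.
Unset Strict Implicit.
Unset Printing Implicit Defensive.

Import Order.TTheory GRing.Theory Num.Theory.
Local Open Scope ring_scope.

Section Gradings.
Variables (F : fieldType) (M : lmodType F).

Definition subspace (U : M -> Prop) : Prop :=
  U 0 /\ forall (c : F) u v, U u -> U v -> U (c *: u + v).

Definition in_span (s : seq M) (v : M) : Prop :=
  exists c : nat -> F, v = \sum_(i < size s) c i *: s`_i.

Variables (I : eqType) (G : I -> M -> Prop).

(* The subspace U is the sum of its intersections with the G i. *)
Definition homogeneous_subspace (U : M -> Prop) : Prop :=
  subspace U /\
  forall v, U v -> exists (s : seq I) (w : I -> M),
    [/\ forall i, i \in s -> G i (w i) /\ U (w i), uniq s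
      & v = \sum_(i <- s) w i].

(* M is the direct sum of the G i. *)
Definition grading : Prop :=
  [/\ forall i, subspace (G i),
      homogeneous_subspace (fun=> True)
    & forall (s : seq I) (w : I -> M), uniq s ->
        (forall i, i \in s -> G i (w i)) ->
        \sum_(i <- s) w i = 0 -> forall i, i \in s -> w i = 0].

End Gradings.

(* Finite-dimensional Lie superalgebras; lsa_par g false is the even part and
   lsa_par g true the odd part. *)
Record lieSuperalgebra (F : fieldType) := LieSuperalgebra {
  lsa_sort :> vectType F;
  lsa_par : bool -> {vspace lsa_sort};
  lsa_br : lsa_sort -> lsa_sort -> lsa_sort;
  lsa_par_sum : (lsa_par false + lsa_par true = fullv)%VS;
  lsa_par_cap : (lsa_par false :&: lsa_par true = 0)%VS;
  lsa_br_linl : forall (c : F) x y z,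
    lsa_br (c *: x + y) z = c *: lsa_br x z + lsa_br y z;
  lsa_br_linr : forall (c : F) x y z,
    lsa_br z (c *: x + y) = c *: lsa_br z x + lsa_br z y;
  lsa_br_par : forall i j x y, x \in lsa_par i -> y \in lsa_par j ->
    lsa_br x y \in lsa_par (i (+) j);
  lsa_br_anti : forall i j x y, x \in lsa_par i -> y \in lsa_par j ->
    lsa_br x y = - ((-1) ^+ (i && j) *: lsa_br y x);
  lsa_br_jacobi : forall i j x y z, x \in lsa_par i -> y \in lsa_par j ->
    lsa_br x (lsa_br y z)
    = lsa_br (lsa_br x y) z + (-1) ^+ (i && j) *: lsa_br y (lsa_br x z)
}.
Arguments lsa_br {F g} : rename.

Section FiniteDimensional.
Variables (F : numClosedFieldType) (g : lieSuperalgebra F).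

Local Notation br := (@lsa_br F g).
Local Notation even := (lsa_par g false).
Local Notation odd := (lsa_par g true).

Definition commutator_space (U V : {vspace g}) : {vspace g} :=
  <<[seq br x y | x <- vbasis U, y <- vbasis V]>>%VS.

Definition even_derived : {vspace g} := commutator_space even even.

Definition super_ideal (J : {vspace g}) : Prop :=
  (forall x, x \in J -> exists x0 x1,
     [/\ x0 \in (J :&: even)%VS, x1 \in (J :&: odd)%VS & x = x0 + x1]) /\
  (forall x y, y \in J -> br x y \in J).

Variable h : {vspace g}.

Definition weight := 'Hom(subvs_of h, F^o).

Definition weight_eval (al : weight) (t : subvs_of h) : F := al t.

Definition root_vector (al : weight) (x : g) : Prop :=
  forall t : subvs_of h, br (vsval t) x = weight_eval al t *: x.

(* Roots of (a subspace U of) g: root vectors are required to lie in U. *)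
Definition root_in (U : {vspace g}) (al : weight) : Prop :=
  al != 0 /\ exists x, [/\ x != 0, x \in U & root_vector al x].

(* g is the contragredient Lie superalgebra g(A, p) of an indecomposable,
   regular (A i j = 0 <-> A j i = 0) Cartan matrix A whose rows are normalized
   by A i i = 2 or, for odd i, A i i = 0: g is generated by h, e_i and f_i with
   the Chevalley relations for a minimal realization of A, and no non-zero
   ideal of g meets h trivially. *)
Definition kac_moody : Prop :=
  exists (n : nat) (A : 'M[F]_n) (p : 'I_n -> bool) (e f : 'I_n -> g)
         (co : n.-tuple (subvs_of h)) (al : n.-tuple weight),
  [/\ [/\ forall i, A i i = 2 \/ (p i = true /\ A i i = 0),
          forall i j, A i j = 0 <-> A j i = 0
        & forall S : {set 'I_n},
            (forall i j, i \in S -> j \notin S -> A i j = 0) ->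
            S = set0 \/ S = setT],
      [/\ (\dim h + \rank A = n.*2)%N, free co, free al
        & forall i j, weight_eval (tnth al j) (tnth co i) = A i j],
      [/\ (h <= even)%VS,
          forall x y, x \in h -> y \in h -> br x y = 0,
          forall i, [/\ e i \in lsa_par g (p i), f i \in lsa_par g (p i),
                        root_vector (tnth al i) (e i)
                      & root_vector (- tnth al i) (f i)]
        & forall i j, br (e i) (f j)
            = if i == j then vsval (tnth co i) else 0],
      forall U : {vspace g}, (h <= U)%VS ->
        (forall i, e i \in U /\ f i \in U) ->
        (forall x y, x \in U -> y \in U -> br x y \in U) -> U = fullv
    & forall J : {vspace g}, super_ideal J -> (J :&: h = 0)%VS -> J = 0%VS].

(* g = nm + h + np, where np (resp. nm) is the sum of the root spaces whose
   roots are positive (resp. negative) on a regular element t0 of h. In a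
   numClosedFieldType, 0 < z means that z is real and positive. *)
Definition triangular_decomposition (nm np : {vspace g}) : Prop :=
  [/\ (nm + h + np = fullv)%VS, directv (nm + h + np)
    & exists t0 : subvs_of h,
      forall al, root_in fullv al ->
        (0 < weight_eval al t0 /\ forall x, root_vector al x -> x \in np) \/
        (weight_eval al t0 < 0 /\ forall x, root_vector al x -> x \in nm)].

Definition even_reductive : Prop :=
  (forall x, x \in even -> exists z y,
     [/\ z \in even, forall u, u \in even -> br z u = 0,
         y \in even_derived & x = z + y]) /\
  (forall J : {vspace g}, (J <= even_derived)%VS ->
     (forall x y, x \in even_derived -> y \in J -> br x y \in J) ->
     (forall x y, x \in J -> y \in J -> br x y = 0) -> J = 0%VS).

Section EvenDynkin.
Variable np : {vspace g}.

(* Roots of the even part of the affinization: (al, s) stands for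
   al + s delta. *)
Definition affine_even_root (a : weight * int) : Prop :=
  root_in even a.1 \/ (a.1 = 0 /\ a.2 != 0).

Definition affine_even_positive (a : weight * int) : Prop :=
  affine_even_root a /\
  (0 < a.2 \/ (a.2 = 0 /\ root_in (even :&: np)%VS a.1)).

Definition affine_even_simple (a : weight * int) : Prop :=
  affine_even_positive a /\
  ~ exists b c, [/\ affine_even_positive b, affine_even_positive c
                  & a = b + c].

(* Distinct simple roots are joined in the Dynkin diagram iff their sum is a
   root. *)
Inductive dynkin_connect (a : weight * int) : weight * int -> Prop :=
| dynkin_refl : dynkin_connect a a
| dynkin_step b c : dynkin_connect a b -> affine_even_simple c -> b <> c ->
    affine_even_root (b + c) -> dynkin_connect a c.

(* The Dynkin diagram of the even part of the affinization is defined because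
   the even part of g is reductive; it is empty iff g has no even root. *)
Definition even_dynkin_connected : Prop :=
  [/\ even_reductive,
      exists al, root_in even al
    & forall a b, affine_even_simple a -> affine_even_simple b ->
        dynkin_connect a b].

End EvenDynkin.

(* weight_norm B al c: (al, al) = c for the form on the dual of h induced by
   the restriction of B to h. *)
Definition weight_norm (B : g -> g -> F) (al : weight) (c : F) : Prop :=
  exists t : subvs_of h,
    (forall s : subvs_of h, B (vsval t) (vsval s) = weight_eval al s) /\
    weight_eval al t = c.

Definition invariant_form (B : g -> g -> F) : Prop :=
  [/\ forall (c : F) x y z, B (c *: x + y) z = c * B x z + B y z,
      forall i j x y, x \in lsa_par g i -> y \in lsa_par g j ->
        B x y = (-1) ^+ (i && j) * B y x,
      forall x y, x \in even -> y \in odd -> B x y = 0,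
      forall x y z, B (br x y) z = B x (br y z)
    & forall x, (forall y, B x y = 0) -> x = 0].

Definition normalized_form (B : g -> g -> F) : Prop :=
  [/\ invariant_form B,
      exists al, root_in even_derived al /\ weight_norm B al 2
    & forall al c, root_in even_derived al -> weight_norm B al c -> c <= 2].

End FiniteDimensional.

Section AffineModules.
Variables (F : numClosedFieldType) (g : lieSuperalgebra F).
Variables (B : g -> g -> F) (k : F).
Variables (M : lmodType F) (par : bool -> M -> Prop).
Variable act : g -> int -> M -> M.

(* M is a module over g[t, t^-1] + F K on which K acts by k, with act a m the
   action of a t^m. *)
Definition affine_module : Prop :=
  [/\ grading par,
      forall m (c : F) a b v, act (c *: a + b) m v = c *: act a m v + act b m v,
      forall m (c : F) a v w, act a m (c *: v + w) = c *: act a m v + act a m w,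
      forall i j a m v, a \in lsa_par g i -> par j v -> par (i (+) j) (act a m v)
    & forall i j a b m n v, a \in lsa_par g i -> b \in lsa_par g j ->
        act a m (act b n v) - (-1) ^+ (i && j) *: act b n (act a m v)
        = act (lsa_br a b) (m + n) v
          + (if m + n == 0 then m%:~R * B a b * k else 0) *: v].

Definition restricted : Prop :=
  forall a v, exists m0 : int, forall m, m0 <= m -> act a m v = 0.

Definition act_stable (U : M -> Prop) : Prop :=
  subspace U /\ forall a m v, U v -> U (act a m v).

Definition irreducible_module : Prop :=
  (exists v : M, v != 0) /\
  forall U : M -> Prop, act_stable U -> homogeneous_subspace par U ->
    (forall v, U v -> v = 0) \/ (forall v, U v).

End AffineModules.

Section Borcherds.
Variables (F : numClosedFieldType).

Definition gen_binomial (m : int) (j : nat) : F :=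
  (\prod_(i < j) (m%:~R - i%:R)) / j`!%:R.

Variables (V M : lmodType F) (Vpar : bool -> V -> Prop).
Variables (prod : V -> int -> V -> V) (Y : V -> int -> M -> M).

(* Both sums have finitely many non-zero terms by the field axioms, so they are
   replaced by their sufficiently long truncations. *)
Definition borcherds_identity : Prop :=
  forall p q (a b : V) (c : M) (m n l : int), Vpar p a -> Vpar q b ->
  exists N0 : nat, forall N : nat, (N0 <= N)%N ->
    \sum_(j < N) gen_binomial m j *: Y (prod a (n + j%:Z) b) (m + l - j%:Z) c
    = \sum_(j < N) ((-1) ^+ j * gen_binomial n j) *:
        (Y a (m + n - j%:Z) (Y b (l + j%:Z) c)
         - ((-1) ^ n * (-1) ^+ (p && q)) *:
           Y b (n + l - j%:Z) (Y a (m + j%:Z) c)).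

(* Y a n is the coefficient of z^(-n-1) in Y(a, z). *)
Definition va_action (vac : V) (Mpar : bool -> M -> Prop) : Prop :=
  [/\ (forall n (c : F) a b v, Y (c *: a + b) n v = c *: Y a n v + Y b n v) /\
      (forall n (c : F) a v w, Y a n (c *: v + w) = c *: Y a n v + Y a n w),
      forall p q a n v, Vpar p a -> Mpar q v -> Mpar (p (+) q) (Y a n v),
      forall a v, exists n0 : int, forall n, n0 <= n -> Y a n v = 0,
      forall n v, Y vac n v = if n == -1 then v else 0
    & borcherds_identity].

End Borcherds.

(* Z-graded vertex superalgebras; va_prod a n b is the n-th product a_(n) b. *)
Record vertexSuperalgebra (F : numClosedFieldType) := VertexSuperalgebra {
  va_sort :> lmodType F;
  va_par : bool -> va_sort -> Prop;
  va_deg : int -> va_sort -> Prop;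
  va_vac : va_sort;
  va_prod : va_sort -> int -> va_sort -> va_sort;
  va_par_grading : grading va_par;
  va_deg_grading : grading va_deg;
  va_par_deg : forall p, homogeneous_subspace va_deg (va_par p);
  va_vac_par : va_par false va_vac;
  va_vac_deg : va_deg 0 va_vac;
  va_prod_deg : forall i j n a b, va_deg i a -> va_deg j b ->
    va_deg (i + j - n - 1) (va_prod a n b);
  va_prod_action : va_action va_par va_prod va_prod va_vac va_par;
  va_creation : forall a, va_prod a (-1) va_vac = a /\
    forall n : int, 0 <= n -> va_prod a n va_vac = 0
}.

Section VertexAlgebras.
Variable F : numClosedFieldType.

Definition va_module (V : vertexSuperalgebra F) (M : lmodType F)
    (Mpar : bool -> M -> Prop) (Y : V -> int -> M -> M) : Prop :=
  grading Mpar /\ va_action (@va_par F V) (@va_prod F V) Y (va_vac V) Mpar.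

Definition va_morphism (U V : vertexSuperalgebra F) (phi : {linear U -> V}) :
    Prop :=
  [/\ phi (va_vac U) = va_vac V,
      forall a n b, phi (va_prod a n b) = va_prod (phi a) n (phi b),
      forall p a, va_par p a -> va_par p (phi a)
    & forall i a, va_deg i a -> va_deg i (phi a)].

Definition va_ideal (V : vertexSuperalgebra F) (J : V -> Prop) : Prop :=
  [/\ homogeneous_subspace (@va_par F V) J,
      homogeneous_subspace (@va_deg F V) J
    & forall a n b, J b -> J (va_prod a n b) /\ J (va_prod b n a)].

Definition va_simple (V : vertexSuperalgebra F) : Prop :=
  va_vac V != 0 /\
  forall J : V -> Prop, va_ideal J ->
    (forall v, J v -> v = 0) \/ (forall v, J v).

Definition simple_quotient (U V : vertexSuperalgebra F)
    (pi : {linear U -> V}) : Prop :=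
  [/\ va_morphism pi, forall v, exists u, pi u = v & va_simple V].

Variables (g : lieSuperalgebra F) (B : g -> g -> F) (k : F).

Definition currents (U : vertexSuperalgebra F) (iota : {linear g -> U}) :
    Prop :=
  [/\ forall p a, a \in lsa_par g p -> va_par p (iota a),
      forall a, va_deg 1 (iota a)
    & forall a b, [/\ va_prod (iota a) 0 (iota b) = iota (lsa_br a b),
                      va_prod (iota a) 1 (iota b) = (k * B a b) *: va_vac U
                    & forall n : int, 2 <= n ->
                        va_prod (iota a) n (iota b) = 0]].

(* (U, iota) is the universal affine vertex superalgebra V^k: the a t^n act by
   iota(a)_(n), and with this action U is the module induced from the
   one-dimensional module over g[t] + F K on which g[t] acts by 0 and K by k. *)
Definition universal_affine_va (U : vertexSuperalgebra F)
    (iota : {linear g -> U}) : Prop :=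
  currents iota /\
  forall (N : lmodType F) (Npar : bool -> N -> Prop) (act : g -> int -> N -> N)
         (w : N),
    affine_module B k Npar act -> Npar false w ->
    (forall a (n : int), 0 <= n -> act a n w = 0) ->
    let is_hom (phi : {linear U -> N}) :=
      phi (va_vac U) = w /\
      forall a n u, phi (va_prod (iota a) n u) = act a n (phi u) in
    exists2 phi, is_hom phi & forall psi, is_hom psi -> psi =1 phi.

(* The restricted [g^(1), g^(1)]-module M of level k is a V^k-module on which
   the action factors through pi : V^k -> V. *)
Definition simple_affine_module (U V : vertexSuperalgebra F)
    (iota : {linear g -> U}) (pi : {linear U -> V}) (M : lmodType F)
    (par : bool -> M -> Prop) (act : g -> int -> M -> M) : Prop :=
  [/\ affine_module B k par act, restricted act
    & exists2 Y : V -> int -> M -> M, va_module par Y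
        & forall a n v, Y (pi (iota a)) n v = act a n v].

Definition positive_energy (M : lmodType F) (par : bool -> M -> Prop)
    (deg : int -> M -> Prop) (act : g -> int -> M -> M) : Prop :=
  [/\ grading deg, forall p, homogeneous_subspace deg (par p),
      forall a j m v, deg m v -> deg (m - j) (act a j v)
    & exists m0 : int, forall m v, m < m0 -> deg m v -> v = 0].

End VertexAlgebras.

Section Conclusions.
Variables (F : numClosedFieldType) (g : lieSuperalgebra F).
Variables (h np : {vspace g}) (M : lmodType F).
Variable act : g -> int -> M -> M.

Definition singular_vector (v : M) : Prop :=
  [/\ v != 0, forall x, x \in np -> act x 0 v = 0
    & forall x (s : int), 1 <= s -> act x s v = 0].

Variable d : M -> M.

(* Integrability over the affine Lie algebra [g_0, g_0]^(1): real root vectors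
   act locally nilpotently and the Cartan subalgebra acts diagonally (K acts by
   a scalar). *)
Definition even_affine_integrable : Prop :=
  (forall (al : weight h) x, al != 0 -> x \in even_derived g ->
     root_vector al x ->
     forall (s : int) v, exists N : nat, iter N (act x s) v = 0) /\
  (forall v, exists2 ws : seq M, v = \sum_(w <- ws) w
     & forall w, w \in ws ->
         (forall t, t \in (h :&: even_derived g)%VS ->
            exists c : F, act t 0 w = c *: w) /\
         exists c : F, d w = c *: w).

Definition cartan_locally_finite : Prop :=
  forall v, exists ws : seq M,
    [/\ in_span ws v,
        forall t w, t \in h -> in_span ws w -> in_span ws (act t 0 w)
      & forall w, in_span ws w -> in_span ws (d w)].

Definition generalized_weight_vector (la : weight h) (c : F) (v : M) : Prop :=
  (forall t : subvs_of h, exists N : nat,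
     iter N (fun w => act (vsval t) 0 w - weight_eval la t *: w) v = 0) /\
  (exists N : nat, iter N (fun w => d w - c *: w) v = 0).

Definition integrable : Prop :=
  [/\ even_affine_integrable, cartan_locally_finite
    & forall la c, exists ws : seq M,
        forall v, generalized_weight_vector la c v -> in_span ws v].

Definition highest_weight_module (par : bool -> M -> Prop) : Prop :=
  exists (v : M) (p : bool) (la : weight h) (c : F),
  [/\ singular_vector v, par p v,
      forall t : subvs_of h, act (vsval t) 0 v = weight_eval la t *: v,
      d v = c *: v
    & forall U : M -> Prop, act_stable act U -> U v -> forall w, U w].

End Conclusions.

(* Main.v *)
(** The even part of a Kac-Moody superalgebra [g] with connected even Dynkin
diagram has only roots of positive norm: roots of opposite sign of the norm are
orthogonal, otherwise reflections would produce infinitely many roots. Let [th]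
be an even root of norm [2]. If an odd root [b] had [(b, th) = m >= 2], then
either [2 b] would be an even root or [b] would be isotropic, and in the latter
case one of [m th] and [2 b - m th] (of norm [- 2 m ^ 2]) would be an even
root; so the coroot of [th] has eigenvalues at most [2] on [g], with equality
only on the line of [e_th]. Hence [(e_th t^-1)^(k+1)] applied to the vacuum is
singular for the whole affine superalgebra and vanishes in [V_k]. Any other
even root vector is a bracket [z] of [e_th] and some [y] which commutes with
[e_th], and [ad (e_th t^-1) ^ N] maps [y ^ N] to [N! (z t^-1) ^ N]; so some power
of every [x t^-1], [x] an even root vector, kills the vacuum of [V_k].

On a positive energy [V_k]-module the leading coefficients of the powers of the
corresponding fields vanish, so the zero modes of all root vectors are nilpotent
on the lowest space (an odd one squares to half an even one); an Engel type
argument along the roots ordered by height gives a singular vector.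

If the module is irreducible, the lowest space is spanned over [C[h]] by
finitely many ordered monomials in [n^-] applied to a singular vector [v]. Given
[t] in [h], either [v] is not in the image of some [t - a], and then the
submodule generated by [p(t) v] misses [v] for a product [p] of translates of
[t - a]; or all equations [(t - a) u = v] are solvable, and since the module has
countable dimension while the field is uncountable their solutions are
dependent. In both cases a polynomial in [t] kills [v], whence a singular weight
vector. *)

Require Import Defs.
From HB Require Import structures.
From mathcomp Require Import all_boot all_order all_algebra.
From mathcomp Require Import reals complex.
From mathcomp Require Import boolp classical_sets cardinality lebesgue_measure.
From mathcomp Require Import ring zify.

Set Implicit Arguments.
Unset Strict Implicit.
Unset Printing Implicit Defensive.

Import Order.TTheory GRing.Theory Num.Theory.
Local Open Scope ring_scope.

(** * Spans and gradings *)

(** Connectedness of the even Dynkin diagram is used in one form: a nonempty class of even roots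
    that is orthogonal to its complement contains every even root. The arguments on roots use [B] on
    both sides, whereas [invariant_form] grants linearity on the left; linearity on the right is
    recovered from the first products of the currents when [k] is nonzero, and for [k = 0] the
    currents vanish. Hence the hypothesis [B_linr] in that part. For irreducible modules the
    obstacle is that no weights are given and that Schur's lemma does not apply to an element [t] of
    [h], which does not commute with the action. It commutes with a root vector [y] up to a shift,
    [(t - c) y = y (t - c + d)], and root vectors are nilpotent on the lowest space with an exponent
    that does not depend on the vector, so finitely many shifts occur: this is where the products of
    translates come from. Parities are carried along everywhere because the submodules tested in
    [irreducible_module] are homogeneous. *)

Section LinearSpan.
Variables (F : fieldType) (M : lmodType F).

(** The modules are infinite dimensional, so spans are inductive predicates; [lspan_least] then
    reduces a claim that cuts out a subspace to generators. *)
Inductive lspan (S : M -> Prop) : M -> Prop :=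
| lspan0 : lspan S 0
| lspan_cons c u v : S u -> lspan S v -> lspan S (c *: u + v).

Section SubspaceTheory.
Variables (P : M -> Prop) (hP : subspace P).

Lemma subspaceZ c u : P u -> P (c *: u).
Proof. by move=> Pu; rewrite -[_ *: _]addr0; apply: hP.2 => //; apply: hP.1. Qed.

Lemma subspaceD u v : P u -> P v -> P (u + v).
Proof. by move=> Pu Pv; rewrite -[u]scale1r; apply: hP.2. Qed.

Lemma subspaceN u : P u -> P (- u).
Proof. by rewrite -scaleN1r; apply: subspaceZ. Qed.

Lemma subspaceB u v : P u -> P v -> P (u - v).
Proof. by move=> Pu Pv; apply: subspaceD => //; apply: subspaceN. Qed.

Lemma subspace_sum (I : Type) (r : seq I) (Q : pred I) (f : I -> M) :
  (forall i, Q i -> P (f i)) -> P (\sum_(i <- r | Q i) f i).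
Proof. by move=> Pf; apply: big_ind => //; [apply: hP.1 | apply: subspaceD]. Qed.

Lemma subspace_sum_in (I : eqType) (r : seq I) (f : I -> M) :
  (forall i, i \in r -> P (f i)) -> P (\sum_(i <- r) f i).
Proof. by move=> Pf; rewrite big_seq; apply: subspace_sum. Qed.

Lemma lspan_least S : (forall u, S u -> P u) -> forall u, lspan S u -> P u.
Proof. by move=> SP u; elim=> [|c {}u v Su _ Pv]; [apply: hP.1 | apply: hP.2; auto]. Qed.

End SubspaceTheory.

Lemma lspan_subspace S : subspace (lspan S).
Proof.
split=> [|c u v Su Sv]; first exact: lspan0.
elim: Su c => [|c' u' v' Su' _ IH] c; first by rewrite scaler0 add0r.
by rewrite scalerDr scalerA -addrA; apply: lspan_cons.
Qed.

Lemma lspan_gen (S : M -> Prop) u : S u -> lspan S u.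
Proof. by move=> Su; rewrite -[u]scale1r -[_ *: _]addr0; apply/lspan_cons/lspan0. Qed.

Lemma lspan_sub (S S' : M -> Prop) u :
  (forall v, S v -> lspan S' v) -> lspan S u -> lspan S' u.
Proof. by move=> SS' Su; apply: (lspan_least (lspan_subspace S') SS' Su). Qed.

Lemma subspace_ker (N : lmodType F) (f : M -> N) (P : N -> Prop) :
  (forall c u v, f (c *: u + v) = c *: f u + f v) -> subspace P ->
  subspace (fun u => P (f u)).
Proof.
move=> lf hP; split=> [|c u v Pu Pv]; last by rewrite lf; apply: hP.2.
suff -> : f 0 = 0 by apply: hP.1.
have /eqP := lf 1 0 0; rewrite !scale1r addr0.
by rewrite -{1}[f 0]addr0 (inj_eq (addrI _)) eq_sym => /eqP.
Qed.

Lemma subspaceI (P Q : M -> Prop) :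
  subspace P -> subspace Q -> subspace (fun u => P u /\ Q u).
Proof.
move=> hP hQ; split=> [|c u v [Pu Qu] [Pv Qv]]; first by split; [apply: hP.1|apply: hQ.1].
by split; [apply: hP.2|apply: hQ.2].
Qed.

Lemma subspace_forall (I : Type) (P : I -> M -> Prop) :
  (forall i, subspace (P i)) -> subspace (fun u => forall i, P i u).
Proof.
move=> hP; split=> [i|c u v Pu Pv i]; first exact: (hP i).1.
exact: (hP i).2.
Qed.

Lemma subspace_imp (A : Prop) (P : M -> Prop) :
  subspace P -> subspace (fun u => A -> P u).
Proof. by move=> hP; split=> [_|c u v Pu Pv a]; [apply: hP.1 | apply: hP.2; auto]. Qed.

End LinearSpan.

(** Terms with the same index are merged as they are added, because the independence clause of
    [grading] speaks of duplicate-free lists. [D] carries a side condition on the indices. *)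
Lemma lspan_components (F : fieldType) (M : lmodType F) (I : eqType)
    (H : I -> M -> Prop) (D : I -> Prop) (S : M -> Prop) v :
  (forall i, subspace (H i)) -> (forall u, S u -> exists2 i, D i & H i u) ->
  lspan S v ->
  exists (s : seq I) (w : I -> M),
    [/\ forall i, i \in s -> D i /\ H i (w i), uniq s & v = \sum_(i <- s) w i].
Proof.
move=> hH SH; elim=> [|c u w Su _ [s [f [Hf us ->]]]].
  by exists [::], (fun=> 0); split=> //; rewrite big_nil.
have [j Dj Hu] := SH u Su.
exists (undup (j :: s)),
  (fun l => (if l == j then c *: u else 0) + (if l \in s then f l else 0)).
split=> [l||]; last 2 first.
- exact: undup_uniq.
- rewrite big_split /= -big_mkcond -big_mkcond /=; congr (_ + _).
  + have -> : \sum_(l <- undup (j :: s) | l == j) c *: u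
               = c *: u *+ (count_mem j (undup (j :: s))).
      by rewrite big_const_seq; elim: (count _ _) => //= n ->; rewrite mulrS.
    by rewrite count_uniq_mem ?undup_uniq // mem_undup mem_head.
  symmetry; rewrite -[LHS]big_filter; apply: perm_big; apply: uniq_perm => //.
    exact/filter_uniq/(undup_uniq (j :: s)).
  move=> l; rewrite mem_filter (mem_undup (j :: s)) inE.
  by case: (l \in s); rewrite ?orbT ?andbT ?andbF.
rewrite mem_undup inE; case: eqP => [-> _|_ /= ls].
  split=> //; apply: subspaceD => //; first exact: subspaceZ.
  by case: ifP => [/Hf[]//|_]; apply: (hH j).1.
by rewrite ls add0r; apply: Hf.
Qed.

Section GradingTheory.
Variables (F : fieldType) (M : lmodType F) (I : eqType) (G : I -> M -> Prop).
Hypothesis hG : forall i, subspace (G i).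

Lemma lspan_homogeneous (S : M -> Prop) :
  (forall u, S u -> exists i, G i u) -> homogeneous_subspace G (lspan S).
Proof.
move=> SG; split=> [|v Sv]; first exact: lspan_subspace.
have [||s [w [Gw us ->]]] := @lspan_components _ _ _
  (fun i u => G i u /\ lspan S u) (fun=> True) S v _ _ Sv.
- by move=> i; apply: subspaceI => //; apply: lspan_subspace.
- by move=> u Su; have [i Gu] := SG u Su; exists i => //; split=> //; apply: lspan_gen.
by exists s, w; split=> // i /Gw[].
Qed.

Lemma homogeneous_lspan (U : M -> Prop) v :
  homogeneous_subspace G U -> U v -> lspan (fun u => U u /\ exists i, G i u) v.
Proof.
move=> [_ hU] /hU[s [w [Gw _ ->]]]; apply: subspace_sum_in; first exact: lspan_subspace.
by move=> i /Gw[Gi Ui]; apply: lspan_gen; split=> //; exists i.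
Qed.

Hypothesis Ggr : grading G.

Lemma grading_span v : lspan (fun u => exists i, G i u) v.
Proof.
case: Ggr => _ h _; have := @homogeneous_lspan _ v h Logic.I.
by apply: lspan_sub => u [_ hu]; apply: lspan_gen.
Qed.

Lemma grading_disjoint i v :
  G i v -> lspan (fun u => exists2 j, j != i & G j u) v -> v = 0.
Proof.
move=> Gv vS.
have [s [w [Gw us vE]]] :=
  lspan_components hG (fun u (hu : exists2 j, j != i & G j u) => hu) vS.
have nis : i \notin s by apply/negP => /Gw[]; rewrite eqxx.
case: Ggr => _ _ /(_ (i :: s) (fun j => if j == i then - v else w j)) K.
have := K _ _ _ i (mem_head _ _); rewrite eqxx => K'.
apply/eqP; rewrite -oppr_eq0; apply/eqP; apply: K'.
- by rewrite /= nis.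
- move=> j; rewrite inE; case: eqP => [-> _|_ /= /Gw[]//].
  exact: subspaceN.
rewrite big_cons eqxx [X in _ + X](_ : _ = v) ?addNr // vE !big_seq.
by apply: eq_bigr => j js; case: eqP => // ji; rewrite -ji js in nis.
Qed.

End GradingTheory.

Section VectorSpan.
Variables (F : fieldType) (V : vectType F).

(** A free family in [P] of maximal length, bounded by the dimension, spans [P]. This turns
    predicates into the [{vspace}]s required by the generation clause of [kac_moody]. *)
Lemma subspace_vspace (P : V -> Prop) :
  subspace P -> exists U : {vspace V}, forall x, x \in U <-> P x.
Proof.
move=> hP.
pose Q n := `[< exists s : seq V, [/\ size s = n, free s & forall x, x \in s -> P x] >].
have exQ : exists n, Q n.
  by exists 0%N; apply/asboolP; exists [::]; split=> //; rewrite nil_free.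
have bQ n : Q n -> (n <= \dim {:V})%N.
  move=> /asboolP[s [<- fs _]]; rewrite -(eqP fs); exact/dimvS/subvf.
case: (ex_maxnP exQ bQ) => n /asboolP[s [sn fs sP]] maxn.
have sP' x : x \in <<s>>%VS -> P x.
  move=> xs; rewrite (coord_span (X := in_tuple s) xs).
  by apply: subspace_sum => // i _; apply: subspaceZ => //; apply/sP/mem_nth.
exists <<s>>%VS => x; split=> [|Px]; first exact: sP'.
apply/negPn/negP => xs.
have : Q n.+1.
  apply/asboolP; exists (x :: s); split=> [|| y]; rewrite /= ?sn //.
    by rewrite free_cons xs.
  by rewrite inE => /orP[/eqP->|/sP].
by move=> /maxn; rewrite ltnn.
Qed.

Lemma lspan_finite (S : V -> Prop) :
  exists2 s : seq V, (forall x, x \in s -> S x) &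
    forall x, lspan S x -> x \in <<s>>%VS.
Proof.
have one x : lspan S x ->
    exists2 s : seq V, (forall y, y \in s -> S y) & x \in <<s>>%VS.
  elim=> [|c u v Su _ [s sS vs]]; first by exists [::] => //; rewrite mem0v.
  exists (u :: s) => [y|]; first by rewrite inE => /orP[/eqP->|/sS].
  rewrite span_cons memv_add //; first exact/memvZ/memv_line.
have [U hU] := subspace_vspace (lspan_subspace S).
suff [s sS Us] : exists2 s : seq V, (forall y, y \in s -> S y) &
    forall x, x \in (vbasis U : seq V) -> x \in <<s>>%VS.
  exists s => // x /hU; rewrite -(span_basis (vbasisP U)).
  by apply/subvP/span_subvP.
have : forall x, x \in (vbasis U : seq V) -> lspan S x.
  by move=> x /vbasis_mem/hU.
elim: (vbasis U : seq V) => [|x r IH] xS; first by exists [::].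
have [|s sS rs] := IH; first by move=> y yr; apply: xS; rewrite inE yr orbT.
have [s' s'S xs'] := one x (xS x (mem_head _ _)).
exists (s' ++ s) => [y|y]; first by rewrite mem_cat => /orP[/s'S|/sS].
rewrite span_cat inE => /orP[/eqP->|/rs ys].
  exact: subvP (addvSl _ _) _ xs'.
exact: subvP (addvSr _ _) _ ys.
Qed.

End VectorSpan.

Lemma span_ind (F : fieldType) (V : vectType F) (s : seq V) (P : V -> Prop) x :
  subspace P -> (forall y, y \in s -> P y) -> x \in <<s>>%VS -> P x.
Proof.
move=> hP sP xs; rewrite (coord_span (X := in_tuple s) xs).
by apply: subspace_sum => // i _; apply: subspaceZ => //; apply/sP/mem_nth.
Qed.

(** * Weights of Lie superalgebras *)

Section Bracket.
Variables (F : fieldType) (g : lieSuperalgebra F).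
Local Notation br := (@lsa_br F g).

Lemma brDl x y z : br (x + y) z = br x z + br y z.
Proof. by have := lsa_br_linl 1 x y z; rewrite !scale1r. Qed.

Lemma brDr x y z : br z (x + y) = br z x + br z y.
Proof. by have := lsa_br_linr 1 x y z; rewrite !scale1r. Qed.

Lemma br0l x : br 0 x = 0.
Proof. by apply: (addrI (br 0 x)); rewrite -brDl !addr0. Qed.

Lemma br0r x : br x 0 = 0.
Proof. by apply: (addrI (br x 0)); rewrite -brDr !addr0. Qed.

Lemma brZl c x z : br (c *: x) z = c *: br x z.
Proof. by have := lsa_br_linl c x 0 z; rewrite br0l !addr0. Qed.

Lemma brZr c x z : br z (c *: x) = c *: br z x.
Proof. by have := lsa_br_linr c x 0 z; rewrite br0r !addr0. Qed.

Lemma brNr x z : br z (- x) = - br z x.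
Proof. by rewrite -scaleN1r brZr scaleN1r. Qed.

Lemma par_split x : exists x0 x1,
  [/\ x0 \in lsa_par g false, x1 \in lsa_par g true & x = x0 + x1].
Proof.
have : x \in (lsa_par g false + lsa_par g true)%VS by rewrite lsa_par_sum memvf.
by move=> /memv_addP[x0 ? [x1 ? ->]]; exists x0, x1.
Qed.

Lemma par_ind (P : g -> Prop) :
  subspace P -> (forall p x, x \in lsa_par g p -> P x) -> forall x, P x.
Proof.
move=> hP pP x; have [x0 [x1 [x0e x1o ->]]] := par_split x.
by apply: subspaceD => //; [apply: (pP false)|apply: (pP true)].
Qed.

Lemma subspace_br (P : g -> Prop) x : subspace P -> subspace (fun y => P (br x y)).
Proof. by move=> hP; apply: subspace_ker => // c u v; rewrite brDr brZr. Qed.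

Lemma subspace_brl (P : g -> Prop) x : subspace P -> subspace (fun y => P (br y x)).
Proof. by move=> hP; apply: subspace_ker => // c u v; rewrite brDl brZl. Qed.

Lemma subspace_eq (M N : lmodType F) (f f' : M -> N) :
  (forall c u v, f (c *: u + v) = c *: f u + f v) ->
  (forall c u v, f' (c *: u + v) = c *: f' u + f' v) ->
  subspace (fun u => f u = f' u).
Proof.
move=> lf lf'; have f0 (k : M -> N) :
    (forall c u v, k (c *: u + v) = c *: k u + k v) -> k 0 = 0.
  move=> lk; have /eqP := lk 1 0 0; rewrite !scale1r addr0.
  by rewrite -{1}[k 0]addr0 (inj_eq (addrI _)) eq_sym => /eqP.
by split=> [|c u v fu fv]; [rewrite !f0|rewrite lf lf' fu fv].
Qed.

Lemma anti_even x y : x \in lsa_par g false -> br x y = - br y x.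
Proof.
move=> xe; move: y; apply: par_ind => [|p y yp].
  by apply: subspace_eq => c u v; rewrite ?brDr ?brDl ?brZl ?brZr // opprD scalerN.
by rewrite (lsa_br_anti xe yp) expr0 scale1r.
Qed.

Lemma jacobi_even t x y : t \in lsa_par g false ->
  br t (br x y) = br (br t x) y + br x (br t y).
Proof.
move=> te; move: x; apply: par_ind => [|p x xp].
  apply: subspace_eq => c u v; rewrite ?(brDr, brDl, brZl, brZr) //.
  by rewrite scalerDr addrACA.
by rewrite (lsa_br_jacobi _ te xp) expr0 scale1r.
Qed.

Lemma br_self_even x : (2%:R != 0 :> F) -> x \in lsa_par g false -> br x x = 0.
Proof.
move=> F2 xe; apply/eqP; have /eqP := anti_even x xe.
by rewrite -addr_eq0 -mulr2n -scaler_nat scaler_eq0 (negPf F2).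
Qed.

End Bracket.

Section Weights.
Variables (F : numClosedFieldType) (g : lieSuperalgebra F) (h : {vspace g}).
Local Notation br := (@lsa_br F g).
Local Notation weight := (weight h).
Implicit Types (mu nu : weight) (x y : g) (p q : bool).

Definition weight_vector p mu x := x \in lsa_par g p /\ root_vector mu x.

Lemma root_vector_subspace mu : subspace (root_vector mu).
Proof.
split=> [t|c u v hu hv t]; first by rewrite br0r scaler0.
by rewrite brDr brZr hu hv scalerDr !scalerA mulrC.
Qed.

Lemma weight_vector_subspace p mu : subspace (weight_vector p mu).
Proof.
apply: subspaceI; last exact: root_vector_subspace.
by split=> [|c u v up vp]; [rewrite mem0v|rewrite memvD ?memvZ].
Qed.

Hypothesis h_even : (h <= lsa_par g false)%VS.
Hypothesis h_abel : forall x y, x \in h -> y \in h -> br x y = 0.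

Lemma vsval_even (t : subvs_of h) : vsval t \in lsa_par g false.
Proof. exact: (subvP h_even) (subvsP t). Qed.

Lemma root_vector_br mu nu x y :
  root_vector mu x -> root_vector nu y -> root_vector (mu + nu) (br x y).
Proof.
move=> hx hy t; rewrite jacobi_even ?vsval_even // hx hy brZl brZr -scalerDl.
by rewrite /weight_eval add_lfunE.
Qed.

Lemma weight_vector_br p q mu nu x y :
  weight_vector p mu x -> weight_vector q nu y ->
  weight_vector (p (+) q) (mu + nu) (br x y).
Proof. by move=> [xp hx] [yq hy]; split; [apply: lsa_br_par|apply: root_vector_br]. Qed.

Lemma weight_vector_h x : x \in h -> weight_vector false 0 x.
Proof.
move=> xh; split=> [|t]; first exact: (subvP h_even).
by rewrite /weight_eval zero_lfunE scale0r h_abel // subvsP.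
Qed.

Lemma subvs_exists x : x \in h -> exists t : subvs_of h, x = vsval t.
Proof. by move=> xh; exists (vsproj h x); rewrite vsprojK. Qed.

Lemma weight_neqP mu nu : mu != nu -> exists t : subvs_of h, mu t != nu t.
Proof.
move=> mn; apply/not_existsP => H; case/eqP: mn; apply/lfunP => t.
by apply/eqP/negPn/negP/(H t).
Qed.

(** Choosing [t] that separates [mu] from one weight [nu] of the expansion, the vector
    [(mu t - nu t) *: x] has an expansion without [nu]; induction on the number of terms. *)
Lemma root_vector_independent mu x :
  root_vector mu x ->
  lspan (fun u => exists2 nu, nu != mu & root_vector nu u) x -> x = 0.
Proof.
move=> hx xS; have [s [w [hw _ xE]]] := lspan_components
  root_vector_subspace (fun u (hu : exists2 nu, nu != mu & root_vector nu u) => hu) xS.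
elim: s x w hx hw xE {xS} => [|nu s IH] x w hx hw xE; first by rewrite xE big_nil.
have [num hwn] := hw nu (mem_head _ _).
have [t tE] := weight_neqP num.
have : (mu t - nu t) *: x = 0.
  apply: (IH _ (fun nu' => (nu' t - nu t) *: w nu')).
  - by apply: subspaceZ hx; apply: root_vector_subspace.
  - move=> nu' nu's; have [? hw'] := hw nu' (mem_behead (s := nu :: s) nu's).
    by split=> //; apply: subspaceZ hw'; apply: root_vector_subspace.
  have : br (vsval t) x = \sum_(i <- nu :: s) i t *: w i.
    rewrite [in LHS]xE.
    have : forall r, {subset r <= nu :: s} ->
      br (vsval t) (\sum_(i <- r) w i) = \sum_(i <- r) i t *: w i.
      elim=> [|i r IHr] rs; first by rewrite !big_nil br0r.
      rewrite !big_cons brDr IHr => [|j jr]; last by apply: rs; rewrite inE jr orbT.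
      by have [_ ->] := hw i (rs i (mem_head _ _)).
    by apply.
  rewrite hx big_cons => E1; rewrite scalerBl [mu t *: x]E1 {1}xE big_cons.
  rewrite scalerDr opprD addrACA subrr add0r scaler_sumr -sumrB.
  by apply: eq_bigr => i _; rewrite scalerBl.
move=> /eqP; rewrite scaler_eq0 subr_eq0 eq_sym (negPf tE) => /eqP //.
Qed.

Section ChevalleyWords.
Variables (n : nat) (p : 'I_n -> bool) (e f : 'I_n -> g) (al : 'I_n -> weight).
Hypothesis wve : forall i, weight_vector (p i) (al i) (e i).
Hypothesis wvf : forall i, weight_vector (p i) (- al i) (f i).
Hypothesis ef_h : forall i j, br (e i) (f j) \in h.

(** Iterated brackets of generators of one kind, [e] or [f]. The multiplicities [c] record the
    degree in the root lattice, which determines the weight. *)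
Inductive chevalley_word (e' : 'I_n -> g) : {ffun 'I_n -> nat} -> g -> Prop :=
| chevalley_gen i : chevalley_word e' [ffun j => (i == j) : nat] (e' i)
| chevalley_step i c x : chevalley_word e' c x ->
    chevalley_word e' [ffun j => ((i == j) + c j)%N] (br (e' i) x).

Lemma chevalley_word_weight (e' : 'I_n -> g) (al' : 'I_n -> weight) c x :
  (forall i, weight_vector (p i) (al' i) (e' i)) -> chevalley_word e' c x ->
  exists q, weight_vector q (\sum_j al' j *+ c j) x.
Proof.
have sum1 i : \sum_j al' j *+ [ffun j => (i == j) : nat] j = al' i.
  rewrite (bigD1 i) //= ffunE eqxx big1 ?addr0 // => j ji.
  by rewrite ffunE eq_sym (negPf ji).
move=> we'; elim=> [i|i {}c {}x _ [q wx]].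
  by exists (p i); rewrite sum1; apply: we'.
exists (p i (+) q); suff -> : \sum_j al' j *+ [ffun j => ((i == j) + c j)%N] j
    = al' i + \sum_j al' j *+ c j by apply: weight_vector_br.
rewrite -[al' i]sum1 -big_split; apply: eq_bigr => j _.
by rewrite /= !ffunE -mulrnDr.
Qed.

Lemma chevalley_word_neq0 e' c x : chevalley_word e' c x -> exists i, (0 < c i)%N.
Proof. by elim=> [i|i {}c {}x _ _]; exists i; rewrite ffunE eqxx. Qed.

(** By the Jacobi identity [e i] moves past the first letter [f j], leaving [[e i, f j]] in [h],
    which acts on the remaining word by a scalar. *)
Lemma raise_lowering_word c x i : chevalley_word f c x ->
  lspan (fun u => u \in h \/ exists c', chevalley_word f c' u) (br (e i) x).
Proof.
have wtf c' u : chevalley_word f c' u -> exists q nu, weight_vector q nu u.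
  by move=> fw; have [q ?] := chevalley_word_weight wvf fw; exists q, (\sum_j - al j *+ c' j).
set S := fun u : g => _; have hS := lspan_subspace S.
move=> fx; elim: fx i => [j|j {}c {}x fx IH] i; first by apply: lspan_gen; left.
have [ep _] := wve i; have [fp _] := wvf j.
rewrite (lsa_br_jacobi _ ep fp); apply: subspaceD => //.
  have [q [nu [_ hx]]] := wtf _ _ fx.
  have [t ->] := subvs_exists (ef_h i j); rewrite hx.
  by apply: subspaceZ => //; apply: lspan_gen; right; exists c.
apply: subspaceZ => //.
apply: (lspan_least (P := fun u => lspan S (br (f j) u)) _ _ (IH i)).
  exact: subspace_br.
move=> u [uh|[c' fu]]; last by apply: lspan_gen; right; eexists; apply: chevalley_step fu.
have [t ->] := subvs_exists uh; rewrite -[br _ _]opprK -anti_even ?vsval_even //.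
have [_ ->] := wvf j; rewrite -scaleNr.
by apply: subspaceZ => //; apply: lspan_gen; right; eexists; apply: chevalley_gen.
Qed.

Lemma raise_raising_word i u :
  u \in h \/ (exists c, chevalley_word e c u) ->
  lspan (fun u => u \in h \/ exists c', chevalley_word e c' u) (br (e i) u).
Proof.
move=> [uh|[c eu]]; last by apply: lspan_gen; right; eexists; apply: chevalley_step eu.
have [t ->] := subvs_exists uh; rewrite -[br _ _]opprK -anti_even ?vsval_even //.
have [_ ->] := wve i; rewrite -scaleNr; apply: subspaceZ; first exact: lspan_subspace.
by apply: lspan_gen; right; eexists; apply: chevalley_gen.
Qed.

End ChevalleyWords.

(** The span of [h] and of both kinds of words is stable under [h] and the generators. The elements
    preserving it contain a subalgebra with all generators, hence are all of [g]; so the span is an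
    ideal that contains the generators, and is itself all of [g]. *)
Lemma chevalley_generation n (p : 'I_n -> bool) (e f : 'I_n -> g) (al : 'I_n -> weight) :
  (forall i, weight_vector (p i) (al i) (e i)) ->
  (forall i, weight_vector (p i) (- al i) (f i)) ->
  (forall i j, br (e i) (f j) \in h) ->
  (forall U : {vspace g}, (h <= U)%VS -> (forall i, e i \in U /\ f i \in U) ->
     (forall x y, x \in U -> y \in U -> br x y \in U) -> U = fullv) ->
  forall x, lspan (fun u => u \in h \/ (exists c, chevalley_word e c u) \/
                            (exists c, chevalley_word f c u)) x.
Proof.
move=> we wf efh gen.
set S := fun u : g => _; have hS := lspan_subspace S.
have fe_h i j : br (f i) (e j) \in h.
  have [fp _] := wf i; have [ep _] := we j.
  by rewrite (lsa_br_anti fp ep) memvN memvZ.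
have we' i : weight_vector (p i) (- - al i) (e i) by rewrite opprK.
have stab_e i u : S u -> lspan S (br (e i) u).
  have sub1 (w : g) : w \in h \/ (exists c, chevalley_word e c w) -> lspan S w.
    by move=> hw; apply: lspan_gen; rewrite /S; tauto.
  have sub2 (w : g) : w \in h \/ (exists c, chevalley_word f c w) -> lspan S w.
    by move=> hw; apply: lspan_gen; rewrite /S; tauto.
  move=> [uh|[eu|[c fu]]].
  - by apply: lspan_sub (raise_raising_word we i (or_introl uh)).
  - by apply: lspan_sub (raise_raising_word we i (or_intror eu)).
  - by apply: lspan_sub (raise_lowering_word we wf efh i fu).
have stab_f i u : S u -> lspan S (br (f i) u).
  have sub1 (w : g) : w \in h \/ (exists c, chevalley_word e c w) -> lspan S w.
    by move=> hw; apply: lspan_gen; rewrite /S; tauto.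
  have sub2 (w : g) : w \in h \/ (exists c, chevalley_word f c w) -> lspan S w.
    by move=> hw; apply: lspan_gen; rewrite /S; tauto.
  move=> [uh|[[c eu]|fu]].
  - by apply: lspan_sub (raise_raising_word wf i (or_introl uh)).
  - by apply: lspan_sub (raise_lowering_word wf we' fe_h i eu).
  - by apply: lspan_sub (raise_raising_word wf i (or_intror fu)).
have Swt u : S u -> exists q mu, weight_vector q mu u.
  move=> [uh|[[c eu]|[c fu]]]; first by exists false, 0; apply: weight_vector_h.
    by have [q ?] := chevalley_word_weight we eu; exists q, (\sum_j al j *+ c j).
  by have [q ?] := chevalley_word_weight wf fu; exists q, (\sum_j - al j *+ c j).
have stab_h t u : t \in h -> S u -> lspan S (br t u).
  move=> th Su; have [q [mu [_ hu]]] := Swt u Su.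
  by have [t' ->] := subvs_exists th; rewrite hu; apply: subspaceZ => //; apply: lspan_gen.
pose St x := forall u, lspan S u -> lspan S (br x u).
have hSt : subspace St.
  apply: subspace_forall => u; apply: subspace_imp; exact: subspace_brl.
have stI x : (forall u, S u -> lspan S (br x u)) -> St x.
  by move=> hx; apply: lspan_least => //; apply: subspace_br.
(* The super Jacobi identity needs parities, so only homogeneous stabilizing elements are collected,
   and it is their span that is closed under the bracket. *)
pose Z := fun x => (exists q, x \in lsa_par g q) /\ St x.
have [U hU] := subspace_vspace (lspan_subspace Z).
have Ufull : U = fullv.
  apply: gen => [|i|x y /hU Zx /hU Zy].
  - apply/subvP => t th; apply/hU/lspan_gen; split; last by apply: stI => u; apply: stab_h.
    by exists false; apply: (subvP h_even).
  - split; apply/hU/lspan_gen; split.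
    + by exists (p i); have [] := we i.
    + by apply: stI => u; apply: stab_e.
    + by exists (p i); have [] := wf i.
    + by apply: stI => u; apply: stab_f.
  apply/hU; move: x Zx; apply: lspan_least; first exact/subspace_brl/lspan_subspace.
  move=> x [[q xq] Sx]; move: y Zy.
  apply: lspan_least; first exact/subspace_br/lspan_subspace.
  move=> y [[r yr] Sy]; apply: lspan_gen; split; first by eexists; apply: lsa_br_par xq yr.
  move=> u Su; have /eqP := lsa_br_jacobi u xq yr; rewrite -subr_eq.
  move=> /eqP <-; apply: subspaceB => //; first exact/Sx/Sy.
  by apply: subspaceZ => //; apply/Sy/Sx.
have ideal x u : lspan S u -> lspan S (br x u).
  move=> Su; suff: St x by apply.
  suff: lspan Z x by move: x; apply: lspan_least => // y [].
  by apply/hU; rewrite Ufull memvf.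
have [U' hU'] := subspace_vspace hS.
suff Ufull' : U' = fullv by move=> x; apply/hU'; rewrite Ufull' memvf.
apply: gen => [|i|x y _ /hU'/(ideal x)/hU']//.
  by apply/subvP => t th; apply/hU'/lspan_gen; left.
by split; apply/hU'/lspan_gen; right; [left|right]; eexists; apply: chevalley_gen.
Qed.

End Weights.

Section KacMoody.
Variables (F : numClosedFieldType) (g : lieSuperalgebra F) (h : {vspace g}).
Hypothesis km : kac_moody h.
Local Notation br := (@lsa_br F g).

Lemma kac_moody_cartan :
  (h <= lsa_par g false)%VS /\ (forall x y, x \in h -> y \in h -> br x y = 0).
Proof. by have [n [A [p [e [f [co [al [_ _ [? ? _ _] _ _]]]]]]]] := km. Qed.

(** A nonempty word has as weight, up to sign, a nonzero combination of the simple roots with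
    natural coefficients; it does not vanish because the simple roots are free and the
    characteristic is zero. Thus only [h] contributes to weight zero. *)
Lemma kac_moody_weights :
  (forall x, lspan (fun u => exists p (mu : weight h), weight_vector p mu u) x) /\
  (forall x, root_vector (0 : weight h) x -> x \in h).
Proof.
have [n [A [p [e [f [co [al [_ [_ _ al_free _] [he hab wef ef] gen _]]]]]]]] := km.
have we i : weight_vector (p i) (tnth al i) (e i) by have [] := wef i.
have wf i : weight_vector (p i) (- tnth al i) (f i) by have [] := wef i.
have efh i j : br (e i) (f j) \in h.
  by rewrite ef; case: eqP => _; rewrite ?subvsP ?mem0v.
have S := chevalley_generation he hab we wf efh gen.
have wte c u : chevalley_word e c u ->
    exists q, weight_vector q (\sum_j tnth al j *+ c j) u.
  exact: chevalley_word_weight.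
have wtf c u : chevalley_word f c u ->
    exists q, weight_vector q (- \sum_j tnth al j *+ c j) u.
  move=> fu; have [q wq] := chevalley_word_weight he wf fu; exists q.
  by rewrite -sumrN; under eq_bigr do rewrite -mulNrn.
have nz (c : {ffun 'I_n -> nat}) : (exists i, (0 < c i)%N) ->
    \sum_j tnth al j *+ c j != 0.
  move=> [i ci]; apply/eqP => s0; have := freeP al_free (fun j => (c j)%:R).
  have -> : \sum_(j < n) (c j)%:R *: al`_j = 0.
    by rewrite -[RHS]s0; apply: eq_bigr => j _; rewrite scaler_nat (tnth_nth 0).
  by move=> /(_ erefl i)/eqP; rewrite pnatr_eq0 eqn0Ngt ci.
split=> x.
  apply: lspan_sub (S x) => u [uh|[[c /wte[q wq]]|[c /wtf[q wq]]]];
    apply: lspan_gen.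
  - by exists false, 0; apply: weight_vector_h.
  - by eexists; eexists; apply: wq.
  - by eexists; eexists; apply: wq.
have [h0 h0h hx] : exists2 h0, h0 \in h &
    lspan (fun u => exists2 nu : weight h, nu != 0 & root_vector nu u) (x - h0).
  elim: (S x) => [|a u v [uh|uw] _ [h0 h0h hx]].
  - by exists 0; rewrite ?mem0v // subrr; apply: lspan0.
  - exists (a *: u + h0); first by rewrite memvD ?memvZ.
    by rewrite opprD addrACA subrr add0r.
  exists h0 => //; rewrite -addrA; apply: lspan_cons => //.
  case: uw => -[c uw].
    have [q [_ wq]] := wte _ _ uw; exists (\sum_j tnth al j *+ c j) => //.
    exact/nz/(chevalley_word_neq0 uw).
  have [q [_ wq]] := wtf _ _ uw; exists (- \sum_j tnth al j *+ c j) => //.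
  by rewrite oppr_eq0; apply/nz/(chevalley_word_neq0 uw).
move=> x0; suff /eqP : x - h0 = 0 by rewrite subr_eq0 => /eqP ->.
apply: (root_vector_independent (mu := 0) _ hx).
apply: (subspaceB (root_vector_subspace _)) => //.
by have [] := weight_vector_h he hab h0h.
Qed.

End KacMoody.

(** * Root strings and the invariant form *)

Section StringRelation.
Variables (F : numFieldType) (M : lmodType F) (E D : M -> M) (v : M) (c a : F).
Hypothesis DZ : forall b u, D (b *: u) = b *: D u.
Hypothesis Ev : E v = 0.
Hypothesis ED : forall j,
  E (iter j.+1 D v) = D (E (iter j D v)) + (c - a * j%:R) *: iter j D v.

(** The sl2 computation for a coroot that is not normalized: the commutator of [E] and [D] acts on
    the [j]-th vector of the string by [c - a j]. Root strings use [a = (nu, nu)] and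
    [c = (mu, nu)], the vacuum string uses [a = 2] and [c = k]. *)
Lemma string_relation j :
  E (iter j.+1 D v) = ((c - a * j%:R / 2%:R) * j.+1%:R) *: iter j D v.
Proof.
have D0 : D 0 = 0 by rewrite -[X in D X](scale0r v) DZ scale0r.
elim: j => [|j IH].
  by rewrite ED /= Ev D0 add0r !mulr0 mul0r !subr0 mulr1.
rewrite ED IH DZ -scalerDl; congr (_ *: _).
by rewrite -[j.+2]addn1 -[j.+1]addn1 !natrD; field.
Qed.

Lemma string_nilpotent N : v != 0 -> iter N D v = 0 -> E 0 = 0 ->
  exists2 n : nat, 2%:R * c = a * n%:R & iter n D v != 0.
Proof.
move=> v0 DN E0.
have exN : exists N, iter N D v == 0 by exists N; apply/eqP.
case: (ex_minnP exN) => -[|n] /eqP Dn minn; first by rewrite -Dn eqxx in v0.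
have Dn0 : iter n D v != 0 by apply: contraT => /negPn/minn; rewrite ltnn.
exists n => //.
have /eqP := string_relation n.
rewrite Dn E0 eq_sym scaler_eq0 (negPf Dn0) orbF mulf_eq0 pnatr_eq0 orbF.
by rewrite subr_eq0 => /eqP ->; field.
Qed.

End StringRelation.

Lemma count_ltn (T : eqType) (a b : pred T) (s : seq T) x :
  (forall y, a y -> b y) -> x \in s -> b x -> ~~ a x -> (count a s < count b s)%N.
Proof.
move=> ab xs bx ax; rewrite -(size_filter b) -(count_predC a [seq y <- s | b y]) !count_filter.
rewrite -[X in (X < _)%N]addn0 -addnS leq_add //.
  by apply: sub_count => y /= ay; rewrite ay ab.
by rewrite -has_count; apply/hasP; exists x => //=; rewrite ax bx.
Qed.

Section InvariantForm.
Variables (F : numClosedFieldType) (g : lieSuperalgebra F) (h : {vspace g}).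
Variable B : g -> g -> F.
Local Notation br := (@lsa_br F g).
Local Notation weight := (weight h).
Local Notation wv := (@weight_vector F g h).
Implicit Types (mu nu : weight) (x y e f : g) (p q : bool).

Hypothesis h_even : (h <= lsa_par g false)%VS.
Hypothesis h_abel : forall x y, x \in h -> y \in h -> br x y = 0.
Hypothesis wv_span : forall x, lspan (fun u => exists p mu, wv p mu u) x.
Hypothesis wv_zero : forall x, root_vector (0 : weight) x -> x \in h.
Hypothesis B_inv : invariant_form B.
Hypothesis B_linr : forall c x y z, B z (c *: x + y) = c * B z x + B z y.

Lemma form_0r z : B z 0 = 0.
Proof.
have := B_linr 1 0 0 z; rewrite scaler0 addr0 mul1r => /eqP.
by rewrite -subr_eq subrr eq_sym => /eqP.
Qed.

Lemma form_Zr c x z : B z (c *: x) = c * B z x.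
Proof. by have := B_linr c x 0 z; rewrite form_0r !addr0. Qed.

Lemma form_linl c x y z : B (c *: x + y) z = c * B x z + B y z.
Proof. by case: B_inv. Qed.

Lemma form_0l z : B 0 z = 0.
Proof.
have := form_linl 1 0 0 z; rewrite scaler0 addr0 mul1r => /eqP.
by rewrite -subr_eq subrr eq_sym => /eqP.
Qed.

Lemma form_Zl c x z : B (c *: x) z = c * B x z.
Proof. by have := form_linl c x 0 z; rewrite form_0l !addr0. Qed.

Lemma form_Nl x z : B (- x) z = - B x z.
Proof. by rewrite -scaleN1r form_Zl mulN1r. Qed.

Lemma form_Bl x y z : B (x - y) z = B x z - B y z.
Proof. by rewrite -[x]scale1r form_linl mul1r scale1r form_Nl. Qed.

Lemma form_br x y z : B (br x y) z = B x (br y z).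
Proof. by case: B_inv. Qed.

Lemma form_sym p x y : x \in lsa_par g p -> y \in lsa_par g p ->
  B x y = (-1) ^+ (p && p) * B y x.
Proof. by move=> xp yp; case: B_inv => _ H _ _ _; apply: H. Qed.

Lemma form_symh (s t : subvs_of h) : B (vsval s) (vsval t) = B (vsval t) (vsval s).
Proof. by rewrite (@form_sym false) ?vsval_even //= expr0 mul1r. Qed.

Lemma form_par p q x y : x \in lsa_par g p -> y \in lsa_par g q -> p != q -> B x y = 0.
Proof.
case: B_inv => _ H K _ _; case: p; case: q => // xp yq _; last exact: K.
by rewrite (H _ _ _ _ xp yq) (K _ _ yq xp) mulr0.
Qed.

Lemma form_weight mu nu x y :
  root_vector mu x -> root_vector nu y -> mu + nu != 0 -> B x y = 0.
Proof.
move=> hx hy /weight_neqP[t]; rewrite zero_lfunE add_lfunE => tE.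
have /eqP := form_br x (vsval t) y.
rewrite hy form_Zr -[br x _]opprK -anti_even ?vsval_even // hx form_Nl form_Zl.
rewrite -subr_eq0 -opprD oppr_eq0 -mulrDl mulf_eq0.
by rewrite [_ + _ == 0](negPf tE) => /eqP.
Qed.

(** Weight spaces whose weights do not add up to zero are orthogonal, and so are the two parities;
    nondegeneracy therefore pairs a weight space with the opposite one of the same parity. *)
Lemma form_dual p mu x : wv p mu x -> x != 0 ->
  exists2 y, wv p (- mu) y & B x y = 1.
Proof.
move=> [xp hx] x0; have [|H] := pselect (exists2 y, wv p (- mu) y & B x y != 0).
  move=> [y wy By]; exists ((B x y)^-1 *: y); last by rewrite form_Zr mulVf.
  exact: (subspaceZ (weight_vector_subspace p (- mu))).
case/eqP: x0; case: B_inv => _ _ _ _; apply => y.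
move: (wv_span y); move: y; apply: lspan_least.
  by split=> [|c u v Bu Bv]; [rewrite form_0r|rewrite B_linr Bu Bv mulr0 addr0].
move=> y [q [nu [yq hy]]]; have [pq|pq] := eqVneq p q; last exact: form_par xp yq pq.
have [mn|mn] := eqVneq (mu + nu) 0; last exact: form_weight hx hy mn.
apply/eqP/negPn/negP => By; apply: H; exists y => //.
rewrite pq; split=> //; suff -> : - mu = nu by [].
by apply/eqP; rewrite eq_sym -addr_eq0 addrC mn.
Qed.

Lemma form_h_nondegenerate (s : subvs_of h) :
  (forall t : subvs_of h, B (vsval s) (vsval t) = 0) -> s = 0.
Proof.
move=> H; apply/eqP; rewrite -(inj_eq subvs_inj) linear0; apply/negPn/negP => s0.
have [y [_ hy]] := form_dual (weight_vector_h h_even h_abel (subvsP s)) s0.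
rewrite oppr0 in hy; have [t ->] := subvs_exists (wv_zero hy).
by rewrite H => /eqP; rewrite eq_sym oner_eq0.
Qed.

Lemma dual_exists mu : exists t : subvs_of h,
  forall s : subvs_of h, B (vsval t) (vsval s) = mu s.
Proof.
pose b := vbasis {:subvs_of h}.
have bP (P : subvs_of h -> Prop) : subspace P -> (forall i, P b`_i) -> forall s, P s.
  move=> hP Pb s; have : s \in <<b>>%VS by rewrite (span_basis (vbasisP _)) memvf.
  by apply: span_ind hP _ => y /(nthP 0)[i _ <-].
pose G := \matrix_(i < \dim {:subvs_of h}, j < \dim {:subvs_of h})
            B (vsval b`_i) (vsval b`_j).
have lhs (u : 'rV_(\dim {:subvs_of h})) (j : 'I_(\dim {:subvs_of h})) :
    B (vsval (\sum_i u 0 i *: b`_i)) (vsval b`_j) = (u *m G) 0 j.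
  rewrite mxE linear_sum; under [RHS]eq_bigr do rewrite mxE.
  apply: (big_ind2 (fun x c => B x (vsval b`_j) = c)) => [|x c y c' <- <-|i _].
  - by rewrite form_0l.
  - by have := form_linl 1 x y (vsval b`_j); rewrite scale1r mul1r.
  - by rewrite linearZ form_Zl.
have /inj_row_free G_free (u : 'rV_(\dim {:subvs_of h})) : u *m G = 0 -> u = 0.
  move=> uG; have s0 : \sum_i u 0 i *: b`_i = 0.
    apply: form_h_nondegenerate; apply: bP => [|i].
      split=> [|c x y Bx By]; first by rewrite linear0 form_0r.
      by rewrite linearP B_linr Bx By mulr0 addr0.
    have [ib|ib] := ltnP i (\dim {:subvs_of h}); last first.
      rewrite nth_default ?size_tuple // linear0.
      by rewrite form_0r.
    by rewrite (lhs u (Ordinal ib)) uG mxE.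
  apply/rowP => i; rewrite mxE.
  by have := freeP (basis_free (vbasisP {:subvs_of h})) (u 0) s0 i.
have Gu : G \in unitmx by rewrite -row_free_unit.
pose u := (\row_j (mu b`_j : F)) *m invmx G.
exists (\sum_i u 0 i *: b`_i); apply: bP => [|i].
  split=> [|c x y Bx By]; last by rewrite !linearP B_linr Bx By.
  by rewrite !linear0 form_0r.
have [ib|ib] := ltnP i (\dim {:subvs_of h}); last first.
  rewrite nth_default ?size_tuple // !linear0.
  by rewrite form_0r.
by rewrite (lhs u (Ordinal ib)) mulmxKV // mxE.
Qed.

Definition dual mu : subvs_of h := projT1 (cid (dual_exists mu)).

Lemma dualP mu (s : subvs_of h) : B (vsval (dual mu)) (vsval s) = mu s.
Proof. by rewrite /dual; case: cid. Qed.

Definition ip mu nu : F := mu (dual nu).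

Lemma ip_sym mu nu : ip mu nu = ip nu mu.
Proof. by rewrite /ip -dualP form_symh dualP. Qed.

Lemma ipDl mu nu la : ip (mu + nu) la = ip mu la + ip nu la.
Proof. by rewrite /ip add_lfunE. Qed.

Lemma ipNl mu nu : ip (- mu) nu = - ip mu nu.
Proof. by rewrite /ip opp_lfunE. Qed.

Lemma ipMnl mu nu n : ip (mu *+ n) nu = n%:R * ip mu nu.
Proof.
elim: n => [|n IH]; first by rewrite mulr0n mul0r /ip zero_lfunE.
by rewrite mulrS ipDl IH -[n.+1]add1n natrD mulrDl mul1r.
Qed.

Lemma ipDr mu nu la : ip la (mu + nu) = ip la mu + ip la nu.
Proof. by rewrite !(ip_sym la) ipDl. Qed.

Lemma ipNr mu nu : ip nu (- mu) = - ip nu mu.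
Proof. by rewrite !(ip_sym nu) ipNl. Qed.

Lemma ipMnr mu nu n : ip nu (mu *+ n) = n%:R * ip nu mu.
Proof. by rewrite !(ip_sym nu) ipMnl. Qed.

Definition ipE := (ipDl, ipDr, ipNl, ipNr, ipMnl, ipMnr).

Lemma weight_normP mu c : weight_norm B mu c <-> c = ip mu mu.
Proof.
split=> [[t [ht <-]]|->]; last by exists (dual mu); split=> // s; apply: dualP.
rewrite /ip /weight_eval; congr (mu _); apply/eqP; rewrite -subr_eq0; apply/eqP.
by apply: form_h_nondegenerate => s; rewrite linearB form_Bl dualP ht subrr.
Qed.

Lemma br_dual p mu x y : wv p mu x -> root_vector (- mu) y ->
  br x y = B x y *: vsval (dual mu).
Proof.
move=> [xp hx] hy; have : root_vector (mu - mu) (br x y).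
  exact: (root_vector_br h_even hx hy).
rewrite subrr => /wv_zero/subvs_exists[t tE].
rewrite tE; suff -> : t = B x y *: dual mu by rewrite linearZ.
apply/eqP; rewrite -subr_eq0; apply/eqP; apply: form_h_nondegenerate => s.
have -> : vsval (t - B x y *: dual mu) = vsval t - B x y *: vsval (dual mu).
  by rewrite linearB linearZ.
rewrite form_Bl form_Zl dualP -tE form_br -[br y _]opprK.
rewrite -anti_even ?vsval_even // hy -scaleNr form_Zr /weight_eval opp_lfunE opprK.
by rewrite mulrC subrr.
Qed.

Definition is_weight p mu := exists2 x, wv p mu x & x != 0.

Lemma is_weightI p mu x : wv p mu x -> x != 0 -> is_weight p mu.
Proof. by exists x. Qed.

Definition even_root mu := mu != 0 /\ is_weight false mu.

Lemma even_rootE mu : root_in (lsa_par g false) mu <-> even_root mu.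
Proof.
split=> [[mu0 [x [x0 xe hx]]]|[mu0 [x [xe hx] x0]]]; first by split=> //; exists x.
by split=> //; exists x.
Qed.

Lemma weights_finite :
  exists L : seq weight, forall mu x, x != 0 -> root_vector mu x -> mu \in L.
Proof.
have [s sw s_span] := lspan_finite (fun u => exists p mu, wv p mu u).
have [L hL] : exists L : seq weight,
    forall y, y \in s -> exists2 nu, nu \in L & root_vector nu y.
  elim: s sw {s_span} => [|y s IH] sw; first by exists [::].
  have [|L hL] := IH; first by move=> z zs; apply: sw; rewrite inE zs orbT.
  have [p [mu [_ hy]]] := sw y (mem_head _ _).
  exists (mu :: L) => z; rewrite inE => /orP[/eqP->|/hL[nu nuL hz]].
    by exists mu; rewrite ?mem_head.
  by exists nu; rewrite // inE nuL orbT.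
exists L => mu x x0 hx; apply/negPn/negP => muL; case/eqP: x0.
apply: (root_vector_independent hx).
apply: span_ind (s_span x (wv_span x)); first exact: lspan_subspace.
move=> y /hL[nu nuL hy]; apply: lspan_gen; exists nu => //.
by apply: contraNneq muL => <-.
Qed.

Lemma iter_weight p mu nu e x j : wv false nu e -> wv p mu x ->
  wv p (mu + nu *+ j) (iter j (br e) x).
Proof.
move=> we wx; elim: j => [|j IH]; first by rewrite mulr0n addr0.
by rewrite mulrSr addrA addrC; apply: (weight_vector_br h_even we IH).
Qed.

Lemma lfun_mulrn mu n (t : subvs_of h) : (mu *+ n) t = mu t *+ n.
Proof. by elim: n => [|n IH]; rewrite ?mulr0n ?zero_lfunE // !mulrS add_lfunE IH. Qed.

Lemma weight_mulIn nu : nu != 0 -> injective (fun n : nat => nu *+ n).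
Proof.
move=> /weight_neqP[t]; rewrite zero_lfunE => tE n m /(congr1 (fun mu : weight => mu t)).
rewrite !lfun_mulrn => /eqP; rewrite -subr_eq0.
wlog mn : n m / (m <= n)%N.
  move=> H; have [mn|/ltnW nm] := leqP m n; first exact: H.
  by rewrite -oppr_eq0 opprB => /(H _ _ nm).
rewrite -mulrnBr // mulrn_eq0 (negPf tE) orbF subn_eq0 => nm.
by apply/eqP; rewrite eqn_leq nm mn.
Qed.

Lemma ad_nilpotent p mu nu e x : nu != 0 -> wv false nu e -> wv p mu x ->
  exists N, iter N (br e) x = 0.
Proof.
move=> nu0 we wx; apply/not_existsP => H; have [L hL] := weights_finite.
have sub : {subset [seq mu + nu *+ j | j <- iota 0 (size L).+1] <= L}.
  move=> _ /mapP[j _ ->]; have [_ hj] := iter_weight j we wx.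
  by apply: hL hj; apply/eqP/H.
suff /uniq_leq_size/(_ sub) : uniq [seq mu + nu *+ j | j <- iota 0 (size L).+1].
  by rewrite size_map size_iota ltnn.
by rewrite map_inj_uniq ?iota_uniq // => i j /addrI/(weight_mulIn nu0).
Qed.

(** The bracket is the dual [t_nu] of [nu] and not the coroot [2 t_nu / (nu, nu)], so the notion
    makes sense before [(nu, nu)] is known to be nonzero. *)
Definition root_pair nu e f :=
  [/\ wv false nu e, wv false (- nu) f & br e f = vsval (dual nu)].

Lemma even_root_pair nu : even_root nu -> exists e f, root_pair nu e f.
Proof.
move=> [nu0 [e we e0]]; have [f wf ef] := form_dual we e0.
by exists e, f; split=> //; rewrite (br_dual we) ?ef ?scale1r //; have [] := wf.
Qed.

Lemma dual_unique mu (t : subvs_of h) :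
  (forall s : subvs_of h, B (vsval t) (vsval s) = mu s) -> t = dual mu.
Proof.
move=> ht; apply/eqP; rewrite -subr_eq0; apply/eqP; apply: form_h_nondegenerate => s.
by rewrite linearB form_Bl dualP ht subrr.
Qed.

Lemma dualN nu : dual (- nu) = - dual nu.
Proof.
symmetry; apply: dual_unique => s.
by rewrite linearN form_Nl dualP opp_lfunE.
Qed.

Lemma root_pair_opp nu e f : root_pair nu e f -> root_pair (- nu) f e.
Proof.
move=> [we wf ef]; split; rewrite ?opprK //.
by rewrite anti_even ?ef ?dualN ?linearN //; have [] := wf.
Qed.

Lemma even_root_opp nu : even_root nu -> even_root (- nu).
Proof.
move=> [nu0 [e we e0]]; split; first by rewrite oppr_eq0.
have [f wf ef] := form_dual we e0; exists f => //.
by apply/eqP => f0; move: ef; rewrite f0 form_0r => /eqP; rewrite eq_sym oner_eq0.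
Qed.

Lemma is_weight_opp p mu : is_weight p mu -> is_weight p (- mu).
Proof.
move=> [e we e0]; have [f wf ef] := form_dual we e0; exists f => //.
by apply/eqP => f0; move: ef; rewrite f0 form_0r => /eqP; rewrite eq_sym oner_eq0.
Qed.

Lemma iter_br0 e j : iter j (br e) 0 = 0.
Proof. by elim: j => //= j ->; rewrite br0r. Qed.

Lemma iter_neq0 e j i x : (j <= i)%N -> iter i (br e) x != 0 -> iter j (br e) x != 0.
Proof.
move=> ji; apply: contraNneq => j0.
by rewrite -(subnK ji) iterD j0 iter_br0.
Qed.

Lemma highest_weight_string p mu nu e f x : nu != 0 -> root_pair nu e f ->
  wv p mu x -> x != 0 -> br e x = 0 ->
  exists2 n : nat, 2%:R * ip mu nu = ip nu nu * n%:R & iter n (br f) x != 0.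
Proof.
move=> nu0 [we wf ef] wx x0 ex.
have nuN0 : - nu != 0 by rewrite oppr_eq0.
have [N fN] := ad_nilpotent nuN0 wf wx.
apply: (string_nilpotent (E := br e)) x0 fN _; rewrite ?br0r //.
  by move=> b u; rewrite brZr.
move=> j /=; rewrite jacobi_even; last by case: we.
rewrite ef addrC; have [_ ->] := iter_weight j wf wx; congr (_ + _ *: _).
rewrite /weight_eval mulNrn add_lfunE opp_lfunE lfun_mulrn -/(ip mu nu) -/(ip nu nu).
by rewrite mulr_natr.
Qed.

(** From the last nonzero vector of the [e]-string, of weight [mu + i nu], the [f]-string goes down
    [n] steps; the integer asked for is [n - 2 i]. For [(nu, nu) = 0] the equation still yields
    [(mu, nu) = 0]. *)
Lemma root_string p mu nu : even_root nu -> is_weight p mu ->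
  exists2 n : int, 2%:R * ip mu nu = ip nu nu * n%:~R
    & forall j : nat, j%:Z <= n -> is_weight p (mu - nu *+ j).
Proof.
move=> hnu [x wx x0]; have [nu0 _] := hnu; have [e [f ef]] := even_root_pair hnu.
have [we wf _] := ef.
have [N eN] := ad_nilpotent nu0 we wx.
have exN : exists N, iter N (br e) x == 0 by exists N; apply/eqP.
case: (ex_minnP exN) => -[|i] /eqP ei mini; first by rewrite -ei eqxx in x0.
have i0 : iter i (br e) x != 0 by apply: contraT => /negPn/mini; rewrite ltnn.
have wi := iter_weight i we wx.
have [n hn n0] := highest_weight_string nu0 ef wi i0 ei.
exists (n%:Z - (i.*2)%:Z) => [|j jn].
  rewrite intrB mulrBr -[n%:~R]/(n%:R) -hn ipDl ipMnl.
  by rewrite -[_%:~R]/(i.*2%:R) -mul2n natrM; ring.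
have ijn : (i + j <= n)%N by move: jn; lia.
exists (iter (i + j) (br f) (iter i (br e) x)); last exact: iter_neq0 ijn n0.
have := iter_weight (i + j) wf wi; congr (wv _ _ _).
by rewrite mulNrn mulrnDr opprD addrA -[mu + _ - _]addrA subrr addr0.
Qed.

Lemma root_stringN p mu nu : even_root nu -> is_weight p mu ->
  exists2 n : int, 2%:R * ip mu nu = ip nu nu * n%:~R
    & forall j : nat, j%:Z <= - n -> is_weight p (mu + nu *+ j).
Proof.
move=> /even_root_opp hnu wmu; have [n nE hn] := root_string hnu wmu.
exists (- n) => [|j]; last by rewrite opprK => /hn; rewrite mulNrn opprK.
apply: oppr_inj; rewrite intrN mulrN opprK -mulrN -ipNr nE.
by rewrite ipNl ipNr opprK.
Qed.

Lemma even_root_reflect p mu nu : even_root nu -> is_weight p mu ->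
  exists2 n : int, 2%:R * ip mu nu = ip nu nu * n%:~R & is_weight p (mu - nu *~ n).
Proof.
move=> hnu wmu; have [n nE hn] := root_string hnu wmu.
have [|n0] := boolP (ip nu nu == 0).
  move=> /eqP n0; exists 0; last by rewrite mulr0z subr0.
  by rewrite nE n0 !mul0r.
have [m mE hm] := root_stringN hnu wmu.
have nm : n = m.
  by move: mE; rewrite nE => /(mulfI n0)/eqP; rewrite eqr_int => /eqP.
exists n => //; have [n_ge0|n_lt0] := leP 0 n.
  by case: n n_ge0 hn {nE nm mE} => // n _ hn; exact: (hn n (lexx _)).
rewrite -[n]opprK mulrNz opprK.
have : 0 <= - n by lia.
by rewrite -nm in hm; case: (- n) hm => // l hm _; exact: (hm l (lexx _)).
Qed.

Hypothesis g0_reductive : even_reductive g.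

Lemma commutator_spaceP (U W : {vspace g}) x y :
  x \in U -> y \in W -> br x y \in commutator_space U W.
Proof.
rewrite -{1}(span_basis (vbasisP U)) -{1}(span_basis (vbasisP W)) => xU yW.
apply: (span_ind (P := fun z => br z y \in commutator_space U W)) xU => [|z zU].
  by split=> [|c u v]; rewrite ?br0l ?mem0v // brDl brZl => *; rewrite memvD ?memvZ.
apply: (span_ind (P := fun w => br z w \in commutator_space U W)) yW => [|w wW].
  by split=> [|c u v]; rewrite ?br0r ?mem0v // brDr brZr => *; rewrite memvD ?memvZ.
by apply: memv_span; apply/allpairsP; exists (z, w).
Qed.

(** If [(nu, nu) = 0], then [root_string] makes [nu] orthogonal to every weight, so its dual in [h]
    is central. Being a bracket [[e, f]], it spans an abelian ideal of the derived even algebra,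
    which reductivity excludes. *)
Lemma even_root_anisotropic nu : even_root nu -> ip nu nu != 0.
Proof.
move=> hnu; apply/eqP => nn; have [nu0 _] := hnu.
have [e [f [[ee _] [fe _] ef]]] := even_root_pair hnu.
have kill x : br (vsval (dual nu)) x = 0.
  move: (wv_span x); move: x; apply: lspan_least.
    by split=> [|c u v]; rewrite ?br0r // brDr brZr => -> ->; rewrite scaler0 addr0.
  move=> x [p [mu wx]]; have [->|x0] := eqVneq x 0; first by rewrite br0r.
  have [_ ->] := wx; have [n nE _] := root_string hnu (ex_intro2 _ _ x wx x0).
  move/eqP: nE; rewrite nn mul0r mulf_eq0 pnatr_eq0 /= => /eqP.
  by rewrite /ip /weight_eval => ->; rewrite scale0r.
have : <[vsval (dual nu)]>%VS = 0%VS.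
  case: g0_reductive => _; apply.
  - by rewrite -memvE -ef; apply: commutator_spaceP.
  - move=> x y _ /vlineP[c ->]; rewrite brZr.
    by rewrite -[br x _]opprK -anti_even ?vsval_even // kill oppr0 scaler0 mem0v.
  - by move=> x y /vlineP[c ->] _; rewrite brZl kill scaler0.
move=> /eqP; rewrite -dimv_eq0 dim_vline eqb0 negbK => /eqP d0.
case/eqP: nu0; apply/lfunP => s; rewrite -dualP d0 form_0l.
by rewrite zero_lfunE.
Qed.

Lemma ipMzl mu nu n : ip (mu *~ n) nu = n%:~R * ip mu nu.
Proof.
case: n => n; first exact: ipMnl.
by rewrite NegzE mulrNz ipNl ipMnl mulrNz mulNr.
Qed.

Lemma ipMzr mu nu n : ip nu (mu *~ n) = n%:~R * ip nu mu.
Proof. by rewrite !(ip_sym nu) ipMzl. Qed.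

Lemma ip0l nu : ip 0 nu = 0.
Proof. by rewrite /ip zero_lfunE. Qed.

(** [ad f] is injective on vectors of weight [gam]: a nonzero vector in its kernel would give
    [- 2 (gam, gam) = (gam, gam) n] with [n >= 0]. Since [[f, y]] is determined by [B y f],
    subtracting a multiple of [e] from [x] leaves zero, and an odd [x] is itself zero. *)
Lemma even_root_line gam p e x : even_root gam ->
  wv false gam e -> e != 0 -> wv p gam x -> exists c, x = c *: e.
Proof.
move=> hg we e0 wx; have [f wf ef] := form_dual we e0.
have pair : root_pair gam e f.
  by split=> //; have [_ hf] := wf; rewrite (br_dual we hf) ef scale1r.
have kill q y : wv q gam y -> br f y = 0 -> y = 0.
  move=> wy fy; apply/eqP/negPn/negP => y0; have [g0 _] := hg.
  have gN0 : - gam != 0 by rewrite oppr_eq0.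
  have [n nE _] := highest_weight_string gN0 (root_pair_opp pair) wy y0 fy.
  move/eqP: nE; rewrite ipNl !ipNr opprK mulrN -subr_eq0 -opprD oppr_eq0.
  rewrite mulrC -mulrDr -natrD mulf_eq0 (negPf (even_root_anisotropic hg)).
  by rewrite pnatr_eq0.
have brx q y : wv q gam y -> br f y = - (B y f *: vsval (dual gam)).
  by move=> wy; rewrite anti_even ?(br_dual wy) //; case: wf.
case: p wx => wx.
  exists 0; rewrite scale0r; apply: (kill _ _ wx); rewrite (brx _ _ wx).
  by rewrite (@form_par true false) ?scale0r ?oppr0 //; [case: wx|case: wf].
exists (B x f); apply/eqP; rewrite -subr_eq0; apply/eqP; apply: (kill false).
  by apply: (subspaceB (weight_vector_subspace _ _)) => //;
    apply: (subspaceZ (weight_vector_subspace _ _)).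
rewrite brDr brNr brZr (brx _ _ wx) (brx _ _ we) ef scale1r.
by rewrite scalerN opprK addNr.
Qed.

(** For [e] odd of weight [mu] and a dual vector [f], the super Jacobi identity gives [[f, [e, e]] =
    2 (mu, mu) e] up to sign, so [[e, e]] does not vanish. *)
Lemma odd_root_double mu : is_weight true mu -> ip mu mu != 0 -> even_root (mu + mu).
Proof.
move=> [e we e0] mm; have [f wf ef] := form_dual we e0.
have [eo he] := we; have [fo hf] := wf.
have mu0 : mu != 0 by apply: contraNneq mm => ->; rewrite ip0l.
split.
  have := @weight_mulIn mu mu0 2%N 0%N; rewrite mulr2n mulr0n => H.
  by apply/eqP => /H.
exists (br e e); first exact: (weight_vector_br h_even we we).
apply/eqP => ee; have := lsa_br_jacobi e fo eo; rewrite ee br0r.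
have fe : br f e = vsval (dual mu).
  by rewrite (lsa_br_anti fo eo) expr1 scaleN1r opprK (br_dual we hf) ef scale1r.
rewrite fe expr1 scaleN1r -anti_even ?vsval_even // he -scalerDl => /eqP.
rewrite eq_sym scaler_eq0 (negPf e0) orbF /weight_eval -/(ip mu mu).
by rewrite -mulr2n -mulr_natr mulf_eq0 (negPf mm) pnatr_eq0.
Qed.

Variables (nm np : {vspace g}).
Hypothesis triangular : triangular_decomposition h nm np.
Hypothesis connected : even_dynkin_connected h np.

Lemma positive_even_root_height : exists t0 : subvs_of h,
  (forall gam, even_root gam -> 0 < (gam t0 : F) \/ (gam t0 : F) < 0) /\
  (forall gam, root_in (lsa_par g false :&: np) gam <-> even_root gam /\ 0 < (gam t0 : F)).
Proof.
have [full direct [t0 ht]] := triangular; exists t0.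
have rootT gam : even_root gam -> root_in fullv gam.
  by move=> [g0 [x [_ hx] x0]]; split=> //; exists x; rewrite memvf.
split=> [gam /rootT/ht[[]|[]]|gam]; [by left|by right|].
split=> [[g0 [x [x0]]]|[hg pos]].
  rewrite memv_cap => /andP[xe xn] hx; have hg : even_root gam by split=> //; exists x.
  split=> //; have [[]//|[_ /(_ x hx) xm]] := ht gam (rootT _ hg).
  case/eqP: x0; apply/eqP; rewrite -memv0.
  move: direct; rewrite directv_addE => /and3P[_ _ /eqP/= <-].
  by rewrite memv_cap xn andbT; apply: subvP xm; rewrite addvSl.
have [g0 [x [xe hx] x0]] := hg; split=> //; exists x; split=> //.
rewrite memv_cap xe; have [[_ /(_ x hx)]//|[neg _]] := ht gam (rootT _ hg).
by have := lt_trans pos neg; rewrite ltxx.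
Qed.

(** * Orthogonality classes of even roots and positivity of norms *)

Section OrthogonalClass.
Variable P : weight -> Prop.
Hypothesis P_orth : forall a b, even_root a -> even_root b -> P a -> ~ P b -> ip a b = 0.

(** If [b] were outside the class, then [(a, b) = 0], and [a + b] would pair with [a] and with [b]
    by their nonzero norms; but it is orthogonal to one of the two, whether it lies in the class or
    not. *)
Lemma class_sum a b : even_root a -> even_root b -> even_root (a + b) -> P a -> P b.
Proof.
move=> ha hb hab Pa; have [//|nPb] := pselect (P b); exfalso.
have ab := P_orth ha hb Pa nPb.
have [Pab|nPab] := pselect (P (a + b)).
  have /eqP := P_orth hab hb Pab nPb.
  by rewrite ipDl ab add0r (negPf (even_root_anisotropic hb)).
have /eqP := P_orth ha hab Pa nPab.
by rewrite ipDr ab addr0 (negPf (even_root_anisotropic ha)).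
Qed.

Lemma class_opp a : even_root a -> P a -> P (- a).
Proof.
move=> ha Pa; have [//|nPb] := pselect (P (- a)).
have /eqP := P_orth ha (even_root_opp ha) Pa nPb.
by rewrite ipNr oppr_eq0 (negPf (even_root_anisotropic ha)).
Qed.

(** Descent along heights. If a root [b] of the class is a sum [c + d] of positive roots, then [c]
    or [d] is in the class since [(b, b)] is nonzero, and [class_sum] passes it to the other.
    Heights lie in the field, so the induction counts the weights of smaller height. *)
Lemma class_simple_root a : even_root a -> P a ->
  exists b : weight, [/\ affine_even_simple np (b, 0), even_root b & P b].
Proof.
have [t0 [sgn pos]] := positive_even_root_height.
have [L hL] := weights_finite.
pose ht (gam : weight) : F := gam t0.
suff main n b : (count (fun c => (ht c < ht b)%R) L < n)%N -> even_root b -> 0 < ht b ->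
    P b -> exists b : weight, [/\ affine_even_simple np (b, 0), even_root b & P b].
  move=> ha Pa; case: (sgn a ha) => ht_a; first exact: (main _ a (ltnSn _)).
  apply: (main _ (- a) (ltnSn _)); [exact: even_root_opp| |exact: class_opp].
  by rewrite /ht opp_lfunE oppr_gt0.
elim: n b => // n IH b bn hb b_gt0 Pb.
have bpos : affine_even_positive np (b, 0).
  by split; [left; apply/even_rootE|right; split=> //; apply/pos].
have [simple|] := pselect (affine_even_simple np (b, 0)); first by exists b.
move=> /not_andP[//|/contrapT[[c1 c2] [[d1 d2] [[hc pc] [hd pd] [bE zE]]]]].
have [c20 d20] : c2 = 0 /\ d2 = 0.
  have : 0 <= c2 by case: pc => [/ltW|[/= ->]].
  have : 0 <= d2 by case: pd => [/ltW|[/= ->]].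
  by move: zE; lia.
have root_of (x : weight) (s : int) : s = 0 -> 0 < s \/ (s = 0 /\
    root_in (lsa_par g false :&: np) x) -> even_root x /\ 0 < ht x.
  by move=> -> [|[_ /pos]]; rewrite ?ltxx.
have [hc1 c1_gt0] := root_of _ _ c20 pc; have [hd1 d1_gt0] := root_of _ _ d20 pd.
rewrite /= in bE; have Pc : P c1.
  have [//|nPc] := pselect (P c1); exfalso.
  have [Pd|nPd] := pselect (P d1).
    by apply: nPc; apply: (class_sum hd1) Pd; rewrite // addrC -bE.
  have /eqP : ip b b = 0.
    by rewrite {2}bE ipDr (P_orth hb hc1 Pb nPc) (P_orth hb hd1 Pb nPd) addr0.
  by rewrite (negPf (even_root_anisotropic hb)).
have htlt : ht c1 < ht b by rewrite bE /ht add_lfunE ltrDl.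
apply: (IH c1) => //; rewrite ltnS in bn; apply: leq_trans bn.
have [x [_ hx] x0] := hc1.2.
apply: (count_ltn (x := c1)); rewrite ?ltxx //; last exact: hL hx.
by move=> y ylt; apply: lt_trans htlt.
Qed.

End OrthogonalClass.

Lemma orthogonal_class_full (P : weight -> Prop) :
  (forall a b, even_root a -> even_root b -> P a -> ~ P b -> ip a b = 0) ->
  forall a b, even_root a -> even_root b -> P a -> P b.
Proof.
move=> orth a b ha hb Pa; have [//|nPb] := pselect (P b); exfalso.
have [a' [sa ha' Pa']] := class_simple_root orth ha Pa.
have orth' c d : even_root c -> even_root d -> ~ P c -> ~ ~ P d -> ip c d = 0.
  by move=> hc hd nPc /contrapT Pd; rewrite ip_sym; apply: orth.
have [b' [sb hb' nPb']] := class_simple_root orth' hb nPb.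
have [t0 [sgn pos]] := positive_even_root_height.
(* An imaginary root is not simple: [c2 delta] is the sum of a positive even root [r] and of
   [- r + c2 delta]. *)
have not_imaginary c : affine_even_simple np c -> even_root c.1.
  case: c => c1 c2 [[[/even_rootE//|[/= c10 c20]] c_pos] nsum]; exfalso; apply: nsum.
  have [r [hr r_gt0]] : exists r, even_root r /\ 0 < (r t0 : F).
    have [r_gt0|r_lt0] := sgn a ha; first by exists a.
    by exists (- a); split; [apply: even_root_opp|rewrite opp_lfunE oppr_gt0].
  have c2_gt0 : 0 < c2 by case: c_pos => [//|[/eqP]]; rewrite (negPf c20).
  exists (r, 0), (- r, c2); split; last by rewrite c10; congr pair; rewrite /= ?subrr ?add0r.
    by split; [left; apply/even_rootE|right; split=> //; apply/pos].
  by split; [left; apply/even_rootE/even_root_opp|left].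
have [_ _ conn] := connected.
suff [_ /nPb'] : even_root (b', 0 : int).1 /\ P (b', 0 : int).1 by [].
elim: (conn (a', 0) (b', 0) sa sb) => // c d _ [hc Pc] sd _ cd.
have hd := not_imaginary d sd; split=> //.
(* Two adjacent affine simple roots may add up to a multiple of [delta], as happens for affine sl2;
   then their finite parts are opposite. *)
case: cd => [/even_rootE hcd|[/= cd0 _]]; first exact: (class_sum orth) Pc.
by rewrite -[d.1]add0r -(subrr c.1) -addrA [_ + d.1]addrC addrA cd0 add0r; apply: class_opp.
Qed.

Hypothesis norm_le2 : forall nu, even_root nu -> ip nu nu <= 2%:R.
Hypothesis long_exists : exists2 th, even_root th & ip th th = 2%:R.

(** The string [mu, mu - nu, ..., mu - m nu] consists of distinct weights, and [g] has finitely
    many. *)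
Lemma same_norm_bound (b : F) : b != 0 -> exists N : nat, forall mu nu (m : int),
  even_root mu -> even_root nu -> ip mu mu = b -> ip nu nu = b ->
  2%:R * ip mu nu = b * m%:~R -> m <= N%:Z.
Proof.
move=> b0; have [L hL] := weights_finite; exists (size L) => mu nu m hmu hnu mub nub mE.
rewrite leNgt; apply/negP => Lm.
have [n nE hn] := root_string hnu hmu.2.
have n_m : n = m by move: nE; rewrite mE nub => /(mulfI b0)/eqP; rewrite eqr_int => /eqP.
have sub : {subset [seq mu - nu *+ j | j <- iota 0 (size L).+1] <= L}.
  move=> _ /mapP[j + ->]; rewrite mem_iota add0n => /andP[_ jL].
  by have [|x [_ hx] x0] := hn j; [rewrite n_m; lia|exact: hL hx].
suff /uniq_leq_size/(_ sub) : uniq [seq mu - nu *+ j | j <- iota 0 (size L).+1].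
  by rewrite size_map size_iota ltnn.
rewrite map_inj_uniq ?iota_uniq // => i j /addrI/oppr_inj.
exact: weight_mulIn hnu.1 _ _.
Qed.

(* Two roots of equal norm [b] with pairing [b m / 2], [m >= 3], yield by
   reflection another such pair with [m] replaced by [m ^ 2 - 2 > m]. *)
Lemma same_norm_pairing (b : F) mu nu (m : int) : b != 0 ->
  even_root mu -> even_root nu -> ip mu mu = b -> ip nu nu = b ->
  2%:R * ip mu nu = b * m%:~R -> m <= 2.
Proof.
move=> b0 hmu hnu mub nub mE; rewrite leNgt; apply/negP => m3.
have [N hN] := same_norm_bound b0.
suff main k : exists mu' nu' (m' : int),
    [/\ even_root mu', even_root nu', ip mu' mu' = b, ip nu' nu' = b &
     2%:R * ip mu' nu' = b * m'%:~R /\ 3 + k%:Z <= m'].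
  have [mu' [nu' [m' [h1 h2 h3 h4 [h5 h6]]]]] := main N.
  by have := hN _ _ _ h1 h2 h3 h4 h5; lia.
elim: k => [|k [mu' [nu' [m' [h1 h2 h3 h4 [h5 h6]]]]]].
  by exists mu, nu, m; split=> //; split=> //; lia.
have [n nE wn] := even_root_reflect h1 h2.2.
have n_m : n = m'.
  by move: nE; rewrite ip_sym h5 h3 => /(mulfI b0)/eqP; rewrite eqr_int => /eqP.
subst n; pose r := mu' *~ m' - nu'.
have hr : even_root (- r).
  rewrite /r opprB; split=> //; apply/eqP => r0.
  have e1 : nu' = mu' *~ m' by apply/eqP; rewrite -subr_eq0 r0.
  have : ip nu' nu' = m'%:~R * ip mu' nu' by rewrite {1}e1 ipMzl.
  rewrite h4; have : ip mu' nu' = b * (m'%:~R / 2%:R).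
    by apply: (mulfI (x := 2%:R)); rewrite ?pnatr_eq0 // h5; field.
  move=> -> bE; have : b * (m' * m' - 2)%:~R = 0.
    by rewrite intrB intrM mulrBr {2}bE; field.
  by move=> /eqP; rewrite mulf_eq0 (negPf b0) intr_eq0 /= => /eqP; nia.
have {}hr : even_root r by rewrite -[r]opprK; apply: even_root_opp.
exists r, nu', (m' * m' - 2); split=> //.
  rewrite /r !(ipDl, ipDr, ipNl, ipNr, ipMzl, ipMzr) h3 h4 (ip_sym nu' mu').
  have -> : ip mu' nu' = b * (m'%:~R / 2%:R).
    by apply: (mulfI (x := 2%:R)); rewrite ?pnatr_eq0 // h5; field.
  by field.
split; last by nia.
rewrite /r ipDl ipNl ipMzl h4 mulrBr mulrCA h5 intrB intrM.
by ring.
Qed.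

(** Let [(a, a) > 0 > (b, b)] with [(a, b)] nonzero. The reflection [r = b - n a] has the norm of
    [b], and [2 (b, r) / (b, b) = 2 - n ^ 2 (a, a) / (b, b) > 2], against [same_norm_pairing]. So
    the roots of positive norm form an orthogonal class, which contains a root of norm [2]. *)
Lemma even_root_norm_gt0 nu : even_root nu -> 0 < ip nu nu.
Proof.
have [th hth thn] := long_exists => hnu.
apply: (orthogonal_class_full (P := fun nu => 0 < ip nu nu) _ hth hnu); last first.
  by rewrite thn ltr0n.
move=> {th hth thn hnu nu} a b ha hb a_gt0 b_le0; apply/eqP/negPn/negP => ab0.
(* The order of a [numClosedFieldType] is partial; comparability with [2] makes the norm real, hence
   gives it a sign. *)
have b_real : ip b b \is Num.real.
  have := norm_le2 hb; rewrite -subr_ge0 => /ger0_real h2.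
  by rewrite -[ip b b](subKr 2%:R) rpredB // realn.
have b_lt0 : ip b b < 0.
  rewrite lt_neqAle even_root_anisotropic //=.
  by have [|//] := real_ltP (real0 _) b_real.
have [n nE wn] := even_root_reflect ha hb.2; rewrite ip_sym in nE.
set r := b - a *~ n in wn.
have rr : ip r r = ip b b.
  have -> : ip r r = ip b b - n%:~R * (2%:R * ip a b) + n%:~R * n%:~R * ip a a.
    by rewrite /r !(ipDl, ipDr, ipNl, ipNr, ipMzl, ipMzr) (ip_sym b a); ring.
  by rewrite nE; ring.
have b0 := even_root_anisotropic hb.
have hr : even_root r.
  by split=> //; apply: contraNneq b0 => r0; rewrite -rr r0 ip0l.
have [m mE _] := even_root_reflect hr hb.2; rewrite rr in mE.
have := same_norm_pairing b0 hb hr erefl rr mE.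
rewrite leNgt => /negP; apply.
have n0 : n != 0.
  apply: contraNneq ab0 => n0; move: nE; rewrite n0 mulr0 => /eqP.
  by rewrite mulf_eq0 pnatr_eq0.
have brE : 2%:R * ip b r = 2%:R * ip b b - n%:~R * n%:~R * ip a a.
  rewrite /r ipDr ipNr ipMzr (ip_sym b a) mulrBr mulrCA nE; ring.
rewrite mE in brE.
have : ip b b * (m - 2)%:~R < 0.
  rewrite intrB mulrBr brE [ip b b * _]mulrC addrAC subrr sub0r oppr_lt0.
  by rewrite pmulr_lgt0 // -intrM ltr0z; nia.
by rewrite nmulr_rlt0 // ltr0z; lia.
Qed.

(** * Pairings with a long root *)

Lemma weight_pairing_int th p mu : even_root th -> ip th th = 2%:R -> is_weight p mu ->
  exists2 m : int, ip mu th = m%:~R &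
    forall j : nat, j%:Z <= m -> is_weight p (mu - th *+ j).
Proof.
move=> hth thn wmu; have [m mE hm] := root_string hth wmu; exists m => //.
by move: mE; rewrite thn => /(mulfI _)->; rewrite ?pnatr_eq0.
Qed.

Lemma long_root_extremal th p mu (m : int) : even_root th -> ip th th = 2%:R ->
  is_weight p mu -> ip mu th = m%:~R -> 2 <= m -> mu = th.
Proof.
move=> hth thn.
(* For an even root [nu] different from [th], the root [nu - th] would have norm
   [(nu, nu) - 2 - 2 (n - 2) <= 0]. *)
have evenC nu (n : int) : is_weight false nu -> ip nu th = n%:~R -> 2 <= n -> nu = th.
  move=> wnu nE n2; apply/eqP; rewrite -subr_eq0; apply/negPn/negP => d0.
  have [n' n'E hn] := weight_pairing_int hth thn wnu.
  have nn' : n = n' by move/eqP: n'E; rewrite nE eqr_int => /eqP.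
  have w1 : is_weight false (nu - th) by have := hn 1%N; rewrite mulr1n; apply; lia.
  have nu0 : nu != 0.
    apply: contraTneq n2 => nu0; move/eqP: nE; rewrite nu0 ip0l eq_sym intr_eq0.
    by move=> /eqP->.
  have := norm_le2 (conj nu0 wnu); set c := ip nu nu => c2.
  have : ip (nu - th) (nu - th) = (c - 2%:R) - (2 * (n - 2))%:~R.
    by rewrite !(ipDl, ipDr, ipNl, ipNr) thn (ip_sym th nu) nE -/c intrM intrB; ring.
  have := even_root_norm_gt0 (conj d0 w1) => /[swap] ->.
  move=> h0; have : (c - 2%:R) - (2 * (n - 2))%:~R <= 0.
    by rewrite subr_le0; apply: (@le_trans _ _ 0); rewrite ?subr_le0 // ler0z; lia.
  by move=> /(lt_le_trans h0); rewrite ltxx.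
case: p => wmu mE m2; last exact: evenC mE m2.
exfalso; have mu0 : mu != 0.
  apply: contraTneq m2 => mu0; move/eqP: mE; rewrite mu0 ip0l eq_sym intr_eq0.
  by move=> /eqP->.
have [mm|mm] := eqVneq (ip mu mu) 0; last first.
  have [_ w2] := odd_root_double wmu mm.
  have e2 : ip (mu + mu) th = (m + m)%:~R by rewrite ipDl mE intrD.
  have := evenC _ _ w2 e2; move=> /(_ ltac:(lia)) E; move/eqP: e2.
  by rewrite E thn -[2%:R]/(2%:~R) eqr_int => /eqP; lia.
have [n nE hn] := weight_pairing_int hth thn wmu.
have n_m : n = m by move/eqP: nE; rewrite mE eqr_int => /eqP.
subst n; case: m => m // in mE nE m2 hn *.
(* At the reflected weight [mu - m th] the element [[e, f]], dual to [mu], acts by [- m ^ 2], which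
   is nonzero; by the Jacobi identity [[f, x]] or [[e, x]] is nonzero, of even weight [- m th] or
   [2 mu - m th]. *)
have [x wx x0] := hn m (lexx _); pose mu' := mu - th *+ m.
have mu'E : mu' = mu - th *+ m by [].
rewrite -mu'E in wx; clearbody mu'.
have [e we e0] := wmu; have [f wf ef] := form_dual we e0.
have [eo _] := we; have [fo hf] := wf.
have bef : br e f = vsval (dual mu) by rewrite (br_dual we hf) ef scale1r.
have ipm : ip mu' mu = - (m%:R * m%:R).
  by rewrite mu'E !ipE mm (ip_sym th mu) mE sub0r.
have m0 : (m%:R : F) != 0 by rewrite pnatr_eq0; lia.
have := lsa_br_jacobi x eo fo; rewrite bef expr1 scaleN1r => jac.
have : br (vsval (dual mu)) x != 0.
  have [_ ->] := wx; rewrite scaler_eq0 negb_or x0 andbT /weight_eval -/(ip mu' mu) ipm.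
  by rewrite oppr_eq0 mulf_neq0.
have -> : br (vsval (dual mu)) x = br e (br f x) + br f (br e x).
  by rewrite jac addrNK.
have [fx|fx] := eqVneq (br f x) 0; last first.
  have wfx := weight_vector_br h_even wf wx.
  have E : - mu + mu' = - (th *+ m) by rewrite mu'E addrA addNr sub0r.
  rewrite E in wfx; have w0 : - (th *+ m) != 0.
    rewrite oppr_eq0; have := @weight_mulIn th hth.1 m 0%N; rewrite mulr0n => H.
    by apply/eqP => /H hm; move: m2; rewrite hm.
  have := norm_le2 (conj w0 (is_weightI wfx fx)).
  rewrite !ipE thn opprK -!natrM ler_nat => hm _; move: hm m2.
  by case: (m) => [|[|l]] //; lia.
rewrite fx br0r add0r; have [ex|ex] := eqVneq (br e x) 0.
  by rewrite ex br0r eqxx.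
move=> _; have wex := weight_vector_br h_even we wx.
have nE2 : ip (mu + mu') (mu + mu') = - (2 * m * m)%:R.
  rewrite [LHS](_ : _ = ip mu mu + 2%:R * ip mu' mu + ip mu' mu'); last first.
    by rewrite !ipE (ip_sym mu mu'); ring.
  have -> : ip mu' mu' = 0.
    by rewrite {2}mu'E !ipE ipm {1}mu'E !ipE thn mE -[_%:~R]/(m%:R); ring.
  by rewrite mm ipm !natrM; ring.
have w0 : mu + mu' != 0.
  apply/eqP => E; move/eqP: nE2; rewrite E ip0l eq_sym oppr_eq0 pnatr_eq0.
  by move: m2; case: (m).
have := even_root_norm_gt0 (conj w0 (is_weightI wex ex)).
by rewrite nE2 oppr_gt0 ltrn0.
Qed.

(** A weight other than [- th] pairs with [th] to at least [-1], by extremality of [- mu]. Two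
    applications of [ad e] raise the pairing by [4], to at least [3], while a weight pairing to [2]
    or more is [th] and pairs to [2]. *)
Lemma long_root_ad_square th p mu e x : even_root th -> ip th th = 2%:R ->
  wv false th e -> wv p mu x -> mu != - th -> br (br x e) e = 0.
Proof.
move=> hth thn we wx muth; apply/eqP/negPn/negP => b0.
have x0 : x != 0 by apply: contraNneq b0 => ->; rewrite !br0l.
have wb : wv p (mu + th + th) (br (br x e) e).
  by have := weight_vector_br h_even (weight_vector_br h_even wx we) we; rewrite !addbF.
have wmu := is_weightI wx x0.
have [m mE _] := weight_pairing_int hth thn wmu.
have m1 : -1 <= m.
  rewrite leNgt; apply/negP => m_lt; case/eqP: muth.
  have mN : ip (- mu) th = (- m)%:~R by rewrite ipNl mE intrN.
  by rewrite -(long_root_extremal hth thn (is_weight_opp wmu) mN) ?opprK //; lia.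
have m4 : ip (mu + th + th) th = (m + 4)%:~R by rewrite !ipDl mE thn intrD; ring.
have E := long_root_extremal hth thn (is_weightI wb b0) m4 ltac:(lia).
move/eqP: m4; rewrite E thn -[2%:R]/(2%:~R) eqr_int => /eqP; lia.
Qed.

(** Some long root [th] has [(gam, th) = 1]. Then [gam - th] is a weight, [ad e] does not kill its
    vectors since their pairing with [th] is [-1], and root spaces are lines; a second application
    of [ad e] would reach the pairing [3]. *)
Lemma short_root_vector gam x : even_root gam -> ip gam gam != 2%:R -> wv false gam x ->
  exists th gam0 e y c,
  [/\ even_root th /\ ip th th = 2%:R, gam0 != 0, wv false th e, wv false gam0 y &
      x = c *: br e y /\ br e (br e y) = 0].
Proof.
move=> hg gn wx.
have reflect_long th a : even_root th -> ip th th = 2%:R -> even_root a ->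
    exists n : int, [/\ 2%:R * ip th a = ip a a * n%:~R,
      even_root (th - a *~ n) & ip (th - a *~ n) (th - a *~ n) = 2%:R].
  move=> hth thn ha; have [n nE wn] := even_root_reflect ha hth.2; exists n.
  have rr : ip (th - a *~ n) (th - a *~ n) = 2%:R.
    rewrite [LHS](_ : _ = ip th th - n%:~R * (2%:R * ip th a) + n%:~R * n%:~R * ip a a).
      by rewrite nE thn; ring.
    by rewrite !(ipDl, ipDr, ipNl, ipNr, ipMzl, ipMzr) (ip_sym a th); ring.
  split=> //; split=> //; apply: contraTneq isT => r0.
  by move/eqP: rr; rewrite r0 ip0l eq_sym pnatr_eq0.
have [th [hth thn gth]] : exists th, [/\ even_root th, ip th th = 2%:R & ip gam th != 0].
  have [th0 hth0 thn0] := long_exists.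
  (* The roots not orthogonal to some long root form an orthogonal class: if [a] pairs with a long
     [th] and [b] pairs with [a] but not with [th], then [b] pairs with the long root obtained by
     reflecting [th] in [a]. *)
  apply: (orthogonal_class_full (P := fun a => exists th,
      [/\ even_root th, ip th th = 2%:R & ip a th != 0]) _ hth0 hg); last first.
    by exists th0; split=> //; rewrite thn0 pnatr_eq0.
  move=> a b ha hb [th [hth thn ath]] nb; apply/eqP/negPn/negP => ab; apply: nb.
  have [bth|bth] := eqVneq (ip b th) 0; last by exists th.
  have [n [nE hr rr]] := reflect_long th a hth thn ha.
  exists (th - a *~ n); split=> //; rewrite !(ipDr, ipNr, ipMzr) bth sub0r oppr_eq0.
  rewrite mulf_neq0 // ?(ip_sym b a) // intr_eq0; apply: contraNneq ath => n0.
  move/eqP: nE; rewrite n0 mulr0 mulf_eq0 pnatr_eq0 ip_sym.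
  by case/orP => // /eqP ->.
have {th hth thn gth} [th [hth thn gth]] :
    exists th, [/\ even_root th, ip th th = 2%:R & ip gam th = 1].
  have [m mE _] := weight_pairing_int hth thn hg.2.
  have m_lt2 : m < 2.
    rewrite ltNge; apply/negP => m2; case/eqP: gn.
    by rewrite (long_root_extremal hth thn hg.2 mE m2).
  have m_gt : -2 < m.
    rewrite ltNge; apply/negP => m2; case/eqP: gn.
    have mN : ip (- gam) th = (- m)%:~R by rewrite ipNl mE intrN.
    have E := long_root_extremal hth thn (is_weight_opp hg.2) mN ltac:(lia).
    by rewrite -[gam]opprK E ipNl ipNr opprK.
  have m0 : m != 0 by apply: contraNneq gth => m0; rewrite mE m0.
  have [m1|m1] := eqVneq m 1; first by exists th; rewrite mE m1.
  exists (- th); split; [exact: even_root_opp| by rewrite ipNl ipNr opprK|].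
  by rewrite ipNr mE (_ : m = -1) ?mulrNz ?opprK //; lia.
have [m mE hm] := weight_pairing_int hth thn hg.2.
have m1 : m = 1 by move/eqP: mE; rewrite gth -[1]/(1%:~R) eqr_int eq_sym => /eqP.
have [y wy y0] := hm 1%N ltac:(lia); rewrite mulr1n in wy.
have [e [f pair]] := even_root_pair hth; have [we _ _] := pair.
have g0 : gam - th != 0.
  by rewrite subr_eq0; apply: contraNneq gn => ->; rewrite thn.
have wey : wv false gam (br e y).
  by have := weight_vector_br h_even we wy; rewrite [th + _]addrC subrK.
have ey0 : br e y != 0.
  apply/eqP => ey; have [n nE _] := highest_weight_string hth.1 pair wy y0 ey.
  move/eqP: nE; rewrite ipDl ipNl gth thn -subr_eq0 -mulrBr mulf_eq0 pnatr_eq0 /=.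
  rewrite subr_eq0 => /eqP E; have : (1 - 2 : F) = (-1)%:~R by ring.
  by rewrite E -[n%:R]/(n%:~R) => /eqP; rewrite eqr_int.
have [c xE] := even_root_line hg wey ey0 wx.
exists th, (gam - th), e, y, c; split=> //; split=> //.
apply/eqP/negPn/negP => eey.
have weey := weight_vector_br h_even we wey.
have E3 : ip (th + gam) th = 3%:~R by rewrite ipDl thn gth; ring.
have E := long_root_extremal hth thn (is_weightI weey eey) E3 isT.
by move/eqP: E3; rewrite E thn -[2%:R]/(2%:~R) eqr_int.
Qed.

(* [x] behaves like a highest root vector: the eigenvalues of its coroot [t] on
   [g] are at most [2], with equality only on the line of [x]. *)
Definition highest_triple x f (t : subvs_of h) :=
  exists th : weight,
  [/\ [/\ th != 0, wv false th x & th t = 2%:R], wv false (- th) f,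
      B x f = 1 /\ br x f = vsval t,
      forall p mu y, wv p mu y -> mu != - th -> br (br y x) x = 0 /\ B y x = 0
    & forall p y, wv p (- th) y -> exists c, y = c *: f].

Lemma long_root_triple th x : even_root th -> ip th th = 2%:R -> wv false th x ->
  x != 0 -> exists f t, highest_triple x f t.
Proof.
move=> hth thn wx x0; have [f wf xf] := form_dual wx x0.
have [_ hf] := wf; exists f, (dual th), th; split=> //; first by split; [case: hth|..].
- by rewrite (br_dual wx hf) xf scale1r.
- move=> p mu y wy muth; split; first exact: long_root_ad_square hth thn wx wy muth.
  by have [_ hy] := wy; have [_ hx] := wx; apply: form_weight hy hx _; rewrite addr_eq0.
move=> p y wy; have f0 : f != 0.
  by apply/eqP => f0; move: xf; rewrite f0 form_0r => /eqP; rewrite eq_sym oner_eq0.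
exact: even_root_line (even_root_opp hth) wf f0 wy.
Qed.

Lemma even_root_vector_cases gam x : even_root gam -> wv false gam x ->
  x = 0 \/ (exists f t, highest_triple x f t) \/
  exists e f t gam0 y c, [/\ highest_triple e f t, gam0 != 0, wv false gam0 y,
    x = c *: br e y & br e (br e y) = 0].
Proof.
move=> hg wx; have [->|x0] := eqVneq x 0; [by left|right].
have [gn|gn] := eqVneq (ip gam gam) 2%:R.
  by left; apply: long_root_triple hg gn wx x0.
right; have [th [gam0 [e [y [c [[hth thn] g0 we wy [xE eey]]]]]]] :=
  short_root_vector hg gn wx.
have e0 : e != 0 by apply: contraNneq x0 => e0; rewrite xE e0 br0l scaler0.
have [f [t efh]] := long_root_triple hth thn we e0.
by exists e, f, t, gam0, y, c.
Qed.

End InvariantForm.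

Lemma even_derived_even (F : numClosedFieldType) (g : lieSuperalgebra F) :
  (even_derived g <= lsa_par g false)%VS.
Proof.
apply/span_subvP => _ /allpairsP[[y z] [/= /vbasis_mem yU /vbasis_mem zU ->]].
exact: (lsa_br_par yU zU).
Qed.

Section KacMoodyForm.
Variables (F : numClosedFieldType) (g : lieSuperalgebra F).
Variables (h nm np : {vspace g}) (B : g -> g -> F).
Hypothesis km : kac_moody h.
Hypothesis triangular : triangular_decomposition h nm np.
Hypothesis connected : even_dynkin_connected h np.
Hypothesis B_norm : normalized_form h B.
Hypothesis B_linr : forall c x y z, B z (c *: x + y) = c * B z x + B z y.

Lemma even_root_vector_generated (gam : weight h) x :
  gam != 0 -> weight_vector false gam x ->
  x = 0 \/ (exists f t, @highest_triple F g h B x f t) \/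
  exists e f t (gam0 : weight h) y c, [/\ @highest_triple F g h B e f t, gam0 != 0,
    weight_vector false gam0 y, x = c *: lsa_br e y & lsa_br e (lsa_br e y) = 0].
Proof.
have [h_even h_abel] := kac_moody_cartan km.
have [wv_span wv_zero] := kac_moody_weights km.
have [B_inv B_long B_max] := B_norm.
have [g0_red _ _] := connected.
(* [normalized_form] speaks of roots of the derived even algebra; root vectors lie there because
   [[t, y] = nu(t) y]. *)
have root_derived (nu : weight h) : even_root nu -> root_in (even_derived g) nu.
  move=> [nu0 [y [ye hy] y0]]; split=> //; exists y; split=> //.
  have [t] := weight_neqP nu0; rewrite zero_lfunE => t0.
  have -> : y = (nu t : F)^-1 *: lsa_br (vsval t) y.
    by rewrite hy scalerA mulVf ?scale1r.
  by rewrite memvZ //; apply: commutator_spaceP; rewrite ?vsval_even. 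
have derived_even := even_derived_even g.
move=> g0 wx; have [x0|x0] := eqVneq x 0; first by left.
have hg : even_root gam by split=> //; exists x.
apply: (even_root_vector_cases (h_even := h_even) (h_abel := h_abel)
  (wv_span := wv_span) (wv_zero := wv_zero) (B_inv := B_inv) (B_linr := B_linr)
  g0_red triangular connected _ _ hg wx).
  move=> nu hnu; apply: B_max (root_derived _ hnu) _.
  exact/(weight_normP h_even h_abel wv_span wv_zero B_inv B_linr).
have [th [[th0 [y [y0 yd hy]]] thn]] := B_long.
have {}thn := (weight_normP h_even h_abel wv_span wv_zero B_inv B_linr _ _).1 thn.
exists th => //; split=> //; exists y => //; split=> //.
exact: subvP derived_even _ yd.
Qed.

End KacMoodyForm.

(** * Vertex algebras and affine modules *)

Section Binomials.
Variable F : numClosedFieldType.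

Lemma gen_binomial0 m : gen_binomial F m 0 = 1.
Proof. by rewrite /gen_binomial big_ord0 fact0 divr1. Qed.

Lemma gen_binomial1 m : gen_binomial F m 1 = m%:~R.
Proof. by rewrite /gen_binomial big_ord_recl big_ord0 mulr1 subr0 divr1. Qed.

Lemma gen_binomial_0n j : gen_binomial F 0 j = (j == 0%N)%:R.
Proof.
case: j => [|j]; first exact: gen_binomial0.
by rewrite /gen_binomial big_ord_recl /= mulr0z subrr !mul0r.
Qed.

End Binomials.

Section VertexAlgebraModule.
Variables (F : numClosedFieldType) (V : vertexSuperalgebra F).
Variables (M : lmodType F) (Mpar : bool -> M -> Prop) (Y : V -> int -> M -> M).
Hypothesis actionY : va_action (@va_par F V) (@va_prod F V) Y (va_vac V) Mpar.

Lemma mode_linl n c a b v : Y (c *: a + b) n v = c *: Y a n v + Y b n v.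
Proof. by case: actionY => -[]. Qed.

Lemma mode_linr n c a v w : Y a n (c *: v + w) = c *: Y a n v + Y a n w.
Proof. by case: actionY => -[]. Qed.

Lemma mode0l n v : Y 0 n v = 0.
Proof.
have /eqP := mode_linl n 1 0 0 v; rewrite !scale1r addr0.
by rewrite -subr_eq subrr eq_sym => /eqP.
Qed.

Lemma mode0r n a : Y a n 0 = 0.
Proof.
have /eqP := mode_linr n 1 a 0 0; rewrite !scale1r addr0.
by rewrite -subr_eq subrr eq_sym => /eqP.
Qed.

Lemma modeZl n c a v : Y (c *: a) n v = c *: Y a n v.
Proof. by have := mode_linl n c a 0 v; rewrite mode0l !addr0. Qed.

Lemma mode_vac n v : Y (va_vac V) n v = if n == -1 then v else 0.
Proof. by case: actionY. Qed.

(** The Borcherds identity at [m = 0], where all binomials on the left but the first vanish. *)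
Lemma mode_iterate p q a b (n l : int) v : va_par p a -> va_par q b ->
  exists N0 : nat, forall N : nat, (N0 <= N)%N ->
  Y (va_prod a n b) l v = \sum_(j < N) ((-1) ^+ j * gen_binomial F n j) *:
    (Y a (n - j%:Z) (Y b (l + j%:Z) v)
     - ((-1) ^ n * (-1) ^+ (p && q)) *: Y b (n + l - j%:Z) (Y a j%:Z v)).
Proof.
move=> ap bq; case: actionY => _ _ _ _ /(_ p q a b v 0 n l ap bq)[N0 H].
(* The truncation has to be nonempty for the term [j = 0] on the left to be present. *)
exists N0.+1 => N N0N; have := H N (ltnW N0N).
under [X in _ = X]eq_bigr do rewrite !add0r.
move=> <-; case: N N0N {H} => // N _; rewrite big_ord_recl gen_binomial0 scale1r.
rewrite big1 ?addr0 ?add0r ?subr0 // => j _.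
by rewrite gen_binomial_0n scale0r.
Qed.

Lemma mode_commutator p q a b (m l : int) v : va_par p a -> va_par q b ->
  (forall n : int, 2 <= n -> va_prod a n b = 0) ->
  Y a m (Y b l v) - (-1) ^+ (p && q) *: Y b l (Y a m v)
  = Y (va_prod a 0 b) (m + l) v + m%:~R *: Y (va_prod a 1 b) (m + l - 1) v.
Proof.
move=> ap bq ab; case: actionY => _ _ _ _ /(_ p q a b v m 0 l ap bq)[N0 H].
have := H N0.+2 ltac:(lia).
have -> : \sum_(j < N0.+2) gen_binomial F m j *:
      Y (va_prod a (0 + j%:Z) b) (m + l - j%:Z) v
    = Y (va_prod a 0 b) (m + l) v + m%:~R *: Y (va_prod a 1 b) (m + l - 1) v.
  rewrite 2!big_ord_recl big1 => [|j _]; last first.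
    by rewrite ab ?mode0l ?scaler0 // /bump /=; lia.
  rewrite (_ : nat_of_ord (lift ord0 ord0) = 1%N) // gen_binomial0 gen_binomial1.
  by rewrite !addr0 !add0r scale1r.
move=> ->; rewrite big_ord_recl big1 => [|j _].
  by rewrite gen_binomial0 expr0 mul1r expr0z mul1r !addr0 !add0r scale1r.
by rewrite gen_binomial_0n mulr0 scale0r.
Qed.

End VertexAlgebraModule.

Section VertexAlgebra.
Variables (F : numClosedFieldType) (V : vertexSuperalgebra F).
Let actV := va_prod_action V.

(** Skew-symmetry, from the Borcherds identity on the vacuum with [m = -1] and [l = 0]: by creation
    only one term with [j = 0] survives on the right. The operators [u |-> u_(-1-j) vac] are the
    divided powers of translation. *)
Lemma mode_skew p q (a b : V) (n : int) : va_par p a -> va_par q b ->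
  exists N (c : nat -> F), va_prod b n a
    = \sum_(j < N) c j *: va_prod (va_prod a (n + j%:Z) b) (-1 - j%:Z) (va_vac V).
Proof.
move=> ap bq; case: actV => _ _ _ _ /(_ p q a b (va_vac V) (-1) n 0 ap bq)[N0 H].
set s := (-1) ^ n * (-1) ^+ (p && q) : F.
have s0 : s != 0 by rewrite mulf_neq0 // ?expfz_neq0 ?expf_neq0 // oppr_eq0 oner_eq0.
exists N0.+1, (fun j => - s^-1 * gen_binomial F (-1) j).
under eq_bigr do rewrite -scalerA.
rewrite -scaler_sumr; have := H N0.+1 ltac:(lia).
under eq_bigr do rewrite addr0.
move=> ->; rewrite big_ord_recl big1 => [|j _].
  rewrite gen_binomial0 expr0 mul1r scale1r /= !addr0.
  have [-> _] := va_creation a; have [_ ->] := va_creation b; rewrite ?lexx //.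
  by rewrite (mode0r actV) sub0r scaleNr scalerN opprK scalerA mulVf ?scale1r.
have [_ ->] := va_creation b; last by lia.
have [_ ->] := va_creation a; last by rewrite lift0; lia.
by rewrite !(mode0r actV) scaler0 subrr scaler0.
Qed.

End VertexAlgebra.

Section Currents.
Variables (F : numClosedFieldType) (g : lieSuperalgebra F) (B : g -> g -> F) (k : F).
Variables (V : vertexSuperalgebra F) (iota : {linear g -> V}).
Hypothesis hiota : currents B k iota.
Variables (M : lmodType F) (Mpar : bool -> M -> Prop) (Y : V -> int -> M -> M).
Hypothesis Mgr : grading Mpar.
Hypothesis actionY : va_action (@va_par F V) (@va_prod F V) Y (va_vac V) Mpar.

Lemma currents_affine_module : affine_module B k Mpar (fun a n v => Y (iota a) n v).
Proof.
have [iota_par iota_deg iota_prod] := hiota.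
split=> //.
- by move=> m c a b v; rewrite linearP (mode_linl actionY).
- by move=> m c a v w; rewrite (mode_linr actionY).
- by move=> i j a m v /iota_par ai; case: actionY => _ H _ _ _; apply: H.
move=> i j a b m n v /iota_par ai /iota_par bj.
have [e0 e1 e2] := iota_prod a b.
rewrite (mode_commutator actionY _ _ _ ai bj) // e0 e1; congr (_ + _).
rewrite (modeZl actionY) (mode_vac actionY) scalerA.
have -> : (m + n - 1 == -1) = (m + n == 0) by lia.
by case: eqP => _; rewrite ?scaler0 ?scale0r // -mulrA [k * _]mulrC.
Qed.

End Currents.

Section SubspaceType.
Variables (F : fieldType) (M : lmodType F) (P : M -> Prop).

(** The universal property of [universal_affine_va] quantifies over types, so a submodule given by a
    predicate has to be made into an [lmodType] before it can be a target. *)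
Definition subspace_pred of subspace P : {pred M} := fun x => `[< P x >].

Variable hP : subspace P.

Lemma subspace_pred_closed : submod_closed (subspace_pred hP).
Proof.
split=> [|c u v]; first by apply/asboolP; apply: hP.1.
by move=> /asboolP Pu /asboolP Pv; apply/asboolP; apply: hP.2.
Qed.

HB.instance Definition _ :=
  GRing.isSubmodClosed.Build F M (subspace_pred hP) subspace_pred_closed.

Record subspace_type := SubspaceElt {
  subspace_val :> M; _ : subspace_val \in subspace_pred hP }.

HB.instance Definition _ := [isSub for subspace_val].
HB.instance Definition _ := [Choice of subspace_type by <:].
HB.instance Definition _ := [SubChoice_isSubLmodule of subspace_type by <:].

Lemma subspace_valP (x : subspace_type) : P (val x).
Proof. by have /asboolP := valP x. Qed.

Definition subspace_elt x (Px : P x) : subspace_type :=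
  SubspaceElt (introT (asboolP (P x)) Px).

End SubspaceType.

Section AffineModule.
Variables (F : numClosedFieldType) (g : lieSuperalgebra F) (B : g -> g -> F) (k : F).
Variables (M : lmodType F) (par : bool -> M -> Prop) (act : g -> int -> M -> M).
Hypothesis hM : affine_module B k par act.
Local Notation br := (@lsa_br F g).

Lemma act_linl m c a b v : act (c *: a + b) m v = c *: act a m v + act b m v.
Proof. by case: hM. Qed.

Lemma act_linr m c a v w : act a m (c *: v + w) = c *: act a m v + act a m w.
Proof. by case: hM. Qed.

Lemma act0l n v : act 0 n v = 0.
Proof.
have /eqP := act_linl n 1 0 0 v; rewrite !scale1r addr0.
by rewrite -subr_eq subrr eq_sym => /eqP.
Qed.

Lemma act0r n a : act a n 0 = 0.
Proof.
have /eqP := act_linr n 1 a 0 0; rewrite !scale1r addr0.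
by rewrite -subr_eq subrr eq_sym => /eqP.
Qed.

Lemma actZl n c a v : act (c *: a) n v = c *: act a n v.
Proof. by have := act_linl n c a 0 v; rewrite act0l !addr0. Qed.

Lemma actZr n c a v : act a n (c *: v) = c *: act a n v.
Proof. by have := act_linr n c a v 0; rewrite act0r !addr0. Qed.

Lemma actDl n a b v : act (a + b) n v = act a n v + act b n v.
Proof. by have := act_linl n 1 a b v; rewrite !scale1r. Qed.

Lemma actDr n a v w : act a n (v + w) = act a n v + act a n w.
Proof. by have := act_linr n 1 a v w; rewrite !scale1r. Qed.

Lemma actNl n a v : act (- a) n v = - act a n v.
Proof. by rewrite -[- a]scaleN1r actZl scaleN1r. Qed.

Lemma subspace_act (P : M -> Prop) a n : subspace P -> subspace (fun u => P (act a n u)).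
Proof. by move=> hP; apply: subspace_ker => // c u v; apply: act_linr. Qed.

Lemma subspace_actl (P : M -> Prop) n u : subspace P -> subspace (fun a => P (act a n u)).
Proof. by move=> hP; apply: subspace_ker => // c a b; apply: act_linl. Qed.

Lemma act_par i j a m v : a \in lsa_par g i -> par j v -> par (i (+) j) (act a m v).
Proof. by case: hM => _ _ _ H _; apply: H. Qed.

Lemma par_subspace i : subspace (par i).
Proof. by case: hM => -[]. Qed.

Lemma act_comm i j a b m n v : a \in lsa_par g i -> b \in lsa_par g j ->
  act a m (act b n v) = (-1) ^+ (i && j) *: act b n (act a m v)
    + act (br a b) (m + n) v + (if m + n == 0 then m%:~R * B a b * k else 0) *: v.
Proof.
move=> ai bj; case: hM => _ _ _ _ /(_ i j a b m n v ai bj) E.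
by rewrite -addrA -E addrC subrK.
Qed.

Section Words.
Variables (low : g -> int -> Prop) (W : M -> Prop).

(** Stands for the action on [W] of a part of the enveloping algebra, selected by [low]. Letters are
    homogeneous so that supercommutators apply to them. *)
Inductive mode_word : M -> Prop :=
| mode_word_base w : W w -> mode_word w
| mode_word_step p a n u : a \in lsa_par g p -> low a n -> mode_word u ->
    mode_word (act a n u).

Lemma mode_word_par : (forall w, W w -> exists p, par p w) ->
  forall u, mode_word u -> exists p, par p u.
Proof.
move=> Wp u; elim=> [w /Wp//|p a n {}u ap _ _ [q uq]].
by exists (p (+) q); apply: act_par.
Qed.

Lemma mode_word_low p a n u : a \in lsa_par g p -> low a n ->
  lspan mode_word u -> lspan mode_word (act a n u).
Proof.
move=> ap la; move: u; apply: lspan_least; first exact/subspace_act/lspan_subspace.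
by move=> u wu; apply: lspan_gen; apply: (mode_word_step ap la wu).
Qed.

(* Commuting a mode through a word only produces shorter words, so stability
   has to be checked on the generators alone. *)
Lemma mode_word_stable :
  (forall w a n, W w -> lspan mode_word (act a n w)) ->
  act_stable act (lspan mode_word).
Proof.
move=> HW; split; first exact: lspan_subspace.
have hS := lspan_subspace mode_word.
suff main u : mode_word u -> forall a m, lspan mode_word (act a m u).
  move=> a m; apply: lspan_least; first exact: subspace_act.
  by move=> u wu; apply: main.
elim=> [w Ww a m|q b n {}u bq lb wu IH a m]; first exact: HW.
move: a; apply: par_ind => [|p a ap]; first exact: subspace_actl.
rewrite (act_comm _ _ _ ap bq); apply: (subspaceD hS); first apply: (subspaceD hS).
- by apply: (subspaceZ hS); apply: (mode_word_low bq lb); apply: IH.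
- exact: IH.
- by apply: (subspaceZ hS); apply: lspan_gen.
Qed.

End Words.

Lemma mode_word_sub low W (P : M -> Prop) : act_stable act P ->
  (forall w, W w -> P w) -> forall u, lspan (mode_word low W) u -> P u.
Proof.
move=> [hP Pact] WP; apply: (lspan_least hP) => u.
by elim=> [w /WP//|p a n {}u _ _ _]; apply: Pact.
Qed.

Definition all_words W := mode_word (fun _ _ => True) W.

Lemma all_words_stable W : act_stable act (lspan (all_words W)).
Proof.
have hS := lspan_subspace (all_words W).
apply: mode_word_stable => w a n Ww; move: a; apply: par_ind => [|p a ap].
  exact: subspace_actl.
by apply: lspan_gen; apply: mode_word_step (ap) _ _ => //; apply: mode_word_base.
Qed.

End AffineModule.

Section UniversalGeneration.
Variables (F : numClosedFieldType) (g : lieSuperalgebra F) (B : g -> g -> F) (k : F).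
Variables (U : vertexSuperalgebra F) (iota : {linear g -> U}).
Hypothesis universal : universal_affine_va B k iota.
Let act a n (u : U) : U := va_prod (iota a) n u.
Let P := lspan (all_words act (fun w => w = va_vac U)).
Let hP : subspace P := lspan_subspace _.
Local Notation N := (subspace_type hP).

Lemma adjoint_affine_module : affine_module B k (@va_par F U) act.
Proof.
exact: (currents_affine_module universal.1 (va_par_grading U) (va_prod_action U)).
Qed.

Let hM := adjoint_affine_module.

Lemma vacuum_words_stable : act_stable act P.
Proof. exact: all_words_stable hM _. Qed.

Lemma vacuum_words_homogeneous : homogeneous_subspace (@va_par F U) P.
Proof.
apply: lspan_homogeneous => [p|u]; first exact: par_subspace hM p.
apply: (mode_word_par hM) => w ->; exists false; exact: va_vac_par.
Qed.

Definition vacuum_act a n (x : N) : N :=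
  subspace_elt hP (vacuum_words_stable.2 a n _ (subspace_valP x)).

Lemma vacuum_affine_module :
  affine_module B k (fun p (x : N) => va_par p (val x)) vacuum_act.
Proof.
have [[par_sub par_hom par_ind] a1 a2 a3 a4] := hM.
split.
- split=> [p||s w us ws w0 i si].
  + split=> [|c u v up vp]; first by rewrite linear0; apply: (par_sub p).1.
    by rewrite linearP; apply: (par_sub p).2.
  + split=> [//|v _].
    have [_ /(_ _ (subspace_valP v))[s [w [ws us vE]]]] := vacuum_words_homogeneous.
    have [w' w'E] : exists w' : bool -> N, forall i, i \in s -> val (w' i) = w i.
      exists (fun i => if pselect (P (w i)) is left Pw then subspace_elt hP Pw else 0).
      by move=> i /ws[_ Pw]; case: pselect.
    exists s, w'; split=> // [i si|]; first by rewrite (w'E i si); have [] := ws i si.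
    apply: val_inj; rewrite linear_sum [LHS]vE !big_seq.
    by apply: eq_bigr => i si; rewrite /= w'E.
  apply: val_inj; rewrite linear0.
  apply: (par_ind s (fun i => val (w i)) us) si => [j /ws//|].
  by rewrite -linear_sum w0 linear0.
- by move=> m c a b v; apply: val_inj; rewrite linearP; apply: a1.
- move=> m c a v w; apply: val_inj.
  by rewrite [RHS]linearP -[LHS]/(act a m (val (c *: v + w))) linearP; apply: a2.
- by move=> i j a m v ai vj; apply: a3.
- move=> i j a b m n v ai bj; apply: val_inj.
  apply: etrans (etrans (a4 i j a b m n (val v) ai bj) _).
    by rewrite linearB linearZ.
  by rewrite linearD linearZ.
Qed.

(** The submodule generated by the vacuum is itself a target of the universal property. Composed
    with the inclusion, the resulting map agrees with the identity by uniqueness. *)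
Lemma universal_generated u : P u.
Proof.
pose one : N := subspace_elt hP (lspan_gen (mode_word_base act (fun _ _ => True)
  (erefl : (fun w => w = va_vac U) (va_vac U)))).
have [||phi [phi1 phia] _] := universal.2 N _ vacuum_act one vacuum_affine_module.
- exact: va_vac_par.
- move=> a n n0; apply: val_inj; rewrite linear0.
  by have [_ H] := va_creation (iota a); apply: H.
have [||psi _ uniq] := universal.2 U (@va_par F U) act (va_vac U) hM.
- exact: va_vac_par.
- by move=> a n n0; have [_ H] := va_creation (iota a); apply: H.
have e1 := uniq idfun; have e2 := uniq (\val \o phi).
rewrite -[u]/(idfun u) e1 // -e2 /=; first exact: subspace_valP.
by split=> [|a n v]; rewrite /= ?phi1 ?phia.
Qed.

End UniversalGeneration.

(** * The ideal generated by a singular vector *)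

Section SimpleVertexAlgebra.
Variables (F : numClosedFieldType) (g : lieSuperalgebra F) (B : g -> g -> F) (k : F).
Variables (V : vertexSuperalgebra F) (iota : {linear g -> V}).
Hypothesis hiota : currents B k iota.
Let act a n (u : V) : V := va_prod (iota a) n u.
Hypothesis generated : forall u, lspan (all_words act (fun w => w = va_vac V)) u.
Hypothesis simple : va_simple V.
Let actV := va_prod_action V.
Let hM : affine_module B k (@va_par F V) act :=
  currents_affine_module hiota (va_par_grading V) actV.

Lemma prod_par p q a n b : va_par p a -> va_par q b -> va_par (p (+) q) (@va_prod F V a n b).
Proof. by case: actV => _ H _ _ _; apply: H. Qed.

Lemma va_par_subspace p : subspace (@va_par F V p).
Proof. by case: (va_par_grading V). Qed.

Lemma va_deg_subspace i : subspace (@va_deg F V i).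
Proof. by case: (va_deg_grading V). Qed.

Lemma vac_positive0 a (n : int) : 0 <= n -> va_prod a n (va_vac V) = 0.
Proof. by have [_] := va_creation a; apply. Qed.

Lemma subspace_prodr (J : V -> Prop) a n : subspace J -> subspace (fun b => J (va_prod a n b)).
Proof. by move=> hJ; apply: subspace_ker => // c u v; apply: mode_linr actV _ _ _ _ _. Qed.

Lemma subspace_prodl (J : V -> Prop) b n : subspace J -> subspace (fun a => J (va_prod a n b)).
Proof. by move=> hJ; apply: subspace_ker => // c u v; apply: mode_linl actV _ _ _ _ _. Qed.

Lemma act_deg a n d u : va_deg d u -> va_deg (d - n) (act a n u).
Proof.
move=> du; have [_ id _] := hiota.
by have := va_prod_deg n (id a) du; congr va_deg; lia.
Qed.

Variables (w : V) (pw : bool) (dw : int).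
Hypothesis w_par : va_par pw w.
Hypothesis w_deg : va_deg dw w.
Hypothesis dw_gt0 : 0 < dw.
Hypothesis w_singular : forall a (n : int), 1 <= n -> act a n w = 0.

Let word := all_words act (fun u => u = w).
Let Vpos := lspan (fun u : V => exists2 d, 0 < d & va_deg d u).

(** As modes [n >= 1] kill [w], the words in modes [n <= 0] already span the submodule, and these
    modes do not lower the degree [dw > 0]. *)
Lemma singular_words_positive u : word u -> Vpos u.
Proof.
move=> wu; have {wu} : lspan (mode_word act (fun _ n => n <= 0) (fun u => u = w)) u.
  apply: (mode_word_sub _ _ (lspan_gen wu)).
    apply: (mode_word_stable hM) => _ a n ->.
    have [n0|n0] := leP n 0; last by rewrite w_singular //; apply: lspan0.
    have hS := lspan_subspace (mode_word act (fun _ n => n <= 0) (fun u => u = w)).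
    move: a; apply: par_ind => [|p a ap]; first exact: (subspace_actl hM).
    by apply: lspan_gen; apply: (mode_word_step ap) => //; apply: mode_word_base.
  by move=> _ ->; apply: lspan_gen; apply: mode_word_base.
apply: lspan_sub => {}u wu; apply: lspan_gen.
elim: wu => [_ ->|p a n {}u _ n0 _ [d d0 du]]; first by exists dw.
by exists (d - n); [lia|apply: act_deg].
Qed.

Lemma singular_words_graded u : word u ->
  (exists p, va_par p u) /\ (exists d, va_deg d u).
Proof.
elim=> [_ ->|p a n {}u ap _ _ [[q uq] [d ud]]]; first by split; [exists pw|exists dw].
split; first by exists (p (+) q); apply: (act_par hM).
by exists (d - n); apply: act_deg.
Qed.

(** Divided translation powers of the submodule generated by [w]. The translates are included
    because [mode_skew], which gives closure under products on the other side, produces them. *)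
Let S v := exists (u : V) (j : nat), word u /\ v = va_prod u (-1 - j%:Z) (va_vac V).
Let J := lspan S.
Let hJ : subspace J := lspan_subspace S.

Lemma singular_ideal_mode u (j : int) : word u -> J (va_prod u j (va_vac V)).
Proof.
move=> wu; have [j0|j0] := leP 0 j; first by rewrite vac_positive0 //; apply: hJ.1.
apply: lspan_gen; exists u, (absz (-1 - j)%R); split=> //.
by congr va_prod; lia.
Qed.

Lemma singular_ideal_act : act_stable act J.
Proof.
split=> // a n; move: a.
apply: (par_ind (P := fun a => forall v, J v -> J (act a n v))) => [|p a ap].
  by apply: subspace_forall => v; apply: subspace_imp; apply: (subspace_actl hM).
apply: lspan_least => [|_ [u [j [wu ->]]]]; first exact: (subspace_act hM).
have [[q uq] _] := singular_words_graded wu.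
have [iota_par _ _] := hiota.
(* In the expansion of [(a_n u)_(-1-j) vac] the half with [a] acting on the vacuum vanishes; the
   leading term is the wanted one, and the others are modes of [a] on [u_(-1-j') vac] with [j' < j],
   or zero. *)
elim/ltn_ind: j n => j IH n.
have [N H] := mode_iterate actV n (-1 - j%:Z) (va_vac V) (iota_par _ _ ap) uq.
have := H N.+1 (leqnSn _); rewrite big_ord_recl.
set R := \sum_(i < N) _.
rewrite expr0 gen_binomial0 mulr1 scale1r (vac_positive0 (iota a)) //.
rewrite (mode0r actV) scaler0 subr0.
have <- : act a n (va_prod u (-1 - j%:Z) (va_vac V)) =
    va_prod (iota a) (n - (@ord0 N)%:Z) (va_prod u (-1 - j%:Z + (@ord0 N)%:Z) (va_vac V)).
  by rewrite /= subr0 addr0.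
move=> /eqP; rewrite -subr_eq => /eqP <-; apply: (subspaceB hJ).
  by apply: singular_ideal_mode; apply: (mode_word_step ap).
apply: (subspace_sum hJ) => i _; apply: (subspaceZ hJ).
rewrite lift0 (vac_positive0 (iota a)) // (mode0r actV) scaler0 subr0.
have [ij|ij] := leqP i.+1 j; last first.
  by rewrite vac_positive0 ?(mode0r actV); [apply: hJ.1|lia].
have -> : -1 - j%:Z + i.+1%:Z = -1 - (j - i.+1)%N%:Z by lia.
by apply: IH; lia.
Qed.

Lemma singular_ideal_translate i v : J v -> J (va_prod v (-1 - i%:Z) (va_vac V)).
Proof.
move: v; apply: lspan_least => [|_ [u [j [wu ->]]]]; first exact: subspace_prodl.
have [[q uq] _] := singular_words_graded wu.
have [N H] := mode_iterate actV (-1 - j%:Z) (-1 - i%:Z) (va_vac V) uq (va_vac_par V).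
rewrite (H N) //; apply: (subspace_sum hJ) => l _; apply: (subspaceZ hJ).
rewrite (vac_positive0 u) // (mode0r actV) scaler0 subr0 (mode_vac actV).
case: eqP => _; first exact: singular_ideal_mode.
by rewrite (mode0r actV); apply: hJ.1.
Qed.

Lemma singular_ideal_left x n v : J v -> J (va_prod x n v).
Proof.
move=> Jv; move: (generated x); move: x.
apply: lspan_least => [|x wx]; first exact: subspace_prodl.
elim: wx n v Jv => [_ ->|p a m {}x ap _ wx IH] n v Jv.
  by rewrite (mode_vac actV); case: eqP => // _; apply: hJ.1.
have [q xq] : exists q, va_par q x.
  by apply: (mode_word_par hM) wx => _ ->; exists false; apply: va_vac_par.
have [iota_par _ _] := hiota.
have [N H] := mode_iterate actV m n v (iota_par _ _ ap) xq.
rewrite /act (H N) //; apply: (subspace_sum hJ) => j _; apply: (subspaceZ hJ).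
apply: (subspaceB hJ); first exact/singular_ideal_act.2/IH.
by apply: (subspaceZ hJ); apply: IH; apply: singular_ideal_act.2.
Qed.

Lemma singular_ideal_right x n v : J v -> J (va_prod v n x).
Proof.
move: v; apply: lspan_least => [|v Sv]; first exact: subspace_prodl.
have [q vq] : exists q, va_par q v.
  have [u [j [/singular_words_graded[[q uq] _] ->]]] := Sv.
  by exists (q (+) false); apply: prod_par => //; apply: va_vac_par.
move: (generated x); move: x; apply: lspan_least => [|x wx]; first exact: subspace_prodr.
have [p xp] : exists p, va_par p x.
  by apply: (mode_word_par hM) wx => _ ->; exists false; apply: va_vac_par.
have [N [c ->]] := mode_skew n xp vq.
apply: (subspace_sum hJ) => j _; apply: (subspaceZ hJ).
by apply/singular_ideal_translate/singular_ideal_left/lspan_gen.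
Qed.

(** [J] is an ideal containing [w]. It lies in the sum of the positive degrees and so misses the
    vacuum, of degree zero; simplicity leaves only [J = 0]. *)
Lemma singular_eq0 : w = 0.
Proof.
have Jw : J w.
  rewrite -(proj1 (va_creation w)); apply: singular_ideal_mode.
  exact: mode_word_base.
have ideal : va_ideal J.
  split; first 2 last.
  - by move=> a n b Jb; split; [apply: singular_ideal_left|apply: singular_ideal_right].
  - apply: lspan_homogeneous => [p|_ [u [j [/singular_words_graded[[p up] _] ->]]]].
      exact: va_par_subspace.
    by exists (p (+) false); apply: prod_par => //; apply: va_vac_par.
  - apply: lspan_homogeneous => [i|_ [u [j [/singular_words_graded[_ [d ud]] ->]]]].
      exact: va_deg_subspace.
    by eexists; apply: va_prod_deg ud (va_vac_deg V).
have [vac0] := simple; move=> /(_ J ideal)[/(_ w Jw)//|/(_ (va_vac V)) Jvac].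
case/eqP: vac0; apply: (grading_disjoint va_deg_subspace (va_deg_grading V) (va_vac_deg V)).
suff : Vpos (va_vac V).
  by apply: lspan_sub => u [d d0 du]; apply: lspan_gen; exists d => //; rewrite gt_eqF.
move: Jvac; apply: (lspan_least (lspan_subspace _)).
move=> _ [u [j [/singular_words_positive Vu ->]]].
move: u Vu; apply: lspan_least => [|v [d d0 dv]]; first exact/subspace_prodl/lspan_subspace.
apply: lspan_gen; exists (d + 0 - (-1 - j%:Z) - 1); first by lia.
exact: (va_prod_deg _ dv (va_vac_deg V)).
Qed.

End SimpleVertexAlgebra.

(** * Powers of root vectors *)

Section LocalNilpotency.
Variables (F : numFieldType) (M : lmodType F).

Definition nilpotent_at (D : M -> M) (v : M) := exists N, iter N D v = 0.

Section OneOperator.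
Variable D : M -> M.
Hypothesis D_lin : forall c u v, D (c *: u + v) = c *: D u + D v.

Lemma iter_lin N c u v : iter N D (c *: u + v) = c *: iter N D u + iter N D v.
Proof. by elim: N => //= N ->. Qed.

Lemma lin_zero : D 0 = 0.
Proof.
have /eqP := D_lin 1 0 0; rewrite !scale1r addr0.
by rewrite -subr_eq subrr eq_sym => /eqP.
Qed.

Lemma iter_zero N : iter N D 0 = 0.
Proof. by elim: N => //= N ->; apply: lin_zero. Qed.

Lemma iter_nilpotent_le N N' v : (N <= N')%N -> iter N D v = 0 -> iter N' D v = 0.
Proof. by move=> NN' Nv; rewrite -(subnK NN') iterD Nv iter_zero. Qed.

Lemma nilpotent_at_subspace : subspace (nilpotent_at D).
Proof.
split=> [|c u v [N Nu] [N' Nv]]; first by exists 0%N.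
exists (maxn N N'); rewrite iter_lin (iter_nilpotent_le (leq_maxl N N') Nu).
by rewrite (iter_nilpotent_le (leq_maxr N N') Nv) scaler0 addr0.
Qed.

End OneOperator.

Variables (X Z W : M -> M).
Hypothesis X_lin : forall c u v, X (c *: u + v) = c *: X u + X v.
Hypothesis Z_lin : forall c u v, Z (c *: u + v) = c *: Z u + Z v.
Hypothesis W_lin : forall c u v, W (c *: u + v) = c *: W u + W v.
Hypothesis XZ : forall u, X (Z u) = Z (X u) + W u.
Hypothesis XW : forall u, X (W u) = W (X u).

(* The sum of all words with [j] letters [W] and [N - j] letters [Z]; the
   derivation [ad X] maps it to [j + 1] times the next one. *)
Fixpoint mixed_words N j u : M :=
  if N is N'.+1 then
    Z (mixed_words N' j u) + (if j is j'.+1 then W (mixed_words N' j' u) else 0)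
  else if j is 0%N then u else 0.

Let addX u v : X (u + v) = X u + X v.
Proof. by have := X_lin 1 u v; rewrite !scale1r. Qed.
Let addZ u v : Z (u + v) = Z u + Z v.
Proof. by have := Z_lin 1 u v; rewrite !scale1r. Qed.
Let addW u v : W (u + v) = W u + W v.
Proof. by have := W_lin 1 u v; rewrite !scale1r. Qed.
Let scaleZ c u : Z (c *: u) = c *: Z u.
Proof. by have := Z_lin c u 0; rewrite (lin_zero Z_lin) !addr0. Qed.
Let scaleW c u : W (c *: u) = c *: W u.
Proof. by have := W_lin c u 0; rewrite (lin_zero W_lin) !addr0. Qed.

Lemma mixed_words_ad N j u :
  X (mixed_words N j u) = mixed_words N j (X u) + j.+1%:R *: mixed_words N j.+1 u.
Proof.
elim: N j => [|N IH] [|j] /=; rewrite ?scaler0 ?addr0 ?(lin_zero X_lin) //.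
  by rewrite XZ IH !scale1r addZ -addrA; congr (_ + _).
rewrite addX XZ XW !IH addZ addW scaleZ scaleW scalerDr.
set a := W (mixed_words N j.+1 u).
have -> : j.+2%:R *: a = a + j.+1%:R *: a by rewrite mulrS scalerDl scale1r.
rewrite -!addrA; congr (_ + _); rewrite [RHS]addrCA; congr (_ + _).
exact: addrCA.
Qed.

Lemma mixed_words_gt N j u : (N < j)%N -> mixed_words N j u = 0.
Proof.
elim: N j => [|N IH] [|j] //= Nj.
by rewrite !IH ?(lin_zero Z_lin) ?(lin_zero W_lin) ?addr0 // ltnW.
Qed.

Lemma mixed_words_diag N u : mixed_words N N u = iter N W u.
Proof.
by elim: N => //= N ->; rewrite mixed_words_gt // (lin_zero Z_lin) add0r.
Qed.

(** A single [N] with [Z ^ N X ^ i v = 0] works for all [i], since [X] is nilpotent at [v]. Applying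
    the derivation [ad X] repeatedly to [Z ^ N] and dividing by [j + 1] at each stage, all mixed
    words of length [N] kill all [X ^ i v]; the last one is [W ^ N]. *)
Lemma commutator_nilpotent v : nilpotent_at X v ->
  (forall i, nilpotent_at Z (iter i X v)) -> nilpotent_at W v.
Proof.
move=> [K Kv] Zv.
have [N NZ] : exists N, forall i, iter N Z (iter i X v) = 0.
  have [N NZ] : exists N, forall i, (i < K)%N -> iter N Z (iter i X v) = 0.
    elim: K {Kv} => [|K [N NZ]]; first by exists 0%N.
    have [N' N'Z] := Zv K; exists (maxn N N') => i.
    rewrite ltnS leq_eqVlt => /orP[/eqP->|/NZ iZ].
      exact: (iter_nilpotent_le Z_lin (leq_maxr N N') N'Z).
    exact: (iter_nilpotent_le Z_lin (leq_maxl N N') iZ).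
  exists N => i; have [/NZ//|Ki] := ltnP i K.
  by rewrite (iter_nilpotent_le X_lin Ki Kv) (iter_zero Z_lin).
exists N; rewrite -mixed_words_diag.
suff main j i : mixed_words N j (iter i X v) = 0 by apply: (main N 0%N).
elim: j i => [|j IH] i.
  rewrite -[RHS](NZ i); elim: {NZ} N => //= N <-.
  by rewrite addr0.
have := mixed_words_ad N j (iter i X v).
rewrite IH -iterS IH (lin_zero X_lin) add0r => /eqP.
by rewrite eq_sym scaler_eq0 pnatr_eq0 => /eqP.
Qed.

End LocalNilpotency.

Section AdNilpotent.
Variables (F : numClosedFieldType) (g : lieSuperalgebra F) (B : g -> g -> F) (k : F).
Variables (M : lmodType F) (par : bool -> M -> Prop) (act : g -> int -> M -> M).
Hypothesis hM : affine_module B k par act.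
Local Notation br := (@lsa_br F g).
Variables (x : g) (s : int).
Hypothesis x_even : x \in lsa_par g false.

Let D := act x s.
Let D_lin c u v : D (c *: u + v) = c *: D u + D v := act_linr hM s c x u v.

Lemma act_even_comm a m n v : exists c,
  act x m (act a n v) = act a n (act x m v) + act (br x a) (m + n) v + c *: v.
Proof.
have [a0 [a1 [a0e a1o ->]]] := par_split a.
exists ((if m + n == 0 then m%:~R * B x a0 * k else 0) +
        (if m + n == 0 then m%:~R * B x a1 * k else 0)).
rewrite !(actDl hM) (actDr hM) brDr (actDl hM).
rewrite (act_comm hM _ _ _ x_even a0e) (act_comm hM _ _ _ x_even a1o) !expr0 !scale1r.
by rewrite scalerDl addrACA; congr (_ + _); rewrite addrACA.
Qed.

(** [D (a_n v)] is [a_n (D v)] plus a mode of [[x, a]] on [v] plus a multiple of [v]: nested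
    inductions, on the order of [ad x] at [a] and on that of [D] at [v]. *)
Lemma ad_nilpotent_stable a n v : nilpotent_at (br x) a -> nilpotent_at D v ->
  nilpotent_at D (act a n v).
Proof.
have hD := nilpotent_at_subspace D_lin.
move=> [r]; elim: r a n v => [|r IHr] a n v ra.
  by rewrite [a]ra (act0l hM) => _; apply: hD.1.
move=> [N]; elim: N v => [|N IHN] v Nv; first by rewrite [v]Nv (act0r hM); apply: hD.1.
have nv : nilpotent_at D v by exists N.+1.
suff [N' N'E] : nilpotent_at D (D (act a n v)) by exists N'.+1; rewrite iterSr.
have [c E] := act_even_comm a s n v; rewrite [D _]E {E}.
apply: (subspaceD hD); last exact: (subspaceZ hD).
apply: (subspaceD hD); first by apply: IHN; rewrite -iterSr.
by apply: IHr => //; rewrite -iterSr.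
Qed.

End AdNilpotent.

(** * Nilpotent currents in the simple quotient *)

Section CurrentPowers.
Variables (F : numClosedFieldType) (g : lieSuperalgebra F) (h nm np : {vspace g}).
Variables (B : g -> g -> F) (k : nat) (V : vertexSuperalgebra F) (iota : {linear g -> V}).
Hypothesis km : kac_moody h.
Hypothesis triangular : triangular_decomposition h nm np.
Hypothesis connected : even_dynkin_connected h np.
Hypothesis B_norm : normalized_form h B.
Hypothesis hiota : currents B k%:R iota.
Let act a n (u : V) : V := va_prod (iota a) n u.
Hypothesis generated : forall u, lspan (all_words act (fun w => w = va_vac V)) u.
Hypothesis simple : va_simple V.
Let actV := va_prod_action V.
Let hM : affine_module B k%:R (@va_par F V) act :=
  currents_affine_module hiota (va_par_grading V) actV.
Local Notation br := (@lsa_br F g).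
Local Notation vac := (va_vac V).

Lemma act_vac a (n : int) : 0 <= n -> act a n vac = 0.
Proof. exact: vac_positive0. Qed.

Lemma power_par x n : x \in lsa_par g false -> va_par false (iter n (act x (-1)) vac).
Proof.
move=> xe; elim: n => [|n IH] /=; first exact: va_vac_par.
exact: (act_par hM (-1) xe IH).
Qed.

Lemma power_deg x n : va_deg n%:Z (iter n (act x (-1)) vac).
Proof.
elim: n => [|n IH] /=; first exact: va_vac_deg.
by have := act_deg hiota x (-1) IH; congr va_deg; lia.
Qed.

Lemma commuting_power x y m n : x \in lsa_par g false -> 0 <= m ->
  (forall u, act y m (act x (-1) u) = act x (-1) (act y m u)) ->
  act y m (iter n (act x (-1)) vac) = 0.
Proof.
move=> xe m0 yx; elim: n => [|n IH] /=; first exact: act_vac.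
by rewrite yx IH (act0r hM).
Qed.

Lemma long_root_power x f t :
  (forall c x y z, B z (c *: x + y) = c * B z x + B z y) ->
  @highest_triple F g h B x f t ->
  iter k.+1 (act x (-1)) vac = 0.
Proof.
move=> B_linr [th [[th0 wx tht] wf [xf xft] ad_sq line]].
have [h_even h_abel] := kac_moody_cartan km.
have [wv_span _] := kac_moody_weights km.
have [xe hx] := wx; have [fe hf] := wf.
have [B_inv _ _] := B_norm.
have thN : th != - th.
  apply/eqP => E; have := congr1 (fun mu : weight h => (mu t : F)) E.
  rewrite opp_lfunE tht => /eqP; rewrite -subr_eq0 opprK -natrD pnatr_eq0 //.
have [_ Bxx] := ad_sq _ _ _ wx thN.
have F2 : (2%:R : F) != 0 by rewrite pnatr_eq0.
have xx : br x x = 0 by exact: br_self_even F2 xe.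
set X := act x (-1); have X0 : X 0 = 0 by apply: act0r hM _ _.
have hX p y m u : y \in lsa_par g p -> act y m (X u) =
    X (act y m u) + act (br y x) (m - 1) u + (if m == 1 then B y x * k%:R else 0) *: u.
  move=> yp; rewrite /X (act_comm hM _ _ _ yp xe) andbF expr0 scale1r; congr (_ + _ *: _).
  by rewrite subr_eq0; case: eqP => // ->; rewrite mul1r.
have x_pow m n : 0 <= m -> act x m (iter n X vac) = 0.
  move=> m0; apply: commuting_power => // u.
  by rewrite -/X (hX _ _ _ _ xe) xx Bxx (act0l hM) mul0r if_same scale0r !addr0.
apply: (singular_eq0 hiota generated simple (power_par _ xe) (power_deg _ _)) => //.
move=> a n n1; rewrite -/(act a n _) -/X; move: (wv_span a); move: a.
apply: lspan_least => [|y [p [mu wy]]]; first by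
  apply: (subspace_actl hM (P := fun u => u = 0)); split=> [//|c u v -> ->];
  rewrite scaler0 addr0.
have [yp hy] := wy.
have [muE|muth] := eqVneq mu (- th); last first.
  (* Off the weight [- th], the bracket [[y, x]] commutes with [x] and pairs with it to zero, so its
     modes of nonnegative index pass through the powers of [X] and kill the vacuum. *)
  have [yxx Byx] := ad_sq _ _ _ wy muth.
  have zp := lsa_br_par yp xe; rewrite addbF in zp.
  have Bz : B (br y x) x = 0 by rewrite (form_br B_inv) xx (form_0r B_linr).
  have z_pow m j : 0 <= m -> act (br y x) m (iter j X vac) = 0.
    move=> m0; apply: commuting_power => // u.
    by rewrite -/X (hX _ _ _ _ zp) yxx Bz (act0l hM) mul0r if_same scale0r !addr0.
  elim: k.+1 => [|j IH] /=; first by apply: act_vac; lia.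
  rewrite -/X (hX _ _ _ _ yp) IH X0 Byx mul0r if_same scale0r addr0 add0r.
  by apply: z_pow; lia.
rewrite muE in wy; have [c ->] := line _ _ wy; rewrite (actZl hM).
suff -> : act f n (iter k.+1 X vac) = 0 by rewrite scaler0.
have wt := weight_vector_h h_even h_abel (subvsP t); have [te _] := wt.
have Btx : B (vsval t) x = 0.
  by have [] := ad_sq _ _ _ wt; rewrite // eq_sym oppr_eq0.
have t_pow m j : 0 <= m -> act (vsval t) m (iter j X vac) =
    (if m == 0 then (2 * j)%:R else 0) *: iter j X vac.
  move=> m0; elim: j => [|j IH] /=; first by rewrite act_vac // muln0 if_same scale0r.
  rewrite (hX _ _ _ _ te) IH hx Btx mul0r if_same scale0r addr0 (actZl hM).
  rewrite /X (actZr hM) -/X /weight_eval tht; case: eqP => [->|/eqP m_neq0].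
    by rewrite sub0r -/X -scalerDl mulnS natrD addrC.
  rewrite scale0r add0r x_pow ?scaler0 ?scale0r //; lia.
have fx : br f x = - vsval t by rewrite anti_even // xft.
have Bfx : B f x = 1 by rewrite (@form_sym F g B B_inv false) // expr0 mul1r.
(* For [n = 1], [f t] and [x t^-1] form an sl2 string on the vacuum with [c = k] and [a = 2]; the
   factor [k - 2 k / 2] vanishes exactly at the power [k + 1]. For [n >= 2] the commutator is a mode
   of the coroot of positive index, which kills all powers. *)
have [n_eq1|n_neq1] := eqVneq n 1.
  rewrite n_eq1; have := @string_relation F V (act f 1) X vac k%:R 2%:R.
  move=> ->; first by rewrite (_ : _ - _ = 0) ?mul0r ?scale0r //; field.
  - by move=> b u; rewrite /X (actZr hM).
  - by apply: act_vac.
  move=> j; rewrite iterS (hX _ _ _ _ fe) Bfx fx (actNl hM) subrr t_pow // eqxx mul1r.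
  by rewrite -addrA -scaleNr -scalerDl natrM [_ + k%:R]addrC.
elim: k.+1 => [|j IH] /=; first by apply: act_vac; lia.
rewrite -/X (hX _ _ _ _ fe) IH X0 fx (actNl hM) t_pow; last by lia.
have -> : (n - 1 == 0) = false by lia.
by rewrite (negPf n_neq1) !scale0r oppr0 !addr0.
Qed.

(* At level [0] the form is invisible to the currents, but then they vanish. *)
Lemma level_zero_currents a : k = 0%N -> iota a = 0.
Proof.
move=> k0; have [iota_par iota_deg iota_prod] := hiota.
move: a; apply: par_ind => [|p a ap].
  apply: (subspace_ker (P := fun u => u = 0)) => [c u v|]; first exact: linearP.
  by split=> [//|c u v -> ->]; rewrite scaler0 addr0.
apply: (singular_eq0 hiota generated simple (iota_par _ _ ap) (iota_deg a)) => //.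
move=> b n n1; have [_ e1 e2] := iota_prod b a.
have [->|n_neq1] := eqVneq n 1; first by rewrite e1 k0 mul0r scale0r.
by apply: e2; lia.
Qed.

(** The product [iota z_(1) iota y = k B(z, y) vac] is linear in [y], and [k] and the vacuum are
    nonzero. *)
Lemma form_bilinear : k <> 0%N ->
  forall c x y z, B z (c *: x + y) = c * B z x + B z y.
Proof.
move=> k0 c x y z; have [_ _ iota_prod] := hiota; have [vac0 _] := simple.
have e1 u v : va_prod (iota u) 1 (iota v) = (k%:R * B u v) *: vac.
  by have [] := iota_prod u v.
have := e1 z (c *: x + y); rewrite linearP (mode_linr actV) !e1 scalerA -scalerDl.
move=> /eqP; rewrite -subr_eq0 -scalerBl scaler_eq0 (negPf vac0) orbF subr_eq0.
rewrite mulrCA -mulrDr => /eqP/esym; apply: mulfI.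
by rewrite pnatr_eq0; apply/eqP.
Qed.

Lemma current_power_eq0 (gam : weight h) x : gam != 0 -> weight_vector false gam x ->
  exists N, iter N (act x (-1)) vac = 0.
Proof.
move=> gam0 wx; have [k0|/form_bilinear B_linr] := pselect (k = 0%N).
  by exists 1%N; rewrite /= /act (level_zero_currents x k0) (mode0l actV).
have [h_even h_abel] := kac_moody_cartan km.
have [wv_span _] := kac_moody_weights km.
have [->|[[f [t xft]]|]] :=
    even_root_vector_generated km triangular connected B_norm B_linr gam0 wx.
- by exists 1%N; rewrite /= (act0l hM).
- by exists k.+1; apply: long_root_power xft.
move=> [e [f [t [gam1 [y [c [eft g1 wy xE eey]]]]]]].
have [th [[_ we _] _ _ _ _]] := eft.
have [ee he] := we; have [ye hy] := wy.
have [N NE] : nilpotent_at (act (br e y) (-1)) vac.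
  have comm a b m n u : a \in lsa_par g false -> b \in lsa_par g false -> m + n != 0 ->
      act a m (act b n u) = act b n (act a m u) + act (br a b) (m + n) u.
    move=> ap bp mn; rewrite (act_comm hM _ _ _ ap bp) expr0 scale1r (negPf mn).
    by rewrite scale0r addr0.
  have eyp : br e y \in lsa_par g false by have := lsa_br_par ee ye.
  (* With [e] in mode [-1] and [y] in mode [0], the commutator is [[e, y]] in mode [-1]. The zero
     mode of [y] kills the vacuum and [ad y] is nilpotent, so it is nilpotent at every power of
     [e t^-1] on the vacuum. *)
  apply: (commutator_nilpotent (X := act e (-1)) (Z := act y 0)).
  - by move=> d u v; rewrite (act_linr hM).
  - by move=> d u v; rewrite (act_linr hM).
  - by move=> d u v; rewrite (act_linr hM).
  - by move=> u; rewrite comm.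
  - by move=> u; rewrite comm // eey (act0l hM) addr0.
  - by exists k.+1; apply: long_root_power eft.
  elim=> [|i IH] /=; first by exists 1%N; apply: act_vac.
  apply: (ad_nilpotent_stable hM) => //.
  have [N NE] := ad_nilpotent h_even wv_span g1 wy we; by exists N.
exists N; rewrite xE.
have E u n : iter n (act (c *: br e y) (-1)) u = c ^+ n *: iter n (act (br e y) (-1)) u.
  elim: n => [|n IH] /=; first by rewrite scale1r.
  by rewrite IH (actZr hM) (actZl hM) scalerA -exprSr.
by rewrite E NE scaler0.
Qed.

End CurrentPowers.

Lemma gen_binomialN1 (F : numClosedFieldType) j : gen_binomial F (-1) j = (-1) ^+ j.
Proof.
rewrite /gen_binomial; have -> : \prod_(i < j) ((-1)%:~R - i%:R) = (-1) ^+ j * j`!%:R :> F.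
  elim: j => [|j IH]; first by rewrite big_ord0 expr0 fact0 mulr1.
  by rewrite big_ord_recr /= IH factS natrM exprS -[j.+1%:R]natr1; ring.
by rewrite mulfK // pnatr_eq0 -lt0n fact_gt0.
Qed.

(** * Powers of a field with commuting modes *)

Section FieldPowers.
Variables (F : numClosedFieldType) (V : vertexSuperalgebra F).
Variables (M : lmodType F) (Mpar : bool -> M -> Prop) (Y : V -> int -> M -> M).
Hypothesis actionY : va_action (@va_par F V) (@va_prod F V) Y (va_vac V) Mpar.
Variable a : V.
Hypothesis a_even : va_par false a.
Hypothesis a_comm : forall m n v, Y a m (Y a n v) = Y a n (Y a m v).

Local Notation power N := (iter N (va_prod a (-1)) (va_vac V)).

Lemma field_power_par N : va_par false (power N).
Proof.
elim: N => [|N IH] /=; first exact: va_vac_par.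
by have [_ H _ _ _] := va_prod_action V; apply: H a_even IH.
Qed.

(** The mode expansion of the normally ordered product of [a] with its [N]-th power: the iterate
    formula at [n = -1], where the signs cancel against the binomials of [-1]. *)
Lemma field_power_recursion N l v : exists N0 : nat, forall L : nat, (N0 <= L)%N ->
  Y (power N.+1) l v = \sum_(j < L)
    (Y a (-1 - j%:Z) (Y (power N) (l + j%:Z) v) +
     Y (power N) (l - 1 - j%:Z) (Y a j%:Z v)).
Proof.
have [N0 H] := mode_iterate actionY (-1) l v a_even (field_power_par N).
exists N0 => L NL; rewrite [LHS](H L NL); apply: eq_bigr => j _.
rewrite gen_binomialN1 -exprD addnn -mul2n exprM sqrrN expr1n expr1n scale1r.
rewrite expr0 mulr1 exprN1 invrN invr1 scaleN1r opprK; congr (_ + Y _ _ _); lia.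
Qed.

Lemma field_power_comm N m n v : Y a m (Y (power N) n v) = Y (power N) n (Y a m v).
Proof.
elim: N n v => [|N IH] n v.
  by rewrite /= !(mode_vac actionY); case: eqP => // _; apply: mode0r actionY _ _.
have [N0 H0] := field_power_recursion N n v.
have [N1 H1] := field_power_recursion N n (Y a m v).
rewrite (H0 (maxn N0 N1)) ?leq_maxl // (H1 (maxn N0 N1)) ?leq_maxr //.
have add u w : Y a m (u + w) = Y a m u + Y a m w.
  by have := mode_linr actionY m 1 a u w; rewrite !scale1r.
rewrite (big_morph _ add (mode0r actionY m a)); apply: eq_bigr => j _.
by rewrite add a_comm !IH a_comm.
Qed.

Definition killed_above r v := forall j : int, r < j -> Y a j v = 0.

Lemma killed_above_mode r m v : killed_above r v -> killed_above r (Y a m v).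
Proof. by move=> rv j rj; rewrite a_comm rv // (mode0r actionY). Qed.

(* The leading coefficient of the [N]-th normally ordered power of a field. *)
Lemma field_power_leading N r v : killed_above r v ->
  (forall m : int, N%:Z * (r + 1) <= m -> Y (power N) m v = 0) /\
  Y (power N) (N%:Z * (r + 1) - 1) v = iter N (Y a r) v.
Proof.
elim: N v => [|N IH] v rv.
  split=> [m m0|]; rewrite /= (mode_vac actionY); last by rewrite mul0r.
  by case: eqP => // mE; move: m0; rewrite mE; lia.
pose T m (j : nat) := Y a (-1 - j%:Z) (Y (power N) (m + j%:Z) v) +
  Y (power N) (m - 1 - j%:Z) (Y a j%:Z v).
have [IH1 IH2] := IH v rv.
(* The only index at which the mode [r] of [a] occurs, in one half or the other of the normally
   ordered sum. The index [N (r + 1) - 1] of the leading mode comes from multiplying [N] factors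
   [z^(-r-1)]. *)
pose j0 := if 0 <= r then absz r else absz (-1 - r)%R.
have T0 m (j : nat) : N.+1%:Z * (r + 1) - 1 <= m -> j != j0 -> T m j = 0.
  move=> mN jj0; rewrite /T.
  have jr : j%:Z != r /\ -1 - j%:Z != r by move: jj0; rewrite /j0; case: ifP; lia.
  have -> : Y a (-1 - j%:Z) (Y (power N) (m + j%:Z) v) = 0.
    have [jl|jl] := leP (-1 - j%:Z) r; last by rewrite field_power_comm rv // (mode0r actionY).
    by rewrite IH1 ?(mode0r actionY) //; lia.
  rewrite add0r; have [jl|jl] := leP j%:Z r; last by rewrite rv // (mode0r actionY).
  by apply: (IH _ (killed_above_mode _ rv)).1; lia.
have sumT m : N.+1%:Z * (r + 1) - 1 <= m -> Y (power N.+1) m v = T m j0.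
  move=> mN; have [N0 H0] := field_power_recursion N m v.
  have lt0 : (j0 < (N0 + j0).+1)%N by lia.
  rewrite (H0 (N0 + j0).+1); last by lia.
  rewrite (bigD1 (Ordinal lt0)) //= big1 ?addr0 // => j jj0.
  by apply: (T0 m j mN); apply: contraNneq jj0 => E; apply/eqP/val_inj.
have j0E m : T m j0 = if 0 <= r
    then Y a (-1 - r) (Y (power N) (m + r) v) + Y (power N) (m - 1 - r) (Y a r v)
    else Y a r (Y (power N) (m - 1 - r) v) + Y (power N) (m + r) (Y a (-1 - r) v).
  rewrite /T /j0; case: ifP => r0.
    by have -> : (absz r)%:Z = r by lia.
  have -> : (absz (-1 - r)%R)%:Z = -1 - r by lia.
  by congr (Y a _ (Y _ _ _) + Y _ _ _); lia.
have IHr := IH _ (killed_above_mode r rv).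
split=> [m mN|].
  rewrite sumT ?j0E; last by lia.
  case: ifP => r0.
    rewrite IH1 ?(mode0r actionY) ?add0r; last by lia.
    by apply: IHr.1; lia.
  rewrite IH1 ?(mode0r actionY) ?add0r; last by lia.
  by rewrite rv ?(mode0r actionY) //; lia.
rewrite sumT // j0E; have -> : N.+1%:Z * (r + 1) - 1 - 1 - r = N%:Z * (r + 1) - 1 by lia.
case: ifP => r0.
  rewrite IH1 ?(mode0r actionY) ?add0r; last by lia.
  by rewrite IHr.2 -iterSr.
by rewrite IH2 rv ?(mode0r actionY) ?addr0 //; lia.
Qed.

Variable N : nat.
Hypothesis power_eq0 : power N = 0.

Lemma iter_mode_comm m n j v : Y a m (iter j (Y a n) v) = iter j (Y a n) (Y a m v).
Proof. by elim: j => //= j IH; rewrite a_comm IH. Qed.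

Lemma iter_iter_comm m n i j v :
  iter i (Y a m) (iter j (Y a n) v) = iter j (Y a n) (iter i (Y a m) v).
Proof. by elim: i => //= i ->; rewrite iter_mode_comm. Qed.

Lemma killed_above_iter r m j v : killed_above r v -> killed_above r (iter j (Y a m) v).
Proof. by move=> rv; elim: j => //= j IH; apply: killed_above_mode. Qed.

Lemma top_mode_nilpotent r v : killed_above r v -> iter N (Y a r) v = 0.
Proof.
move=> rv; have [_ <-] := field_power_leading N rv.
by rewrite power_eq0 (mode0l actionY).
Qed.

(** A vector killed also by mode [r] is killed above [r - 1], where the previous case applies. The
    filtration by kernels of powers of mode [r] has at most [N] steps, and the modes commute, so the
    exponents multiply. *)
Lemma mode_nilpotent i : exists L, forall r v, killed_above r v ->
  iter L (Y a (r - i%:Z)) v = 0.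
Proof.
elim: i => [|i [L HL]].
  by exists N => r v rv; rewrite subr0; apply: top_mode_nilpotent.
exists (N * L)%N => r v rv; have := top_mode_nilpotent rv; move: v rv.
elim: {1 2}N => [|q IH] v rv; first by move=> /= ->.
move=> qv; rewrite mulSn addnC iterD; apply: IH; first exact: killed_above_iter.
rewrite iter_iter_comm; have -> : r - i.+1%:Z = r - 1 - i%:Z by lia.
apply: HL => j rj; have [jr|jr] := leP j r; last first.
  exact: (killed_above_iter _ _ rv jr).
have -> : j = r by lia.
exact: qv.
Qed.

End FieldPowers.

(** * Lowest energy spaces *)

Section HeightOrder.
Variables (F : numClosedFieldType) (g : lieSuperalgebra F) (h : {vspace g}).
Local Notation br := (@lsa_br F g).
Local Notation weight := (weight h).
Local Notation wv := (@weight_vector F g h).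
Hypothesis h_even : (h <= lsa_par g false)%VS.
Hypothesis wv_span : forall x, lspan (fun u => exists p (mu : weight), wv p mu u) x.
Variable t0 : subvs_of h.

(** The condition used both for an Engel argument and for straightening ordered monomials:
    bracketing an element of a tail with the letter before it stays in the span of that tail. *)
Fixpoint polycentral (ys : seq g) : Prop :=
  if ys is y :: ys' then
    (forall z, z \in ys' -> br z y \in <<ys'>>%VS) /\ polycentral ys'
  else True.

Definition positive_vector (y : g) :=
  exists p (mu : weight), [/\ wv p mu y, y != 0 & 0 < (mu t0 : F)].

Lemma span_weight_component (s : seq g) (wt : g -> weight) mu x :
  (forall y, y \in s -> root_vector (wt y) y) -> root_vector mu x ->
  x \in <<s>>%VS -> x \in <<[seq y <- s | wt y == mu]>>%VS.
Proof.
move=> ws hx xs; set s' := [seq y <- s | _].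
have [x1 x1s hx1] : exists2 x1, x1 \in <<s'>>%VS &
    lspan (fun u => exists2 nu, nu != mu & root_vector nu u) (x - x1).
  have hS := lspan_subspace (fun u => exists2 nu, nu != mu & @root_vector F g h nu u).
  apply: (span_ind (P := fun x => exists2 x1, x1 \in <<s'>>%VS &
    lspan (fun u => exists2 nu, nu != mu & root_vector nu u) (x - x1))) xs => [|y ys].
    split=> [|c u v [u1 u1s hu] [v1 v1s hv]].
      by exists 0; rewrite ?mem0v // subrr; apply: hS.1.
    exists (c *: u1 + v1); first by rewrite memvD ?memvZ.
    rewrite opprD addrACA -scalerBr; exact: hS.2.
  have [E|E] := eqVneq (wt y) mu.
    exists y; last by rewrite subrr; apply: hS.1.
    by apply: memv_span; rewrite mem_filter E eqxx.
  by exists 0; rewrite ?mem0v // subr0; apply: lspan_gen; exists (wt y) => //; apply: ws.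
have hx1' : root_vector mu x1.
  apply: (span_ind (root_vector_subspace mu) _ x1s) => y.
  by rewrite mem_filter => /andP[/eqP <-]; apply: ws.
suff /eqP : x - x1 = 0 by rewrite subr_eq0 => /eqP ->.
by apply: (root_vector_independent _ hx1); apply: (subspaceB (root_vector_subspace mu)).
Qed.

(** Root vectors are sorted by increasing height: [[z, y]] has greater height than [y], so it is a
    combination of later vectors. The integer [rank] replaces the height, which lies in the
    field. *)
Lemma polycentral_exists : exists ys : seq g,
  [/\ forall y, y \in ys -> positive_vector y,
      forall y, positive_vector y -> y \in <<ys>>%VS
    & polycentral ys].
Proof.
have [s sP s_span] := lspan_finite positive_vector.
have [L hL] := weights_finite wv_span.
have wtP (y : g) : exists mu : weight,
    (exists mu', @root_vector F g h mu' y) -> root_vector mu y.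
  have [[mu hmu]|n] := pselect (exists mu', @root_vector F g h mu' y); first by exists mu.
  by exists 0.
pose wt y := projT1 (cid (wtP y)).
have wt_root y : y \in s -> root_vector (wt y) y.
  move=> /sP[p [mu [[_ hy] _ _]]]; rewrite /wt; case: cid => nu /= H.
  by apply: H; exists mu.
have wtE y mu : y \in s -> root_vector mu y -> mu = wt y.
  move=> ys hy; apply/eqP/negPn/negP => E; have [p [nu [_ y0 _]]] := sP y ys.
  case/eqP: y0; apply: (root_vector_independent hy); apply: lspan_gen.
  by exists (wt y); [rewrite eq_sym|apply: wt_root].
have wt_pos y : y \in s -> 0 < (wt y t0 : F).
  by move=> ys; have [p [mu [[_ hy] _ mu0]]] := sP y ys; rewrite -(wtE y mu).
pose rank y := count (fun nu : weight => (nu t0 : F) < wt y t0) L.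
have rank_lt x y z : x \in s -> y \in s -> z \in s -> wt x = wt z + wt y ->
    (rank y < rank x)%N.
  move=> xs ys zs E; have yx : (wt y t0 : F) < wt x t0.
    by rewrite E add_lfunE ltrDr wt_pos.
  apply: (count_ltn (x := wt y)); rewrite ?ltxx //.
    by move=> nu nuy; apply: lt_trans yx.
  have [p [mu [_ y0 _]]] := sP y ys; exact: hL y0 (wt_root y ys).
pose ys := sort (fun y z => (rank y <= rank z)%N) s.
have ysE y : (y \in ys) = (y \in s) by rewrite mem_sort.
have br_span y z : y \in s -> z \in s ->
    br z y \in <<[seq x <- s | wt x == (wt z + wt y)%R]>>%VS.
  move=> yS zS; have [b0|b0] := eqVneq (br z y) 0; first by rewrite b0 mem0v.
  apply: span_weight_component => //.
    exact: (root_vector_br h_even (wt_root z zS) (wt_root y yS)).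
  apply: s_span; apply: lspan_gen.
  have [p [mu [[zp _] _ _]]] := sP z zS; have [q [nu [[yq _] _ _]]] := sP y yS.
  exists (p (+) q), (wt z + wt y); split=> //; last by rewrite add_lfunE addr_gt0 ?wt_pos.
  by apply: (weight_vector_br h_even); split=> //; apply: wt_root.
exists ys; split=> [y|y|]; rewrite ?ysE; first exact: sP.
  move=> Py; apply: subvP (s_span y (lspan_gen Py)).
  by apply: sub_span => z zs; rewrite ysE.
have srt : sorted (fun y z => (rank y <= rank z)%N) ys.
  by apply: sort_sorted => y z; apply: leq_total.
have tr : transitive (fun y z => (rank y <= rank z)%N) by move=> a b c; apply: leq_trans.
suff main s' : {subset s' <= s} -> sorted (fun y z => (rank y <= rank z)%N) s' ->
    (forall x y, x \in s -> x \notin s' -> y \in s' -> (rank x <= rank y)%N) ->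
    polycentral s'.
  apply: main => // [y|x y xs]; rewrite ysE // => /negP/(_ xs) //.
elim: s' => // y s' IH sub /[dup] srt' /path_sorted srt2 inv.
have yS : y \in s by apply: sub; rewrite mem_head.
have sub' : {subset s' <= s} by move=> z zs; apply: sub; rewrite inE zs orbT.
split=> [z zs'|].
  apply: subvP (br_span y z yS (sub' _ zs')); apply: sub_span => x.
  rewrite mem_filter => /andP[/eqP E xs].
  have rk := rank_lt x y z xs yS (sub' _ zs') E.
  apply/negPn/negP => xs'; have : x \notin y :: s'.
    by rewrite inE negb_or xs' andbT; apply: contraTneq rk => ->; rewrite ltnn.
  by move=> /(inv x y xs)/(_ (mem_head _ _)); rewrite leqNgt rk.
apply: IH => // x z xs xs' zs'; have [->|xy] := eqVneq x y.
  by have := order_path_min tr srt'; move=> /allP/(_ z zs').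
by apply: inv => //; rewrite inE ?negb_or ?xy ?xs' ?zs' ?orbT.
Qed.

End HeightOrder.

Section ZeroModes.
Variables (F : numClosedFieldType) (g : lieSuperalgebra F) (B : g -> g -> F) (k : F).
Variables (M : lmodType F) (par : bool -> M -> Prop) (act : g -> int -> M -> M).
Hypothesis hM : affine_module B k par act.
Local Notation br := (@lsa_br F g).
Local Notation homogeneous y := (exists p, y \in lsa_par g p).

Variable T : M -> Prop.
Hypothesis T_subspace : subspace T.
Hypothesis T_stable : forall a v, T v -> T (act a 0 v).

Let iterT y e v : T v -> T (iter e (act y 0) v).
Proof. by move=> Tv; elim: e => //= e; apply: T_stable. Qed.

Lemma zero_mode_comm p q a b v : a \in lsa_par g p -> b \in lsa_par g q ->
  act a 0 (act b 0 v) = (-1) ^+ (p && q) *: act b 0 (act a 0 v) + act (br a b) 0 v.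
Proof.
move=> ap bq; rewrite (act_comm hM _ _ _ ap bq) addr0 mulr0z !mul0r eqxx scale0r.
by rewrite addr0.
Qed.

Lemma iter_mode_par p y e v : y \in lsa_par g p -> (exists q, par q v) ->
  exists q, par q (iter e (act y 0) v).
Proof.
move=> yp vq; elim: e => //= e [q hq]; exists (p (+) q); exact: (act_par hM).
Qed.

(** Engel's argument: once the tail kills [u], it kills all [y ^ i u], because [[z, y]] is in the
    span of the tail; the last nonzero power is then killed by [y] as well. *)
Lemma killed_vector_exists (ys : seq g) v :
  polycentral ys -> (forall y, y \in ys -> homogeneous y) ->
  (forall y v, y \in ys -> T v -> nilpotent_at (act y 0) v) ->
  T v -> v != 0 -> (exists p, par p v) ->
  exists u, [/\ T u, u != 0, exists p, par p u & forall y, y \in ys -> act y 0 u = 0].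
Proof.
elim: ys => [|y ys IH] /=; first by move=> _ _ _ Tv v0 vp; exists v; split.
move=> [yc pc] hom nil Tv v0 vp.
have [||u [Tu u0 up uk]] := IH pc _ _ Tv v0 vp.
- by move=> z zs; apply: hom; rewrite inE zs orbT.
- by move=> z w zs; apply: nil; rewrite inE zs orbT.
have [N uN] := nil y u (mem_head _ _) Tu.
have exN : exists N, iter N (act y 0) u == 0 by exists N; apply/eqP.
case: (ex_minnP exN) => -[|n] /eqP yn minn; first by rewrite -yn eqxx in u0.
have [p yp] := hom y (mem_head _ _).
exists (iter n (act y 0) u); split.
- exact: iterT.
- by apply: contraT => /negPn/minn; rewrite ltnn.
- exact: (iter_mode_par n yp up).
have main i : forall z, z \in ys -> act z 0 (iter i (act y 0) u) = 0.
  elim: i => //= i IHi z zs.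
  have [q zq] := hom z ltac:(by rewrite inE zs orbT).
  rewrite (zero_mode_comm _ zq yp) IHi // (act0r hM) scaler0 add0r.
  apply: (span_ind (P := fun x => act x 0 (iter i (act y 0) u) = 0)) (yc z zs) => //.
  by split=> [|c a b a0 b0]; rewrite ?(act0l hM) // (act_linl hM) a0 b0 scaler0 addr0.
by move=> z; rewrite inE => /orP[/eqP->|/main].
Qed.

(** Ordered monomials applied to [W], with the first letter outermost. They replace a
    Poincare-Birkhoff-Witt basis; only spanning is used. *)
Fixpoint ordered_span (ys : seq g) (W : M -> Prop) : M -> Prop :=
  if ys is y :: ys' then
    lspan (fun u => exists e a, ordered_span ys' W a /\ u = iter e (act y 0) a)
  else W.

Lemma ordered_span_subspace ys W : subspace W -> subspace (ordered_span ys W).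
Proof. by case: ys => // y ys _; apply: lspan_subspace. Qed.

Lemma ordered_span_base ys (W : M -> Prop) u : W u -> ordered_span ys W u.
Proof. by move=> Wu; elim: ys => //= y ys IH; apply: lspan_gen; exists 0%N, u. Qed.

Lemma ordered_span_mono ys (W W' : M -> Prop) u :
  (forall v, W v -> W' v) -> ordered_span ys W u -> ordered_span ys W' u.
Proof.
move=> WW'; elim: ys u => [|y ys IH] u /=; first exact: WW'.
apply: lspan_sub => _ [e [a [Sa ->]]]; apply: lspan_gen; exists e, a; split=> //.
exact: IH.
Qed.

Lemma ordered_span_T ys W : (forall u, W u -> T u) -> forall u, ordered_span ys W u -> T u.
Proof.
move=> WT; elim: ys => //= y ys IH; apply: lspan_least => // _ [e [a [/IH Ta ->]]].
exact: iterT.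
Qed.

Lemma ordered_span_stable ys W x u : subspace W -> polycentral ys ->
  (forall y, y \in ys -> homogeneous y) ->
  x \in <<ys>>%VS -> ordered_span ys W u -> ordered_span ys W (act x 0 u).
Proof.
move=> hW; elim: ys x u => [|y ys IH] x u.
  by rewrite span_nil memv0 => _ _ /eqP-> _; rewrite (act0l hM); apply: hW.1.
move=> [yc pc] hom xs; set S := ordered_span (y :: ys) W.
have hS : subspace S := lspan_subspace _.
have hom' z : z \in ys -> homogeneous z by move=> zs; apply: hom; rewrite inE zs orbT.
have [p yp] := hom y (mem_head _ _).
suff main e a : ordered_span ys W a -> forall z, z \in ys ->
    S (act z 0 (iter e (act y 0) a)).
  move: u; apply: lspan_least; first exact: (subspace_act hM).
  move=> _ [e [a [Sa ->]]].
  apply: (span_ind (P := fun x => S (act x 0 (iter e (act y 0) a)))) xs.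
    exact: (subspace_actl hM).
  move=> z; rewrite inE => /orP[/eqP->|]; last exact: main.
  by apply: lspan_gen; exists e.+1, a.
move=> Sa; elim: e => [|e IHe] z zs.
  by apply: lspan_gen; exists 0%N, (act z 0 a); split=> //; apply: IH => //; apply: memv_span.
have [q zq] := hom' z zs.
rewrite iterS (zero_mode_comm _ zq yp); apply: (subspaceD hS).
  apply: (subspaceZ hS); have : S (act z 0 (iter e (act y 0) a)) by apply: IHe.
  move: (act z 0 _); apply: lspan_least; first exact: (subspace_act hM).
  by move=> _ [e' [b [Sb ->]]]; apply: lspan_gen; exists e'.+1, b.
apply: (span_ind (P := fun x => S (act x 0 (iter e (act y 0) a)))) (yc z zs) => //.
exact: (subspace_actl hM).
Qed.

Lemma ordered_span_finite ys (W : M -> Prop) (ws : seq M) :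
  (forall y, y \in ys -> exists N, forall v, T v -> iter N (act y 0) v = 0) ->
  (forall u, W u -> T u) -> (forall u, W u -> lspan (fun w : M => w \in ws) u) ->
  exists ws' : seq M, forall u, ordered_span ys W u -> lspan (fun w => w \in ws') u.
Proof.
move=> nil WT Wws; elim: ys nil => [|y ys IH] nil; first by exists ws.
have [z zs|ws' hws'] := IH; first by apply: nil; rewrite inE zs orbT.
have [N yN] := nil y (mem_head _ _).
exists [seq iter e (act y 0) w | e <- iota 0 N, w <- ws'] => u /=.
apply: lspan_sub => _ [e [a [Sa ->]]]; have [Ne|eN] := leqP N e.
  rewrite (iter_nilpotent_le (act_linr hM _ ^~ y) Ne); first exact: lspan0.
  by apply: yN; apply: ordered_span_T Sa.
move: a {Sa} (hws' a Sa); apply: lspan_least => [|w ww].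
  by apply: subspace_ker (lspan_subspace _) => c v v'; apply: (iter_lin (act_linr hM _ ^~ y)).
apply: lspan_gen; apply/allpairsP; exists (e, w); split=> //.
by rewrite mem_iota.
Qed.

Variable t : g.
Local Notation z := (act t 0).

Fixpoint linear_factors (q : seq F) (u : M) : M :=
  if q is c :: q' then z (linear_factors q' u) - c *: linear_factors q' u else u.

Lemma linear_factors_lin q c u v :
  linear_factors q (c *: u + v) = c *: linear_factors q u + linear_factors q v.
Proof.
elim: q => //= b q ->; rewrite (act_linr hM) scalerDr opprD addrACA scalerBr.
by rewrite !scalerA [b * c]mulrC.
Qed.

Lemma linear_factors_cat q q' u :
  linear_factors (q ++ q') u = linear_factors q (linear_factors q' u).
Proof. by elim: q => //= c q ->. Qed.

Lemma linear_factors_act q u : z (linear_factors q u) = linear_factors q (z u).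
Proof.
elim: q => //= c q IH; rewrite -IH -scaleNr addrC (act_linr hM) scaleNr addrC.
by [].
Qed.

Lemma linear_factors_comm q q' u :
  linear_factors q (linear_factors q' u) = linear_factors q' (linear_factors q u).
Proof.
elim: q => //= c q ->; rewrite linear_factors_act -[in RHS]scaleNr addrC.
by rewrite [in RHS]addrC linear_factors_lin scaleNr.
Qed.

Lemma linear_factors_flatten (qs : seq (seq F)) q u : q \in qs ->
  exists v, linear_factors (flatten qs) u = linear_factors q v.
Proof.
elim: qs => //= q' qs IH; rewrite inE linear_factors_cat => /orP[/eqP->|/IH[v ->]].
  by eexists.
by eexists; apply: linear_factors_comm.
Qed.

Lemma linear_factors_shift y d e q u :
  (forall v, z (act y 0 v) = act y 0 (z v) + d *: act y 0 v) ->
  linear_factors q (iter e (act y 0) u)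
  = iter e (act y 0) (linear_factors [seq c - e%:R * d | c <- q] u).
Proof.
move=> yd; have ze v : z (iter e (act y 0) v)
    = iter e (act y 0) (z v) + (e%:R * d) *: iter e (act y 0) v.
  elim: e => [|e IH] /=; first by rewrite mul0r scale0r addr0.
  rewrite yd IH (actDr hM) (actZr hM) -addrA -scalerDl; congr (_ + _ *: _).
  by rewrite mulrS mulrDl mul1r addrC.
have lin c v w := iter_lin (act_linr hM 0 ^~ y) e c v w.
elim: q => //= c q ->; rewrite ze -scaleNr -addrA -scalerDl addrC -lin addrC.
by rewrite -scaleNr opprB addrC.
Qed.

(** Moving [q(t)] through [y ^ e] translates its roots by [e d], and only [e < N] matters. Taking
    for [q'] the product of all these translates, letter by letter, puts every ordered monomial
    applied to an image of [q'(t)] into the image of [q(t)]. *)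
Lemma ordered_span_factor ys q :
  (forall y, y \in ys ->
     (exists N, forall v, T v -> iter N (act y 0) v = 0) /\
     exists d, forall v, z (act y 0 v) = act y 0 (z v) + d *: act y 0 v) ->
  exists q', forall u,
    ordered_span ys (fun u => T u /\ exists w, u = linear_factors q' w) u ->
    exists w, u = linear_factors q w.
Proof.
elim: ys q => [|y ys IH] q hy; first by exists q => u [].
have [[N yN] [d yd]] := hy y (mem_head _ _).
have [w ws|q' hq'] := IH (flatten [seq [seq c - e%:R * d | c <- q] | e <- iota 0 N]).
  by apply: hy; rewrite inE ws orbT.
have im0 : subspace (fun u => exists w, u = linear_factors q w).
  split=> [|c _ _ [u ->] [v ->]]; last by exists (c *: u + v); rewrite linear_factors_lin.
  by exists 0; rewrite (lin_zero (linear_factors_lin q)).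
exists q' => u /=; move: u; apply: lspan_least => // _ [e [a [Sa ->]]].
have [Ne|eN] := leqP N e.
  rewrite (iter_nilpotent_le (act_linr hM _ ^~ y) Ne); first exact: im0.1.
  by apply: yN; apply: ordered_span_T Sa => v [].
have [w ->] := hq' a Sa.
have [|v ->] := @linear_factors_flatten
  [seq [seq c - e%:R * d | c <- q] | e <- iota 0 N] [seq c - e%:R * d | c <- q] w.
  by apply/mapP; exists e; rewrite ?mem_iota.
by rewrite -(linear_factors_shift _ _ _ yd); eexists.
Qed.

End ZeroModes.

(** * Resolvents in countable dimension *)

Lemma infinite_fibre (R : realType) (f : R -> nat) :
  exists n, forall N, exists s : seq R,
    [/\ uniq s, size s = N & forall a, a \in s -> f a = n].
Proof.
have [n finf] : exists n, infinite_set (f @^-1` [set n])%classic.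
  apply/not_existsP => fin; have cT : countable (@classical_sets.setT R).
    have -> : @classical_sets.setT R =
        (\bigcup_(n in @classical_sets.setT nat) f @^-1` [set n])%classic.
      by apply/seteqP; split=> // a _; exists (f a).
    apply: bigcup_countable => [|n _]; first exact: countableP.
    by apply: finite_set_countable; apply: contrapT; apply: fin.
  (* Uncountability of the reals: a countable set has Lebesgue measure zero, the line does not. *)
  have := countable_lebesgue_measure0 cT.
  by rewrite -set_interval.set_itvNyy lebesgue_measure_itv.
exists n => N; have [A Af NA] := infinite_set_fset N finf.
exists (take N (finmap.enum_fset A)); split.
- exact/take_uniq/finmap.fset_uniq.
- by rewrite size_takel.
by move=> a /mem_take aA; apply: Af.
Qed.

Section PolynomialAction.
Variables (F : numClosedFieldType) (M : lmodType F) (z : M -> M).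
Hypothesis z_lin : forall c u v, z (c *: u + v) = c *: z u + z v.

Definition poly_act (p : {poly F}) (v : M) := \sum_(i < size p) p`_i *: iter i z v.

Lemma poly_act_widen n (p : {poly F}) v : (size p <= n)%N ->
  poly_act p v = \sum_(i < n) p`_i *: iter i z v.
Proof.
move=> pn; rewrite /poly_act (big_ord_widen n (fun i => p`_i *: iter i z v) pn).
rewrite big_mkcond; apply: eq_bigr => i _; case: ltnP => // pi.
by rewrite nth_default // scale0r.
Qed.

Lemma poly_act_linl c p q v :
  poly_act (c *: p + q) v = c *: poly_act p v + poly_act q v.
Proof.
set n := maxn (size (c *: p + q)) (maxn (size p) (size q)).
rewrite !(@poly_act_widen n) ?leq_max ?leqnn ?orbT //.
rewrite scaler_sumr -big_split; apply: eq_bigr => i _ /=.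
by rewrite coefD coefZ scalerDl scalerA.
Qed.

Lemma poly_act_linr p c u v :
  poly_act p (c *: u + v) = c *: poly_act p u + poly_act p v.
Proof.
rewrite /poly_act scaler_sumr -big_split; apply: eq_bigr => i _ /=.
by rewrite (iter_lin z_lin) scalerDr !scalerA mulrC.
Qed.

Lemma poly_act_mulX p v : poly_act (p * 'X) v = poly_act p (z v).
Proof.
rewrite (@poly_act_widen (size p).+1 (p * 'X)); last first.
  by apply: leq_trans (size_polyMleq _ _) _; rewrite size_polyX addn2.
rewrite big_ord_recl coefMX eqxx scale0r add0r; apply: eq_bigr => i _.
by rewrite lift0 coefMX iterSr.
Qed.

Lemma poly_act_mulXsub p a v : poly_act (p * ('X - a%:P)) v = poly_act p (z v - a *: v).
Proof.
have -> : p * ('X - a%:P) = (- a) *: p + p * 'X.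
  by rewrite mulrBr addrC -[a%:P]alg_polyC mulr_algr scaleNr.
by rewrite poly_act_linl poly_act_mulX [z v - _]addrC -scaleNr poly_act_linr.
Qed.

Lemma poly_act1 v : poly_act 1 v = v.
Proof. by rewrite /poly_act size_poly1 big_ord1 coefC scale1r. Qed.

Lemma poly_act_sum (I : Type) (r : seq I) (c : I -> F) (p : I -> {poly F}) v :
  poly_act (\sum_(i <- r) c i *: p i) v = \sum_(i <- r) c i *: poly_act (p i) v.
Proof.
elim: r => [|i r IH]; first by rewrite !big_nil /poly_act size_poly0 big_ord0.
by rewrite !big_cons poly_act_linl IH.
Qed.

(* If [(z - a) u_a = v] is solvable at more points [a] than the [u_a] can be
   independent, clearing denominators gives a polynomial killing [v]. *)
Lemma resolvent_dependence n (a : 'I_n -> F) (u : 'I_n -> M) (c : 'I_n -> F) v :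
  injective a -> (forall i, z (u i) - a i *: u i = v) ->
  (exists i, c i != 0) -> \sum_i c i *: u i = 0 ->
  exists2 p : {poly F}, p != 0 & poly_act p v = 0.
Proof.
move=> inja zu [i0 ci0] dep.
(* [P i] sends [v] to [Q(z) (u i)], so the combination [\sum_i c i *: P i] kills [v]; it is not the
   zero polynomial, because at [a i0] all terms but one vanish. *)
pose P i := \prod_(j | j != i) ('X - (a j)%:P); pose Q := \prod_j ('X - (a j)%:P).
have QE i : Q = P i * ('X - (a i)%:P) by rewrite /Q (bigD1 i) //= mulrC.
exists (\sum_i c i *: P i).
  apply/eqP => /(congr1 (horner^~ (a i0))); rewrite horner0 horner_sum => /eqP.
  rewrite (bigD1 i0) //= big1 ?addr0 => [|i ii0]; last first.
    by rewrite hornerZ horner_prod (bigD1 i0) 1?eq_sym //= hornerXsubC subrr mul0r mulr0.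
  rewrite hornerZ mulf_eq0 (negPf ci0) horner_prod => /prodf_eq0[j ji0].
  by rewrite hornerXsubC subr_eq0 (inj_eq inja) eq_sym (negPf ji0).
have e i : poly_act (P i) v = poly_act Q (u i) by rewrite (QE i) poly_act_mulXsub zu.
rewrite poly_act_sum; under eq_bigr do rewrite e.
have -> : \sum_i c i *: poly_act Q (u i) = poly_act Q (\sum_i c i *: u i).
  have Q0 : poly_act Q 0 = 0 by apply: lin_zero (poly_act_linr Q).
  elim/big_rec2: _ => [|i y x _ ->]; first by rewrite Q0.
  by rewrite poly_act_linr.
by rewrite dep (lin_zero (poly_act_linr Q)).
Qed.

End PolynomialAction.

Lemma finite_span_dependent (F : fieldType) (M : lmodType F) n N (f : nat -> M)
    (u : 'I_N -> M) : (n < N)%N ->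
  (forall i, lspan (fun w => exists2 j, (j < n)%N & w = f j) (u i)) ->
  exists c : 'I_N -> F, (exists i, c i != 0) /\ \sum_i c i *: u i = 0.
Proof.
move=> nN uf; have coefs w : lspan (fun w => exists2 j, (j < n)%N & w = f j) w ->
    exists c : 'rV[F]_n, w = \sum_j c 0 j *: f j.
  elim=> [|b _ w' [j jn ->] _ [c ->]].
    by exists 0; rewrite big1 // => j _; rewrite mxE scale0r.
  exists (b *: delta_mx 0 (Ordinal jn) + c).
  under [RHS]eq_bigr do rewrite !mxE eqxx /= scalerDl.
  rewrite big_split; congr (_ + _); rewrite (bigD1 (Ordinal jn)) //= eqxx mulr1.
  by rewrite big1 ?addr0 // => i /negPf ij; rewrite ij mulr0 scale0r.
have {}coefs i := cid (coefs _ (uf i)).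
pose A := \matrix_i projT1 (coefs i).
have : kermx A != 0.
  rewrite kermx_eq0; apply: contraL nN => /eqP <-.
  by rewrite -leqNgt rank_leq_col.
move=> /rowV0Pn[c /sub_kermxP cA c0]; exists (fun i => c 0 i); split.
  by have /rV0Pn := c0.
have uE i : u i = \sum_j A i j *: f j.
  by rewrite {1}(projT2 (coefs i)); apply: eq_bigr => j _; rewrite mxE.
under eq_bigr do rewrite uE scaler_sumr.
rewrite exchange_big /= big1 // => j _.
under eq_bigr do rewrite scalerA.
rewrite -scaler_suml; have /rowP/(_ j) := cA; rewrite !mxE => ->.
by rewrite scale0r.
Qed.

(* Uncountably many resolvents cannot be independent in a space of countable
   dimension. *)
Lemma resolvent_annihilator (R : realType) (M : lmodType R[i]) (z : M -> M)
    (f : nat -> M) v :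
  (forall c u w, z (c *: u + w) = c *: z u + z w) ->
  (forall u, exists n, lspan (fun w => exists2 j, (j < n)%N & w = f j) u) ->
  (forall a : R[i], exists u, z u - a *: u = v) ->
  exists2 p : {poly R[i]}, p != 0 & poly_act z p v = 0.
Proof.
move=> z_lin f_span res.
(* Real points are enough. Some [m] bounds the number of generators needed at infinitely many of
   them, and [m + 1] of these solutions are dependent. *)
pose u (a : R) := projT1 (cid (res (a%:C)%C)).
have uP a : z (u a) - (a%:C)%C *: u a = v by rewrite /u; case: cid.
pose n a := projT1 (cid (f_span (u a))).
have nP a : lspan (fun w => exists2 j, (j < n a)%N & w = f j) (u a).
  by rewrite /n; case: cid.
have [m Hm] := infinite_fibre n; have [s [us ss sm]] := Hm m.+1.
have tP (i : 'I_m.+1) : s`_i \in s by rewrite mem_nth // ss.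
have [|c [c0 dep]] := @finite_span_dependent _ M m m.+1 f (fun i => u s`_i) (ltnSn _).
  by move=> i; have := nP s`_i; rewrite sm.
apply: (resolvent_dependence z_lin (a := fun i : 'I_m.+1 => (s`_i)%:C%C) _ _ c0 dep) => // i j.
move=> [] /eqP; rewrite nth_uniq ?ss // => /eqP; exact: val_inj.
Qed.

Lemma lspan_degree (F : fieldType) (M : lmodType F) (I : eqType) (G : I -> M -> Prop)
    (S : M -> Prop) i v :
  grading G -> (forall u, S u -> exists j, G j u) -> G i v -> lspan S v ->
  lspan (fun u => S u /\ G i u) v.
Proof.
move=> Ggr SG Gv Sv; have [hG _ _] := Ggr.
have [u Su hu] : exists2 u, lspan (fun u => S u /\ G i u) u &
    lspan (fun u => exists2 j, j != i & G j u) (v - u).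
  elim: Sv => [|c x w Sx _ [u hu hw]]; first by exists 0; rewrite ?subr0; apply: lspan0.
  have [j Gx] := SG x Sx; have [ji|ji] := eqVneq j i.
    exists (c *: x + u); first by apply: lspan_cons => //; rewrite -ji.
    by rewrite opprD addrACA subrr add0r.
  by exists u => //; rewrite -addrA; apply: lspan_cons => //; exists j.
suff /eqP : v - u = 0 by rewrite subr_eq0 => /eqP ->.
apply: (grading_disjoint hG Ggr _ hu); apply: (subspaceB (hG i)) => //.
by move: Su; apply: (lspan_least (hG i)) => w [].
Qed.

Lemma bihomogeneous_exists (F : fieldType) (M : lmodType F) (par : bool -> M -> Prop)
    (deg : int -> M -> Prop) m v :
  grading par -> grading deg -> (forall p, homogeneous_subspace deg (par p)) ->
  deg m v -> v != 0 -> exists u, [/\ u != 0, deg m u & exists p, par p u].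
Proof.
move=> pgr dgr phom dv v0; have [hpar _ _] := pgr; have [hdeg _ _] := dgr.
apply/not_existsP => H; case/eqP: v0.
have vS : lspan (fun u => (exists p, par p u) /\ exists i, deg i u) v.
  apply: lspan_sub (grading_span pgr v) => u [p pu].
  apply: lspan_sub (homogeneous_lspan (phom p) pu) => w [pw dw].
  by apply: lspan_gen; split=> //; exists p.
have := lspan_degree dgr (fun u (hu : _ /\ exists i, deg i u) => hu.2) dv vS.
apply: (lspan_least (P := fun u => u = 0)) => [|u [[pu _] du]].
  by split=> [//|c u w -> ->]; rewrite scaler0 addr0.
by apply/eqP/negPn/negP => u0; apply: (H u).
Qed.

Section TriangularParts.
Variables (F : numClosedFieldType) (g : lieSuperalgebra F) (h nm np : {vspace g}).
Hypothesis km : kac_moody h.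
Hypothesis triangular : triangular_decomposition h nm np.
Local Notation wv := (@weight_vector F g h).

(** Root vectors positive on [t0] lie in [np], negative ones in [nm], and together with [h] they
    span [g]; directness of the sum makes [np] and [nm] no larger than these spans. *)
Lemma triangular_lists : exists ps ns : seq g,
  [/\ polycentral ps /\ polycentral ns,
      forall y, y \in ps ++ ns -> exists p (mu : weight h), wv p mu y /\ mu != 0,
      np = <<ps>>%VS, nm = <<ns>>%VS
    & forall p (mu : weight h) x, wv p mu x -> [\/ x \in h, x \in np | x \in nm]].
Proof.
have [h_even h_abel] := kac_moody_cartan km.
have [wv_span wv_zero] := kac_moody_weights km.
have [full direct [t0 ht]] := triangular.
have [ps [psP ps_span ps_pc]] := polycentral_exists h_even wv_span t0.
have [ns [nsP ns_span ns_pc]] := polycentral_exists h_even wv_span (- t0).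
have cases p (mu : weight h) x : wv p mu x ->
    [\/ x \in h, (x \in np /\ x \in <<ps>>%VS) | (x \in nm /\ x \in <<ns>>%VS)].
  move=> wx; have [xp hx] := wx.
  have [->|x0] := eqVneq x 0; first by apply: Or31; rewrite mem0v.
  have [mu0|mu0] := eqVneq mu 0; first by apply/Or31/wv_zero; rewrite -mu0.
  have [|[pos /(_ x hx) xn]|[neg /(_ x hx) xn]] := ht mu.
  - by split=> //; exists x; rewrite memvf.
  - by apply: Or32; split=> //; apply: ps_span; exists p, mu.
  - apply: Or33; split=> //; apply: ns_span; exists p, mu; split=> //.
    by rewrite linearN oppr_gt0.
have dec x : exists a b c, [/\ a \in np /\ a \in <<ps>>%VS, b \in h,
    c \in nm /\ c \in <<ns>>%VS & x = c + b + a].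
  elim: (wv_span x) => [|e u v [p [mu wu]] _ [a [b [c [[a1 a2] bh [c1 c2] ->]]]]].
    by exists 0, 0, 0; rewrite !mem0v !addr0.
  case: (cases _ _ _ wu) => [uh|[u1 u2]|[u1 u2]].
  - exists a, (e *: u + b), c; split=> //; first by rewrite memvD ?memvZ.
    by rewrite !addrA; congr (_ + _); rewrite -addrA addrCA addrA.
  - exists (e *: u + a), b, c; rewrite !memvD ?memvZ //; split=> //.
    by rewrite addrCA.
  - exists a, b, (e *: u + c); rewrite !memvD ?memvZ //; split=> //.
    by rewrite !addrA.
move: direct; rewrite directv_addE => /and3P[direct2 _ /eqP /= cap].
move: direct2; rewrite directv_addE => /and3P[_ _ /eqP /= cap2].
exists ps, ns; split=> //.
- move=> y; rewrite mem_cat => /orP[/psP|/nsP] [p [mu [wy y0 mu0]]]; exists p, mu; split=> //;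
    by apply: contraTneq mu0 => ->; rewrite zero_lfunE ltxx.
- apply/eqP; rewrite eqEsubv; apply/andP; split; apply/subvP => x xn; last first.
    apply: (span_ind (P := fun x => x \in np)) xn => [|y /psP[p [mu [wy y0 mu0]]]].
      by split=> [|e u v u0 v0]; rewrite ?mem0v // memvD ?memvZ.
    have [|[_ /(_ y wy.2)//]|[neg _]] := ht mu.
      split; first by apply: contraTneq mu0 => ->; rewrite zero_lfunE ltxx.
      by exists y; rewrite memvf; have [] := wy.
    by have := lt_trans mu0 neg; rewrite ltxx.
  have [a [b [c [[a1 a2] bh [c1 c2] xE]]]] := dec x.
  suff /eqP : x - a = 0 by rewrite subr_eq0 => /eqP ->.
  apply/eqP; rewrite -memv0 -cap memv_cap; apply/andP; split; last exact: memvB.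
  by rewrite xE addrK memv_add.
- apply/eqP; rewrite eqEsubv; apply/andP; split; apply/subvP => x xn; last first.
    apply: (span_ind (P := fun x => x \in nm)) xn => [|y /nsP[p [mu [wy y0 mu0]]]].
      by split=> [|e u v u0 v0]; rewrite ?mem0v // memvD ?memvZ.
    have {}mu0 : (mu t0 : F) < 0 by move: mu0; rewrite linearN oppr_gt0.
    have [|[pos _]|[_ /(_ y wy.2)//]] := ht mu.
      split; first by apply: contraTneq mu0 => ->; rewrite zero_lfunE ltxx.
      by exists y; rewrite memvf; have [] := wy.
    by have := lt_trans mu0 pos; rewrite ltxx.
  have [a [b [c [[a1 a2] bh [c1 c2] xE]]]] := dec x.
  have a0 : a = 0.
    apply/eqP; rewrite -memv0 -cap memv_cap a1 andbT.
    have -> : a = (x - c) - b by rewrite xE -addrA -opprD [_ + a]addrC addrK.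
    apply: memvB; last exact: (subvP (addvSr nm h)).
    by apply: (subvP (addvSl nm h)); apply: memvB.
  have b0 : b = 0.
    apply/eqP; rewrite -memv0 -cap2 memv_cap bh andbT.
    have -> : b = x - c by rewrite xE a0 addr0 [c + _]addrC addrK.
    by rewrite memvB.
  by rewrite xE a0 b0 !addr0.
- move=> p mu x wx; case: (cases _ _ _ wx) => [?|[? _]|[? _]].
  + exact: Or31.
  + exact: Or32.
  + exact: Or33.
Qed.

End TriangularParts.

(** * Singular and highest weight vectors of lowest energy *)

Section LowestEnergy.
Variables (R : realType) (g : lieSuperalgebra R[i]) (h nm np : {vspace g}).
Variables (B : g -> g -> R[i]) (k : R[i]) (V : vertexSuperalgebra R[i]).
Variables (iota : {linear g -> V}).
Hypothesis km : kac_moody h.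
Hypothesis triangular : triangular_decomposition h nm np.
Hypothesis B_inv : invariant_form B.
Hypothesis iota_par : forall p a, a \in lsa_par g p -> va_par p (iota a).
Hypothesis power_eq0 : forall (gam : weight h) x, gam != 0 -> weight_vector false gam x ->
  exists N, iter N (fun u => va_prod (iota x) (-1) u) (va_vac V) = 0.
Variables (M : lmodType R[i]) (par : bool -> M -> Prop) (deg : int -> M -> Prop).
Variables (act : g -> int -> M -> M) (Y : V -> int -> M -> M).
Hypothesis hM : affine_module B k par act.
Hypothesis actionY : va_action (@va_par _ V) (@va_prod _ V) Y (va_vac V) par.
Hypothesis actE : forall a n v, Y (iota a) n v = act a n v.
Hypothesis energy : positive_energy par deg act.
Variable m0 : int.
Hypothesis lowest : forall m v, m < m0 -> deg m v -> v = 0.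
Local Notation br := (@lsa_br _ g).
Local Notation wv := (@weight_vector _ g h).
Local Notation T := (deg m0).
Local Notation homogeneous v := (exists p, par p v).

Let h_even := (kac_moody_cartan km).1.
Let h_abel := (kac_moody_cartan km).2.
Let wv_span := (kac_moody_weights km).1.
Let wv_zero := (kac_moody_weights km).2.

Lemma deg_grading : grading deg. Proof. by case: energy. Qed.

Lemma deg_subspace m : subspace (deg m). Proof. by case: deg_grading. Qed.

Lemma deg_act a j m v : deg m v -> deg (m - j) (act a j v).
Proof. by case: energy => _ _ H _; apply: H. Qed.

Lemma lowest_act0 a n v : 1 <= n -> T v -> act a n v = 0.
Proof. by move=> n1 Tv; apply: (lowest (m := m0 - n)); [lia|apply: deg_act]. Qed.

Lemma lowest_act a v : T v -> T (act a 0 v).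
Proof. by move=> Tv; have := deg_act a 0 Tv; rewrite subr0. Qed.

Lemma root_mode_comm (gam : weight h) x m n v : gam != 0 -> wv false gam x ->
  act x m (act x n v) = act x n (act x m v).
Proof.
move=> g0 [xe hx]; have xx : br x x = 0 by apply: br_self_even => //; rewrite pnatr_eq0.
have Bxx : B x x = 0.
  have [t] := weight_neqP g0; rewrite zero_lfunE => t0.
  have : gam t * B x x = 0.
    have [Bl Bs _ Bi _] := B_inv.
    have B0 y : B 0 y = 0.
      have := Bl 1 0 0 y; rewrite scaler0 addr0 mul1r => /eqP.
      by rewrite -subr_eq subrr eq_sym => /eqP.
    have BZ c y z : B (c *: y) z = c * B y z by rewrite -[c *: y]addr0 Bl B0 addr0.
    rewrite -[gam t]/(weight_eval gam t) -BZ -hx Bi xx.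
    by rewrite (Bs false false) ?mem0v ?vsval_even // B0 mulr0.
  by move=> /eqP; rewrite mulf_eq0 [gam t == 0](negPf t0) => /eqP.
rewrite (act_comm hM _ _ _ xe xe) xx (act0l hM) Bxx mulr0 mul0r if_same scale0r.
by rewrite !addr0 scale1r.
Qed.

Lemma root_mode_nilpotent (gam : weight h) x (i : nat) : gam != 0 -> wv false gam x ->
  exists L, forall v, (forall j : int, 0 < j -> act x j v = 0) ->
    iter L (act x (- i%:Z)) v = 0.
Proof.
move=> g0 wx; have [N power0] := power_eq0 g0 wx; have [xe _] := wx.
have [|L HL] := mode_nilpotent actionY (iota_par xe) _ power0 i.
  by move=> m n v; rewrite !actE; apply: root_mode_comm g0 wx.
exists L => v kv; rewrite -[RHS](HL 0 v) => [|j j0]; last by rewrite actE kv.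
by apply: eq_iter => u; rewrite actE sub0r.
Qed.

Lemma zero_mode_nilpotent p (mu : weight h) y : mu != 0 -> wv p mu y ->
  exists N, forall v, T v -> iter N (act y 0) v = 0.
Proof.
have even (nu : weight h) x : nu != 0 -> wv false nu x ->
    exists N, forall v, T v -> iter N (act x 0) v = 0.
  move=> nu0 wx; have [L HL] := root_mode_nilpotent 0 nu0 wx; exists L => v Tv.
  by apply: HL => j j0; apply: lowest_act0.
move=> mu0 wy; case: p wy => wy; last exact: even wy.
have [yo _] := wy.
have mumu0 : mu + mu != 0.
  apply/eqP => E; have := @weight_mulIn _ _ h mu mu0 2%N 0%N.
  by rewrite mulr2n mulr0n E => /(_ erefl).
have [N HN] := even _ _ mumu0 (weight_vector_br h_even wy wy).
exists (N + N)%N => v Tv.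
have sq u : act (br y y) 0 u = 2%:R *: act y 0 (act y 0 u).
  have := zero_mode_comm hM u yo yo; rewrite expr1 scaleN1r => /eqP.
  by rewrite addrC -subr_eq opprK => /eqP <-; rewrite scaler_nat mulr2n.
have : iter N (act (br y y) 0) v = 2%:R ^+ N *: iter (N + N) (act y 0) v.
  elim: N {HN} => [|N IH]; first by rewrite scale1r.
  by rewrite iterS IH sq !(actZr hM) scalerA -exprS addSn addnS.
rewrite HN // => /esym/eqP; rewrite scaler_eq0 expf_eq0 pnatr_eq0 andbF => /eqP //.
Qed.

Definition singular_top p v :=
  [/\ T v, par p v & forall x, x \in np -> act x 0 v = 0].

Lemma singular_top_subspace p : subspace (singular_top p).
Proof.
split=> [|c u v [Tu pu uk] [Tv pv vk]].
  by split=> [||x _]; [apply: (deg_subspace _).1|apply: (par_subspace hM p).1|apply: (act0r hM)].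
split; [exact: (deg_subspace _).2|exact: (par_subspace hM p).2|move=> x xn].
by rewrite (act_linr hM) uk ?vk // scaler0 addr0.
Qed.

Lemma singular_top_exists v : T v -> v != 0 -> exists p u, singular_top p u /\ u != 0.
Proof.
move=> Tv v0; have [ps [ns [[ps_pc _] lw ps_span _ _]]] := triangular_lists km triangular.
have [_ phom _ _] := energy; have [pgr _ _ _ _] := hM.
have [w [w0 Tw wp]] := bihomogeneous_exists pgr deg_grading phom Tv v0.
have lw' y : y \in ps -> exists p (mu : weight h), wv p mu y /\ mu != 0.
  by move=> yp; apply: lw; rewrite mem_cat yp.
have [||u [Tu u0 [p up] uk]] := killed_vector_exists hM lowest_act ps_pc _ _ Tw w0 wp.
- by move=> y /lw'[p [mu [[yp _] _]]]; exists p.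
- move=> y u /lw'[p [mu [wy mu0]]] Tu.
  by have [N HN] := zero_mode_nilpotent mu0 wy; exists N; apply: HN.
exists p, u; split=> //; split=> // x; rewrite ps_span => xs.
apply: (span_ind (P := fun x => act x 0 u = 0)) xs => //.
by split=> [|c a b a0 b0]; rewrite ?(act0l hM) // (act_linl hM) a0 b0 scaler0 addr0.
Qed.

Lemma singular_top_vector p v : singular_top p v -> v != 0 -> singular_vector np act v.
Proof. by move=> [Tv _ vk] v0; split=> // x s s1; apply: lowest_act0. Qed.

Lemma cartan_comm t t' v : t \in h -> t' \in h ->
  act t 0 (act t' 0 v) = act t' 0 (act t 0 v).
Proof.
move=> th t'h; have te := subvP h_even _ th; have t'e := subvP h_even _ t'h.
by rewrite (zero_mode_comm hM _ te t'e) h_abel // (act0l hM) addr0 scale1r.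
Qed.

Lemma singular_top_cartan p t v : t \in h -> singular_top p v -> singular_top p (act t 0 v).
Proof.
move=> th [Tv pv vk]; have te := subvP h_even _ th; split; first exact: lowest_act.
  exact: (act_par hM 0 te pv).
have [ps [ns [_ lw ps_span _ _]]] := triangular_lists km triangular.
move=> x; rewrite ps_span; apply: (span_ind (P := fun x => act x 0 (act t 0 v) = 0)).
  by split=> [|c a b a0 b0]; rewrite ?(act0l hM) // (act_linl hM) a0 b0 scaler0 addr0.
move=> y yps; have [|q [mu [[yq hy] _]]] := lw y; first by rewrite mem_cat yps.
have yn : y \in np by rewrite ps_span memv_span.
have := zero_mode_comm hM v te yq.
rewrite (vk y yn) (act0r hM) scale1r; have [t' ->] := subvs_exists th.
by rewrite hy (actZl hM) (vk y yn) scaler0 addr0 => /esym.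
Qed.

Lemma linear_factors_singular p t q v : t \in h -> singular_top p v ->
  singular_top p (linear_factors act t q v).
Proof.
move=> th sv; elim: q => //= c q IH.
apply: (subspaceB (singular_top_subspace p)); first exact: singular_top_cartan.
exact: (subspaceZ (singular_top_subspace p)).
Qed.

Lemma linear_factors_cartan t t' q v : t \in h -> t' \in h ->
  act t' 0 (linear_factors act t q v) = linear_factors act t q (act t' 0 v).
Proof.
move=> th t'h; elim: q => //= c q IH.
by rewrite (actDr hM) -scaleNr (actZr hM) scaleNr cartan_comm // IH.
Qed.

Definition cartan_words v := mode_word act (fun a n => n = 0 /\ a \in h) (fun u => u = v).

Lemma cartan_words_singular p v u : singular_top p v -> cartan_words v u -> singular_top p u.
Proof.
by move=> sv; elim=> [_ ->//|q a n {}u _ [-> ah] _]; apply: singular_top_cartan.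
Qed.

(** Two layers, Cartan words inside and lowering modes outside, mirror the triangular decomposition,
    so that the part of lowest degree consists of zero modes of [nm] on Cartan words. *)
Definition lowering_words v :=
  mode_word act (fun a n => n < 0 \/ (n = 0 /\ a \in nm)) (cartan_words v).

Lemma lowering_words_stable p v : singular_top p v -> act_stable act (lspan (lowering_words v)).
Proof.
move=> sv; have [_ [_ [_ _ _ _ cases]]] := triangular_lists km triangular.
have hS := lspan_subspace (lowering_words v).
apply: (mode_word_stable hM) => w a n hw; have [Tw _ wk] := cartan_words_singular sv hw.
move: (wv_span a); move: a; apply: lspan_least; first exact: (subspace_actl hM).
move=> a [q [mu wa]]; have [aq _] := wa.
have [n1|] := leP 1 n; first by rewrite lowest_act0 //; apply: hS.1.
have [n0 _|n0 n1] := ltP n 0.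
  by apply: lspan_gen; apply: (mode_word_step aq); [left|apply: mode_word_base].
have -> : n = 0 by lia.
case: (cases _ _ _ wa) => [ah|an|an].
- by apply: lspan_gen; apply: mode_word_base; apply: (mode_word_step aq).
- by rewrite wk //; apply: hS.1.
by apply: lspan_gen; apply: (mode_word_step aq); [right|apply: mode_word_base].
Qed.

Lemma lowering_words_par p v u : singular_top p v -> lowering_words v u -> homogeneous u.
Proof.
move=> sv; apply: (mode_word_par hM) => w hw; exists p.
by have [] := cartan_words_singular sv hw.
Qed.

(** A word is either an ordered combination in lowest degree or has degree above [m0], where it
    stays under lowering modes; projecting to degree [m0] discards the second kind. *)
Lemma lowering_words_lowest p v u ns : singular_top p v -> nm = <<ns>>%VS ->
  polycentral ns -> (forall y, y \in ns -> exists q, y \in lsa_par g q) ->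
  T u -> lspan (lowering_words v) u -> ordered_span act ns (lspan (cartan_words v)) u.
Proof.
move=> sv nmE ns_pc ns_hom Tu uS; set W := lspan (cartan_words v).
have WT w : W w -> T w.
  by move: w; apply: (lspan_least (deg_subspace _)) => w /(cartan_words_singular sv)[].
have hW : subspace (ordered_span act ns W) by apply/ordered_span_subspace/lspan_subspace.
have oT w : ordered_span act ns W w -> T w.
  by apply: (ordered_span_T (deg_subspace m0) (fun a v => @lowest_act a v)).
have dich w : lowering_words v w -> ordered_span act ns W w \/ exists2 m, m0 < m & deg m w.
  elim=> [x xw|q a n x aq [n0|[-> an]] _ IH].
  - by left; apply/ordered_span_base/lspan_gen.
  - right; case: IH => [/oT Tx|[m mm0 dx]].
      by exists (m0 - n); [lia|apply: deg_act].
    by exists (m - n); [lia|apply: deg_act].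
  case: IH => [ox|[m mm0 dx]]; last by right; exists m => //; have := deg_act a 0 dx; rewrite subr0.
  left; apply: (ordered_span_stable hM) ox => //; first exact: lspan_subspace.
  by rewrite -nmE.
have := lspan_degree deg_grading _ Tu uS; move=> H.
have {H} : lspan (fun w => lowering_words v w /\ T w) u.
  by apply: H => w /dich[/oT|[m _ dw]]; [exists m0|exists m].
apply: (lspan_least hW) => w [/dich[//|[m mm0 dw]] Tw].
have -> : w = 0; last exact: hW.1.
apply: (grading_disjoint deg_subspace deg_grading Tw).
by apply: lspan_gen; exists m => //; rewrite gt_eqF.
Qed.

Hypothesis irreducible : irreducible_module par act.

Lemma irreducible_full (S : M -> Prop) v : act_stable act (lspan S) ->
  (forall u, S u -> homogeneous u) -> lspan S v -> v != 0 -> forall u, lspan S u.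
Proof.
move=> stS Sp Sv v0; have [_ irr] := irreducible.
have [all0|//] := irr _ stS (lspan_homogeneous (fun p => par_subspace hM p) Sp).
by rewrite (all0 v Sv) eqxx in v0.
Qed.

Lemma lowering_words_full p v : singular_top p v -> v != 0 ->
  forall u, lspan (lowering_words v) u.
Proof.
move=> sv v0; apply: irreducible_full (lowering_words_stable sv) _ _ v0.
  by move=> u; apply: lowering_words_par sv.
by apply: lspan_gen; apply: mode_word_base; apply: mode_word_base.
Qed.


Lemma ns_exists : exists ns : seq g,
  [/\ nm = <<ns>>%VS, polycentral ns,
      forall y, y \in ns -> exists q, y \in lsa_par g q
    & forall y, y \in ns -> (exists N, forall v, T v -> iter N (act y 0) v = 0) /\
        exists p (mu : weight h), wv p mu y].
Proof.
have [ps [ns [[_ ns_pc] lw _ nmE _]]] := triangular_lists km triangular.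
have lw' y : y \in ns -> exists p (mu : weight h), wv p mu y /\ mu != 0.
  by move=> yn; apply: lw; rewrite mem_cat yn orbT.
exists ns; split=> // y /lw'[p [mu [wy mu0]]]; first by exists p; have [] := wy.
by split; [apply: (zero_mode_nilpotent mu0 wy)|exists p, mu].
Qed.

Lemma lowest_space_span p v : singular_top p v -> v != 0 ->
  exists ns : seq g, [/\ nm = <<ns>>%VS, polycentral ns,
      forall y, y \in ns -> (exists N, forall v, T v -> iter N (act y 0) v = 0) /\
        exists p (mu : weight h), wv p mu y
    & forall u, T u -> ordered_span act ns (lspan (cartan_words v)) u].
Proof.
move=> sv v0; have [ns [nmE ns_pc ns_hom ns_nil]] := ns_exists.
exists ns; split=> // u Tu; apply: (lowering_words_lowest sv) => //.
exact: (lowering_words_full sv v0).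
Qed.

(** Words in modes of a finite basis of [g], applied to one nonzero homogeneous vector, are indexed
    by the countable type [seq (nat * int)]. *)
Lemma countable_span : exists f : nat -> M,
  forall u, exists n, lspan (fun w => exists2 j, (j < n)%N & w = f j) u.
Proof.
have [[v v1] _] := irreducible.
have [pgr _ _ _ _] := hM.
have [p [w [w0 pw]]] : exists p w, w != 0 /\ par p w.
  apply/not_existsP => H; case/eqP: v1.
  have /(_ v) := grading_span pgr; apply: (lspan_least (P := fun u => u = 0)).
    by split=> [//|c u u' -> ->]; rewrite scaler0 addr0.
  move=> u [p pu]; apply/eqP/negPn/negP => u0; apply: (H p); by exists u.
pose bs := (vbasis (lsa_par g false) : seq g) ++ vbasis (lsa_par g true).
have bs_hom y : y \in bs -> exists p, y \in lsa_par g p.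
  by rewrite mem_cat => /orP[]/vbasis_mem ?; eexists; eassumption.
have bs_span x : x \in <<bs>>%VS.
  by rewrite span_cat !(span_basis (vbasisP _)) lsa_par_sum memvf.
pose word (s : seq (nat * int)) := foldr (fun x u => act bs`_x.1 x.2 u) w s.
pose S u := exists s, u = word s.
have Sp u : S u -> homogeneous u.
  move=> [s ->]; elim: s => [|[i n] s [q hq]] /=; first by exists p.
  have [ib|ib] := ltnP i (size bs); last first.
    by rewrite nth_default // (act0l hM); exists false; apply: (par_subspace hM false).1.
  have [r hr] := bs_hom _ (mem_nth 0 ib); exists (r (+) q); exact: (act_par hM n hr hq).
have stS : act_stable act (lspan S).
  have hS := lspan_subspace S; split=> // a n; apply: lspan_least.
    exact: (subspace_act hM).
  move=> _ [s ->]; apply: (span_ind (P := fun a => lspan S (act a n (word s)))) (bs_span a).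
    exact: (subspace_actl hM).
  by move=> y /(nthP 0)[i _ <-]; apply: lspan_gen; exists ((i, n) :: s).
have full := irreducible_full stS Sp (lspan_gen (ex_intro _ [::] erefl)) w0.
exists (fun n => if unpickle n is Some s then word s else 0) => u.
elim: (full u) => [|c _ u' [s ->] _ [n hn]]; first by exists 0%N; apply: lspan0.
exists (maxn n (pickle s).+1); apply: lspan_cons.
  by exists (pickle s); rewrite ?leq_maxr // pickleK.
apply: lspan_sub hn => _ [j jn ->]; apply: lspan_gen; exists j => //.
by apply: leq_trans jn (leq_maxl _ _).
Qed.

Lemma cartan_annihilator t p v : t \in h -> singular_top p v -> v != 0 ->
  exists q, linear_factors act t q v = 0.
Proof.
move=> th sv v0; have te := subvP h_even _ th.
have z_lin : forall c u w, act t 0 (c *: u + w) = c *: act t 0 u + act t 0 w.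
  by move=> c u w; apply: (act_linr hM).
have [res|/existsNP[a /forallNP na]] :=
    pselect (forall a, exists u, act t 0 u - a *: u = v).
  have [f f_span] := countable_span.
  have [pol pol0 pv] := resolvent_annihilator z_lin f_span res.
  have [rs polE] := closed_field_poly_normal pol.
  exists rs; have : poly_act (act t 0) (lead_coef pol *: \prod_(x <- rs) ('X - x%:P)) v
      = lead_coef pol *: linear_factors act t rs v.
    have E u : poly_act (act t 0) (\prod_(x <- rs) ('X - x%:P)) u = linear_factors act t rs u.
      elim: (rs) u => [|x r IH] u; first by rewrite big_nil poly_act1.
      rewrite big_cons mulrC (poly_act_mulXsub z_lin) IH /=.
      by rewrite (linear_factors_act hM) addrC -scaleNr (linear_factors_lin hM) scaleNr addrC.
    have := poly_act_linl (act t 0) (lead_coef pol) (\prod_(x <- rs) ('X - x%:P)) 0 v.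
    by rewrite addr0 => ->; rewrite E /poly_act size_poly0 big_ord0 addr0.
  rewrite -polE pv => /esym/eqP; rewrite scaler_eq0 lead_coef_eq0 (negPf pol0).
  by move=> /eqP.
have [ns [nmE ns_pc ns_hom ns_nil]] := ns_exists.
have ns_fac y : y \in ns ->
   (exists N, forall v, T v -> iter N (act y 0) v = 0) /\
   exists d, forall v, act t 0 (act y 0 v) = act y 0 (act t 0 v) + d *: act y 0 v.
  move=> yn; have [nil [q [mu [yq hy]]]] := ns_nil y yn; split=> //.
  have [t' tE] := subvs_exists th; exists (weight_eval mu t') => u.
  by rewrite (zero_mode_comm hM u te yq) scale1r tE hy (actZl hM).
(* If [q(t) v] were nonzero, it would be singular and generate the module; [v] would be an ordered
   combination over it, hence lie in the image of [t - a], against the choice of [a]. *)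
have [q Hq] := ordered_span_factor hM (deg_subspace m0) lowest_act [:: a] ns_fac.
exists q; apply/eqP/negPn/negP => w0.
have sw := linear_factors_singular q th sv.
have [Tv _ _] := sv.
have : ordered_span act ns (lspan (cartan_words (linear_factors act t q v))) v.
  by apply: (lowering_words_lowest sw) => //; apply: (lowering_words_full sw w0).
move=> hv; have [|u /= vE] := Hq v _; last by apply: (na u); rewrite vE.
apply: ordered_span_mono hv => u.
have hW : subspace (fun u => T u /\ exists w, u = linear_factors act t q w).
  apply: subspaceI; first exact: deg_subspace.
  split=> [|c _ _ [u1 ->] [u2 ->]].
    by exists 0; rewrite (lin_zero (linear_factors_lin hM t q)).
  by exists (c *: u1 + u2); rewrite (linear_factors_lin hM).
apply: (lspan_least hW) => {}u hu; split; first by have [] := cartan_words_singular sw hu.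
elim: hu => [_ ->|r b n {}u _ [-> bh] _ [w ->]]; first by eexists.
by rewrite (linear_factors_cartan _ _ th bh); eexists.
Qed.

(** Removing linear factors one by one until the product no longer kills [u] gives an eigenvector of
    [t]. Eigenvectors of the previous elements remain such, since [h] acts by commuting
    operators. *)
Lemma cartan_eigenvector p v (ts : seq g) : singular_top p v -> v != 0 ->
  (forall t, t \in ts -> t \in h) ->
  exists u, [/\ singular_top p u, u != 0 &
    forall t, t \in ts -> exists c, act t 0 u = c *: u].
Proof.
move=> sv v0; elim: ts => [|t ts IH] tsh; first by exists v.
have [|u [su u0 eu]] := IH; first by move=> t' t's; apply: tsh; rewrite inE t's orbT.
have th : t \in h by apply: tsh; rewrite mem_head.
have [q] := cartan_annihilator th su u0; elim: q => [|c q IHq] /= qu.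
  by rewrite qu eqxx in u0.
have [w0|w0] := eqVneq (linear_factors act t q u) 0; first exact: IHq.
exists (linear_factors act t q u); split=> //; first exact: linear_factors_singular.
move=> t'; rewrite inE => /orP[/eqP->|t's].
  by exists c; apply/eqP; rewrite -subr_eq0 qu.
have [c' t'u] := eu t' t's; exists c'.
rewrite linear_factors_cartan //; last by apply: tsh; rewrite inE t's orbT.
rewrite t'u -[c' *: u]addr0 (linear_factors_lin hM).
by rewrite (lin_zero (linear_factors_lin hM t q)) addr0.
Qed.

Lemma highest_weight_exists : (exists2 v, T v & v != 0) ->
  exists v p (la : weight h), [/\ singular_top p v, v != 0 &
    forall t : subvs_of h, act (vsval t) 0 v = weight_eval la t *: v].
Proof.
move=> [v Tv v0]; have [p [u [su u0]]] := singular_top_exists Tv v0.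
pose b := vbasis {:subvs_of h}.
have [|w [sw w0 ew]] := cartan_eigenvector (ts := map vsval b) su u0.
  by move=> _ /mapP[t _ ->]; apply: subvsP.
have ew' (i : 'I_(\dim {:subvs_of h})) : exists c, act (vsval b`_i) 0 w = c *: w.
  by apply/ew/map_f/mem_nth; rewrite size_tuple.
pose c i := projT1 (cid (ew' i)).
have cE (i : 'I_(\dim {:subvs_of h})) : act (vsval b`_i) 0 w = c i *: w.
  by rewrite /c; case: cid.
pose la : weight h := \sum_i c i *: linfun (coord b i : subvs_of h -> R[i]^o).
exists w, p, la; split=> // t.
have -> : vsval t = \sum_i coord b i t *: vsval b`_i.
  rewrite {1}(coord_vbasis (memvf t)) linear_sum; apply: eq_bigr => i _.
  by rewrite linearZ.
rewrite (big_morph (fun a => act a 0 w) (fun a a' => actDl hM 0 a a' w) (act0l hM 0 w)).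
rewrite /weight_eval sum_lfunE scaler_suml; apply: eq_bigr => i _.
by rewrite (actZl hM) cE scalerA scale_lfunE lfunE mulrC.
Qed.

(** * Integrability of the highest weight module *)

Section HighestWeight.
Variables (v : M) (pv : bool) (la : weight h).
Hypothesis v_sing : singular_top pv v.
Hypothesis v_neq0 : v != 0.
Hypothesis v_weight : forall t : subvs_of h, act (vsval t) 0 v = weight_eval la t *: v.

Definition weight_words :=
  mode_word act (fun a _ => exists p (mu : weight h), wv p mu a) (fun u => u = v).

Lemma weight_words_full u : lspan weight_words u.
Proof.
have [Tv pvv _] := v_sing; move: u.
apply: (irreducible_full (v := v)) => //.
- have hS := lspan_subspace weight_words.
  apply: (mode_word_stable hM) => _ a n ->.
  move: (wv_span a); move: a; apply: lspan_least; first exact: (subspace_actl hM).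
  move=> a [p [mu wa]]; have [ap _] := wa.
  by apply: lspan_gen; apply: (mode_word_step ap); [exists p, mu|apply: mode_word_base].
- by move=> u; apply: (mode_word_par hM) => _ ->; exists pv.
- by apply: lspan_gen; apply: mode_word_base.
Qed.

(** [P] may fail to be homogeneous for parity, so irreducibility does not apply to it directly; it
    contains all words on [v], which already span. *)
Lemma highest_vector_generates (P : M -> Prop) : act_stable act P -> P v -> forall u, P u.
Proof.
move=> stP Pv u; apply: (mode_word_sub stP _ (weight_words_full u)).
by move=> _ ->.
Qed.

Lemma cartan_weight t u (mu nu : weight h) n a p :
  wv p mu a -> (forall t : subvs_of h, act (vsval t) 0 u = weight_eval nu t *: u) ->
  act (vsval t) 0 (act a n u) = weight_eval (mu + nu) t *: act a n u.
Proof.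
move=> [ap ha] hu.
rewrite (act_comm hM _ _ _ (vsval_even h_even t) ap) expr0 scale1r hu (actZr hM).
rewrite add0r ha (actZl hM) mulr0z !mul0r if_same scale0r addr0 -scalerDl.
by congr (_ *: _); rewrite /weight_eval add_lfunE addrC.
Qed.

Lemma weight_words_weight u : weight_words u ->
  (exists nu : weight h, forall t : subvs_of h, act (vsval t) 0 u = weight_eval nu t *: u) /\
  exists m, deg m u.
Proof.
have [Tv _ _] := v_sing; elim=> [_ ->|p a n {}u ap [q [mu wa]] _ [[nu hnu] [m dm]]].
  by split; [exists la|exists m0].
split; last by exists (m - n); apply: deg_act.
by exists (mu + nu) => t; apply: cartan_weight wa hnu.
Qed.

(** The vectors at which [act x s] is nilpotent form a submodule, as [ad x] is nilpotent; it
    contains [v], by the bound on the lowest space. *)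
Lemma root_mode_locally_nilpotent (gam : weight h) x s u : gam != 0 ->
  wv false gam x -> nilpotent_at (act x s) u.
Proof.
move=> g0 wx; have [xe _] := wx; have [Tv _ _] := v_sing.
have ad a : nilpotent_at (br x) a.
  move: (wv_span a); move: a; apply: lspan_least.
    by apply: nilpotent_at_subspace => c y z; rewrite brDr brZr.
  by move=> a [p [mu wa]]; have [N NE] := ad_nilpotent h_even wv_span g0 wx wa; exists N.
move: u; apply: highest_vector_generates.
  split; first by apply: nilpotent_at_subspace => c y z; apply: (act_linr hM).
  by move=> a n u; apply: (ad_nilpotent_stable hM).
have [s1|s0] := leP 1 s; first by exists 1%N; apply: lowest_act0.
have [L HL] := root_mode_nilpotent (absz s) g0 wx.
exists L; have -> : s = - (absz s)%:Z by lia.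
by apply: HL => j j0; apply: lowest_act0.
Qed.

(** Cartan words on [v] are multiples of [v], and each lowering letter occurs with bounded
    exponent. *)
Lemma lowest_space_finite : exists ws : seq M,
  forall u, T u -> lspan (fun w => w \in ws) u.
Proof.
have [ns [nmE ns_pc ns_nil ns_span]] := lowest_space_span v_sing v_neq0.
have [Tv _ _] := v_sing.
have cw u : cartan_words v u -> exists c, u = c *: v.
  elim=> [_ ->|p a n {}u _ [-> ah] _ [c ->]]; first by exists 1; rewrite scale1r.
  have [t ->] := subvs_exists ah; rewrite (actZr hM) v_weight scalerA.
  by eexists.
have [y yn|u||ws Hws] := @ordered_span_finite _ _ _ _ _ _ _ hM T (deg_subspace m0)
  lowest_act ns (lspan (cartan_words v)) [:: v].
- by have [] := ns_nil y yn.
- move: u; apply: (lspan_least (deg_subspace m0)) => u /cw[c ->].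
  exact: (subspaceZ (deg_subspace m0)).
- move=> u; apply: lspan_sub => w /cw[c ->]; apply: (subspaceZ (lspan_subspace _)).
  by apply: lspan_gen; rewrite mem_head.
by exists ws => u /ns_span/Hws.
Qed.

Definition raised_words :=
  mode_word act (fun _ n => n < 0) (fun u => T u /\ homogeneous u).

Lemma raised_words_full u : lspan raised_words u.
Proof.
have [Tv pvv _] := v_sing; move: u.
have hS := lspan_subspace raised_words.
have [pgr _ _ _ _] := hM; have [_ phom _ _] := energy.
have TS u : T u -> lspan raised_words u.
  move=> Tu; have : lspan (fun u => (exists p, par p u) /\ exists i, deg i u) u.
    apply: lspan_sub (grading_span pgr u) => w [p pw].
    apply: lspan_sub (homogeneous_lspan (phom p) pw) => x [px dx].
    by apply: lspan_gen; split=> //; exists p.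
  move=> /(lspan_degree deg_grading (fun w (hw : _ /\ exists i, deg i w) => hw.2) Tu).
  apply: lspan_sub => w [[pw _] Tw]; apply: lspan_gen; exact: mode_word_base.
apply: (irreducible_full (v := v)) => //; last exact: TS.
- apply: (mode_word_stable hM) => w a n [Tw pw].
  have [n1|] := leP 1 n; first by rewrite lowest_act0 //; apply: hS.1.
  have [n0 _|n0 n1] := ltP n 0; last first.
    by have -> : n = 0; [lia|apply/TS/lowest_act].
  move: a; apply: par_ind => [|p a ap]; first exact: (subspace_actl hM).
  by apply: lspan_gen; apply: (mode_word_step ap) => //; apply: mode_word_base.
- by move=> u; apply: (mode_word_par hM) => w [].
Qed.

Lemma graded_space_finite m : exists ws : seq M,
  forall u, deg m u -> lspan (fun w => w \in ws) u.
Proof.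
(* Peeling off the outermost letter [a t^-n] brings a word of energy [l > 0] down to [l - n]; with
   finitely many [n] and a finite basis of [g], induction on [l] gives finite spanning lists. *)
pose D (l : nat) u := deg (m0 + l%:Z) u /\ ((0 < l)%N -> exists a (n l' : nat) u',
  [/\ (0 < n)%N, l = (l' + n)%N, deg (m0 + l'%:Z) u' & u = act a (- n%:Z) u']).
have wordD u : raised_words u -> exists l, D l u.
  elim=> [w [Tw _]|p a n {}u _ n0 _ [l [dl _]]]; first by exists 0%N; split; rewrite ?addr0.
  exists (l + absz n)%N; split.
    by have := deg_act a n dl; congr deg; lia.
  move=> _; exists a, (absz n), l, u; split=> //; first by lia.
  by congr act; lia.
have degD u l : deg (m0 + l%:Z) u -> lspan (D l) u.
  move=> dl; have := lspan_degree deg_grading _ dl (raised_words_full u) => H.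
  apply: lspan_sub (H _) => [w [/wordD[l' Dl'] dw]|w /wordD[l' [dw _]]]; last first.
    by exists (m0 + l'%:Z).
  have [E|E] := eqVneq l' l; first by rewrite -E; apply: lspan_gen.
  have -> : w = 0; last exact: lspan0.
  apply: (grading_disjoint deg_subspace deg_grading dw).
  by apply: lspan_gen; exists (m0 + l'%:Z); [apply: contraNneq E; lia|have [] := Dl'].
have main l : exists ws : seq M, forall u, deg (m0 + l%:Z) u -> lspan (fun w => w \in ws) u.
  elim/ltn_ind: l => l IH; have [l0|l0] := posnP l.
    by have [ws Hws] := lowest_space_finite; exists ws => u; rewrite l0 addr0; apply: Hws.
  have [W HW] : exists W : nat -> seq M, forall j, (j < l)%N -> forall u,
      deg (m0 + j%:Z) u -> lspan (fun w => w \in W j) u.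
    have IH' j : exists ws : seq M, (j < l)%N -> forall u, deg (m0 + j%:Z) u ->
        lspan (fun w => w \in ws) u.
      have [jl|jl] := ltnP j l; last by exists [::].
      by have [ws Hws] := IH j jl; exists ws.
    by exists (fun j => projT1 (cid (IH' j))) => j; case: cid.
  pose ws := [seq act b.1 (- b.2%:Z) w |
    b <- [seq (y, n) | y <- vbasis {:g}, n <- seq.iota 1 l],
    w <- flatten [seq W j | j <- seq.iota 0 l]].
  have hS := lspan_subspace (fun w : M => w \in ws).
  exists ws => u /degD.
  apply: lspan_sub => _ [_ /(_ l0)[a [n [l' [u' [n0 lE du' ->]]]]]].
  have := HW l' ltac:(lia) u' du'; move: u' {du'}.
  apply: lspan_least; first exact: (subspace_act hM).
  move=> w ww; have : a \in <<vbasis {:g}>>%VS by rewrite (span_basis (vbasisP _)) memvf.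
  apply: (span_ind (P := fun a => lspan (fun w => w \in ws) (act a (- n%:Z) w))).
    exact: (subspace_actl hM).
  move=> y yb.
  apply: lspan_gen; apply/allpairsP; exists ((y, n), w); split=> //=.
    by apply/allpairsP; exists (y, n); split=> //=; rewrite mem_iota; lia.
  by apply/flattenP; exists (W l') => //; apply: map_f; rewrite mem_iota; lia.
have [m_lt|m_ge] := ltP m m0; first by exists [::] => u /(lowest m_lt) ->; apply: lspan0.
have [ws Hws] := main (absz (m - m0)%R); exists ws => u du.
by apply: Hws; move: du; congr deg; lia.
Qed.

Variable d : {linear M -> M}.
Hypothesis dE : forall m u, deg m u -> d u = - (m%:~R *: u).

Lemma eigenvector_sum u : exists ws : seq M, u = \sum_(w <- ws) w /\
  forall w, w \in ws -> (forall t, t \in h -> exists c, act t 0 w = c *: w) /\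
    exists c, d w = c *: w.
Proof.
elim: (weight_words_full u) => [|c w u' ww _ [ws [-> hws]]].
  by exists [::]; rewrite big_nil.
exists (c *: w :: ws); rewrite big_cons; split=> // w'; rewrite inE => /orP[/eqP->|/hws//].
have [[nu hnu] [m dm]] := weight_words_weight ww; split.
  move=> _ /subvs_exists[t ->]; exists (weight_eval nu t).
  by rewrite (actZr hM) hnu !scalerA mulrC.
by exists (- m%:~R); rewrite linearZ /= (dE dm) scaleNr scalerN !scalerA mulrC.
Qed.

Lemma lspan_in_span (ws : seq M) u : lspan (fun w => w \in ws) u <-> in_span ws u.
Proof.
split=> [|[c ->]]; last first.
  apply: (subspace_sum (lspan_subspace _)) => i _; apply: (subspaceZ (lspan_subspace _)).
  by apply: lspan_gen; rewrite mem_nth.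
move: u; apply: lspan_least => [|w /(nthP 0)[i iw <-]].
  split=> [|c _ _ [a ->] [b ->]].
    by exists (fun=> 0); rewrite big1 // => i _; rewrite scale0r.
  exists (fun i => c * a i + b i); rewrite scaler_sumr -big_split.
  by apply: eq_bigr => i _; rewrite scalerDl scalerA.
exists (fun j => (j == i)%:R); rewrite (bigD1 (Ordinal iw)) //= eqxx scale1r big1 ?addr0 //.
by move=> j /negPf ji; rewrite -[_ == i]/(j == Ordinal iw) ji scale0r.
Qed.

Lemma cartan_finite : cartan_locally_finite h act d.
Proof.
move=> u; have [ws [uE hws]] := eigenvector_sum u; exists ws.
have hS := lspan_subspace (fun w : M => w \in ws).
split.
- by apply/lspan_in_span; rewrite uE; apply: (subspace_sum_in hS) => w; apply: lspan_gen.
- move=> t w th /lspan_in_span ww; apply/lspan_in_span; move: w ww.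
  apply: lspan_least => [|w ww]; first exact: (subspace_act hM).
  have [/(_ t th)[c ->] _] := hws w ww; apply: (subspaceZ hS); exact: lspan_gen.
move=> w /lspan_in_span ww; apply/lspan_in_span; move: w ww.
apply: lspan_least => [|w ww].
  by apply: subspace_ker hS => c x y; rewrite linearP.
have [_ [c ->]] := hws w ww; apply: (subspaceZ hS); exact: lspan_gen.
Qed.

(** [(d - c) ^ N] multiplies the component of degree [i] by [(- i - c) ^ N], so only the degree
    [- c] can survive. Hence each generalized weight space sits in one graded piece, which is finite
    dimensional. *)
Lemma generalized_eigenvector_deg c u N :
  iter N (fun w => d w - c *: w) u = 0 -> u != 0 -> exists2 m : int, c = - m%:~R & deg m u.
Proof.
move=> Nu u0; have [hdeg [_ dgen] dind] := deg_grading.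
have [s [w [hw us uE]]] := dgen u Logic.I.
have iterE (r : seq int) : {subset r <= s} ->
    iter N (fun w => d w - c *: w) (\sum_(i <- r) w i)
    = \sum_(i <- r) (- i%:~R - c) ^+ N *: w i.
  move=> rs; elim: N {Nu} => [|N IH] /=; first by apply: eq_bigr => i _; rewrite scale1r.
  rewrite IH linear_sum scaler_sumr -sumrB !big_seq; apply: eq_bigr => i ir.
  rewrite linearZ /= (dE (hw i (rs i ir)).1) scalerN scalerA -scaleNr !scalerA -scalerBl.
  by rewrite exprS mulrBl mulNr [_ ^+ N * _]mulrC.
have w0 i : i \in s -> c != - i%:~R -> w i = 0.
  move=> si ci; have := dind s (fun i => (- i%:~R - c) ^+ N *: w i) us _ _ i si.
  have h1 j : j \in s -> deg j ((- j%:~R - c) ^+ N *: w j).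
    by move=> js; apply: (subspaceZ (hdeg j)); case: (hw j js).
  have h2 : \sum_(i <- s) (- i%:~R - c) ^+ N *: w i = 0 by rewrite -iterE // -uE.
  move=> /(_ h1 h2)/eqP; rewrite scaler_eq0 expf_eq0 subr_eq0 eq_sym (negPf ci) andbF.
  by move=> /eqP.
have [[m cm]|n] := pselect (exists m : int, c = - m%:~R).
  exists m => //; rewrite uE; apply: (subspace_sum_in (hdeg m)) => i si.
  have [E|im] := eqVneq i m; first by rewrite -E; case: (hw i si).
  rewrite w0 //; first exact: (hdeg m).1.
  by rewrite cm (inj_eq oppr_inj) eqr_int eq_sym.
case/eqP: u0; rewrite uE big_seq big1 // => i si; apply: w0 => //.
by apply/eqP => ci; apply: n; exists i.
Qed.

Lemma highest_weight_integrable : integrable h act d.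
Proof.
split; last 1 first.
- move=> la' c; have [[m cm]|n] := pselect (exists m : int, c = - m%:~R).
    have [ws Hws] := graded_space_finite m; exists ws => u [_ [N Nu]].
    apply/lspan_in_span; have [->|u0] := eqVneq u 0; first exact: lspan0.
    have [m' cm' du] := generalized_eigenvector_deg Nu u0; apply: Hws.
    suff -> : m = m' by [].
    by move/eqP: cm'; rewrite cm (inj_eq oppr_inj) eqr_int => /eqP.
  exists [::] => u [_ [N Nu]]; apply/lspan_in_span.
  have [->|u0] := eqVneq u 0; first exact: lspan0.
  by have [m cm _] := generalized_eigenvector_deg Nu u0; case: n; exists m.
- split=> [al x al0 xd hx s u|u].
    apply: (root_mode_locally_nilpotent s u al0); split=> //.
    exact: subvP (even_derived_even g) _ xd.
  have [ws [uE hws]] := eigenvector_sum u; exists ws => // w /hws[hw dw].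
  by split=> // t; rewrite memv_cap => /andP[th _]; apply: hw.
exact: cartan_finite.
Qed.

Lemma highest_weight_conclusion : highest_weight_module h np act d par.
Proof.
have [Tv pvv _] := v_sing; exists v, pv, la, (- m0%:~R); split=> //.
- exact: singular_top_vector v_sing v_neq0.
- by rewrite (dE Tv) scaleNr.
by move=> P stP Pv w; apply: highest_vector_generates.
Qed.

End HighestWeight.

End LowestEnergy.

(** * The simple quotient and the conclusion *)

Section SimpleQuotient.
Variables (F : numClosedFieldType) (g : lieSuperalgebra F) (B : g -> g -> F) (k : F).
Variables (U V : vertexSuperalgebra F) (iota : {linear g -> U}) (pi : {linear U -> V}).
Hypothesis universal : universal_affine_va B k iota.
Hypothesis quotient : simple_quotient pi.

Let iotaV : {linear g -> V} := pi \o iota.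

Lemma quotient_currents : currents B k iotaV.
Proof.
have [[pi_vac pi_prod pi_par pi_deg] _ _] := quotient.
have [[iota_par iota_deg iota_prod] _] := universal.
split=> [p a /iota_par/pi_par//|a|a b]; first exact/pi_deg/iota_deg.
have [e0 e1 e2] := iota_prod a b; split.
- by rewrite -pi_prod e0.
- by rewrite -pi_prod e1 linearZ /= pi_vac.
by move=> n n2; rewrite -pi_prod e2 ?linear0.
Qed.

Lemma quotient_generated v :
  lspan (all_words (fun a n (u : V) => va_prod (iotaV a) n u) (fun w => w = va_vac V)) v.
Proof.
have [[pi_vac pi_prod _ _] pi_surj _] := quotient.
have [u <-] := pi_surj v; move: u (universal_generated universal u).
apply: lspan_least => [|u].
  by apply: subspace_ker (lspan_subspace _) => c x y; rewrite linearP.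
elim=> [_ ->|p a n {}u ap _ _ IH].
  by rewrite pi_vac; apply: lspan_gen; apply: mode_word_base.
have hM : affine_module B k (@va_par F V) (fun a n (u : V) => va_prod (iotaV a) n u) :=
  currents_affine_module quotient_currents (va_par_grading V) (va_prod_action V).
rewrite pi_prod; exact: (mode_word_low hM ap).
Qed.

End SimpleQuotient.

Lemma lowest_degree_exists (F : numClosedFieldType) (g : lieSuperalgebra F)
    (M : lmodType F) (par : bool -> M -> Prop) (deg : int -> M -> Prop)
    (act : g -> int -> M -> M) (v : M) :
  positive_energy par deg act -> v != 0 ->
  exists m0 : int, (exists2 u, deg m0 u & u != 0) /\
    forall m u, m < m0 -> deg m u -> u = 0.
Proof.
move=> [dgr _ _ [b hb]] v0.
pose P n := `[< exists2 u, deg (b + n%:Z) u & u != 0 >].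
have exP : exists n, P n.
  have [m [u [du u0]]] : exists m u, deg m u /\ u != 0.
    apply/not_existsP => H; case/eqP: v0; move: (grading_span dgr v).
    apply: (lspan_least (P := fun u => u = 0)) v => [|u [m du]].
      by split=> [//|c u w -> ->]; rewrite scaler0 addr0.
    by apply/eqP/negPn/negP => u0; apply: (H m); exists u.
  exists (absz (m - b)%R); apply/asboolP; exists u => //.
  have mb : b <= m by rewrite leNgt; apply/negP => /hb/(_ du) u1; rewrite u1 eqxx in u0.
  by move: du; congr deg; lia.
case: (ex_minnP exP) => n /asboolP hn minn; exists (b + n%:Z); split=> // m u mn du.
apply/eqP/negPn/negP => u0; have mb : b <= m.
  by rewrite leNgt; apply/negP => /hb/(_ du) u1; rewrite u1 eqxx in u0.
suff /minn : P (absz (m - b)%R) by lia.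
by apply/asboolP; exists u => //; move: du; congr deg; lia.
Qed.

Theorem corollary6p5p1 (R : realType) (g : lieSuperalgebra R[i])
    (h nm np : {vspace g}) (B : g -> g -> R[i]) (k : nat)
    (U V : vertexSuperalgebra R[i])
    (iota : {linear g -> U}) (pi : {linear U -> V})
    (g_kac_moody : kac_moody h)
    (g_odd : lsa_par g true <> 0%VS)
    (g_triangular : triangular_decomposition h nm np)
    (g_connected : even_dynkin_connected h np)
    (B_normalized : normalized_form h B)
    (U_universal : universal_affine_va B k%:R iota)
    (V_simple_quotient : simple_quotient pi) :
  (forall (M : lmodType R[i]) (par : bool -> M -> Prop)
          (deg : int -> M -> Prop) (act : g -> int -> M -> M),
     simple_affine_module B k%:R iota pi par act ->
     positive_energy par deg act ->
     (exists v : M, v != 0) ->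
     exists v : M, singular_vector np act v)
  /\
  (forall (M : lmodType R[i]) (par : bool -> M -> Prop)
          (deg : int -> M -> Prop) (act : g -> int -> M -> M)
          (d : {linear M -> M}),
     simple_affine_module B k%:R iota pi par act ->
     positive_energy par deg act ->
     irreducible_module par act ->
     (forall m v, deg m v -> d v = - (m%:~R *: v)) ->
     integrable h act d /\ highest_weight_module h np act d par).

Proof.
have [B_inv _ _] := B_normalized.
have [_ _ V_simple] := V_simple_quotient.
have curr := quotient_currents U_universal V_simple_quotient.
have [iota_par _ _] := curr.
have power0 := current_power_eq0 g_kac_moody g_triangular g_connected B_normalized curr
  (quotient_generated U_universal V_simple_quotient) V_simple.
split=> [M par deg act [hM _ [Y [_ hY] YE]] energy [v v0]|
         M par deg act d [hM _ [Y [_ hY] YE]] energy irr dE].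
  have [m0 [[u Tu u0] low]] := lowest_degree_exists energy v0.
  have [p [w [sw w0]]] := singular_top_exists g_kac_moody g_triangular B_inv
    iota_par power0 hM hY YE energy low Tu u0.
  by exists w; exact: (singular_top_vector g_kac_moody energy low sw w0).
have [v v0] := irr.1; have [m0 [topv low]] := lowest_degree_exists energy v0.
have [w [p [la [sw w0 ww]]]] := highest_weight_exists g_kac_moody g_triangular B_inv
  iota_par power0 hM hY YE energy low irr topv.
split.
  exact: (highest_weight_integrable g_kac_moody g_triangular B_inv iota_par power0
    hM hY YE energy low irr sw w0 ww dE).
exact: (highest_weight_conclusion g_kac_moody hM energy low irr sw w0 ww dE).
Qed.
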